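(* Let $S\subset\mathbb{N}^\times\setminus\{1\}$ be a family of pairwise relatively prime natural numbers, $P=\langle S\rangle\subset\mathbb{N}^\times$ the monoid generated by $S$, acting on $\mathbb{Z}$ by multiplication $\theta_p(m)=pm$. For every $n\in P$ with $2\leq n<\infty$, the group ${\rm Aut}_{\mathcal{O}_n}\mathcal{Q}(\mathbb{Z}\rtimes P)$ is a subgroup of ${\rm Aut}_{C^*(\mathbb{Z})}\mathcal{Q}(\mathbb{Z}\rtimes P)\cong{\rm Hom}_\theta(P,C(\mathbb{T},\mathbb{T}))$. For $\psi\in{\rm Hom}_\theta(P,C(\mathbb{T},\mathbb{T}))$, the automorphism $\beta_\psi$ belongs to ${\rm Aut}_{\mathcal{O}_n}\mathcal{Q}(\mathbb{Z}\rtimes P)$ if and only if $\psi\in{\rm Hom}(P,\mathbb{T})$ with $\psi_n=1$, that is, $\beta_\psi=\gamma_\chi$ for some $\chi\in T$ with $\chi(n)=1$.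
   Context: $\mathcal{Q}(\mathbb{Z}\rtimes P)$ is the universal $C^*$-algebra generated by a unitary $u$ and isometries $s_p$, $p\in P$, with $s_ps_q=s_{pq}$ and $s_1=1$, subject to (I) $s_pu^m=u^{pm}s_p$ for $m\in\mathbb{Z}$; (II) $s_p^*u^ms_q=u^{m_1}s_{p'}s_{q'}^*u^{m_2}$ if $m=pm_1+qm_2$ and $pP\cap qP=pp'P$, $pp'=qq'$, and $s_p^*u^ms_q=0$ if $m\notin p\mathbb{Z}+q\mathbb{Z}$; (III) $\sum_{m=0}^{p-1}u^ms_ps_p^*u^{-m}=1$ for all $p\in P$. $C^*(\mathbb{Z})\cong C(\mathbb{T})$ is identified with the $C^*$-subalgebra generated by $u$ ($u$ corresponding to the coordinate function $z$), and $\mathcal{O}_n=C^*(\{u^ks_n\mid 0\leq k\leq n-1\})$. For a $C^*$-subalgebra $B$, ${\rm Aut}_B\mathcal{Q}(\mathbb{Z}\rtimes P)$ is the group of $*$-automorphisms fixing $B$ pointwise. ${\rm Hom}_\theta(P,C(\mathbb{T},\mathbb{T}))$ is the group, under pointwise multiplication, of maps $\psi\colon P\to C(\mathbb{T},\mathbb{T})$, $p\mapsto\psi_p$, with $\psi_{pq}(z)=\psi_p(z)\psi_q(z^p)$ for all $p,q\in P$, $z\in\mathbb{T}$. The isomorphism ${\rm Hom}_\theta(P,C(\mathbb{T},\mathbb{T}))\cong{\rm Aut}_{C^*(\mathbb{Z})}\mathcal{Q}(\mathbb{Z}\rtimes P)$ is $\psi\mapsto\beta_\psi$, where $\beta_\psi(u)=u$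 and $\beta_\psi(s_p)=\psi_p(u)s_p$. ${\rm Hom}(P,\mathbb{T})$ (monoid homomorphisms $P\to\mathbb{T}$) is regarded as the subgroup of those $\psi$ for which every $\psi_p$ is a constant function. $T$ is the Pontryagin dual of the Grothendieck group $P^{-1}P$, and $\gamma\colon T\curvearrowright\mathcal{Q}(\mathbb{Z}\rtimes P)$ is the gauge action $\gamma_\chi(u)=u$, $\gamma_\chi(s_p)=\chi(p)s_p$. *)

(* Defs.v *)
From HB Require Import structures.
From mathcomp Require Import all_boot all_order all_algebra.
From mathcomp Require Import complex.
From mathcomp Require Import all_classical all_reals all_analysis.

Set Implicit Arguments.
Unset Strict Implicit.
Unset Printing Implicit Defensive.

Import Order.TTheory GRing.Theory Num.Theory.
Import numFieldNormedType.Exports.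

Local Open Scope classical_set_scope.
Local Open Scope ring_scope.
Local Open Scope complex_scope.

(* Unital C*-algebras. The real-valued norm [cnorm] is bundled here because
   MathComp's rings and MathComp-Analysis' normed modules have no common
   structure below the number fields, so that a normed algebra cannot be
   declared as a join of the two; completeness is therefore spelled out. *)
HB.mixin Record isCStarAlgebra (R : realType) A & GRing.Algebra R[i] A := {
  star : A -> A ;
  cnorm : A -> R ;
  starD : {morph star : x y / x + y} ;
  starZ : forall (a : R[i]) (x : A), star (a *: x) = a^* *: star x ;
  starM : forall x y : A, star (x * y) = star y * star x ;
  starK : involutive star ;
  cnormD : forall x y : A, cnorm (x + y) <= cnorm x + cnorm y ;
  cnormZ : forall (a : R[i]) (x : A), (cnorm (a *: x))%:C = `|a| * (cnorm x)%:C ;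
  cnorm_eq0 : forall x : A, cnorm x = 0 -> x = 0 ;
  cnormM : forall x y : A, cnorm (x * y) <= cnorm x * cnorm y ;
  cstar_identity : forall x : A, cnorm (star x * x) = cnorm x ^+ 2 ;
  cnorm_complete : forall x : nat -> A,
    (forall e : R, 0 < e ->
       exists N, forall m n, (N <= m)%N -> (N <= n)%N -> cnorm (x m - x n) < e) ->
    exists l, (fun n => cnorm (x n - l)) @ \oo --> (0 : R)
}.

#[short(type="cstarAlgType")]
HB.structure Definition CStarAlgebra (R : realType) :=
  {A of isCStarAlgebra R A & GRing.Algebra R[i] A}.

Section CStar.
Variable R : realType.

Definition star_hom (A B : cstarAlgType R) (f : A -> B) : Prop :=
  [/\ linear f, f 1 = 1, {morph f : x y / x * y} & {morph f : x / star x}].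

Definition cstar_subalg (A : cstarAlgType R) (B : set A) : Prop :=
  [/\ forall (a : R[i]) x y, B x -> B y -> B (a *: x + y),
      forall x y, B x -> B y -> B (x * y),
      forall x, B x -> B (star x),
      B 0 &
      forall (x : nat -> A) l, (forall n, B (x n)) ->
        (fun n => cnorm (x n - l)) @ \oo --> (0 : R) -> B l].

Definition cstar_gen (A : cstarAlgType R) (X : set A) : set A :=
  smallest (@cstar_subalg A) X.

Definition star_aut (A : cstarAlgType R) : set (A -> A) :=
  [set f | star_hom f /\ bijective f].

Definition Aut_fix (A : cstarAlgType R) (B : set A) : set (A -> A) :=
  [set f | star_aut f /\ forall x, B x -> f x = x].

Definition unitary (A : cstarAlgType R) (u : A) : Prop :=
  star u * u = 1 /\ u * star u = 1.

(* [zpow u m] is [u ^ m] for a unitary [u], whose inverse is [star u]. *)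
Definition zpow (A : cstarAlgType R) (u : A) (m : int) : A :=
  match m with Posz k => u ^+ k | Negz k => star u ^+ k.+1 end.

End CStar.

Definition is_comp_group (T : Type) (G : set (T -> T)) : Prop :=
  [/\ G id, forall f g, G f -> G g -> G (f \o g) &
      forall f, G f -> exists g, [/\ G g, cancel f g & cancel g f]].

Definition is_comp_subgroup (T : Type) (H G : set (T -> T)) : Prop :=
  [/\ is_comp_group G, is_comp_group H & H `<=` G].

Section Circle.
Variable R : realType.

Definition circle_set : set R[i]^o := [set z | `|z| = 1].
(* [circle] is topologized as a subspace of [R[i]]. *)
Definition circle := set_type circle_set.

HB.instance Definition _ := Topological.on circle.

Lemma circle_mul_subproof (z w : circle) :
  set_val z * set_val w \in circle_set.
Proof.
by apply/mem_set; rewrite /circle_set/= normrM (set_mem (valP z))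
  (set_mem (valP w)) mulr1.
Qed.

Lemma circle_one_subproof : (1 : R[i]) \in circle_set.
Proof. by apply/mem_set; rewrite /circle_set/= normr1. Qed.

Lemma circle_inv_subproof (z : circle) : (set_val z)^-1 \in circle_set.
Proof.
by apply/mem_set; rewrite /circle_set/= normfV (set_mem (valP z)) invr1.
Qed.

Definition circle_mul (z w : circle) : circle := SigSub (circle_mul_subproof z w).
Definition circle_one : circle := SigSub circle_one_subproof.
Definition circle_inv (z : circle) : circle := SigSub (circle_inv_subproof z).

Fact circle_mulA : associative circle_mul.
Proof. by move=> x y z; apply/val_inj; rewrite /= mulrA. Qed.
Fact circle_left1 : left_id circle_one circle_mul.
Proof. by move=> x; apply/val_inj; rewrite /= mul1r. Qed.
Fact circle_right1 : right_id circle_one circle_mul.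
Proof. by move=> x; apply/val_inj; rewrite /= mulr1. Qed.
Fact circle_neq0 (z : circle) : set_val z != 0.
Proof. by rewrite -normr_eq0 (set_mem (valP z)) oner_eq0. Qed.
Fact circle_mulV : left_inverse circle_one circle_inv circle_mul.
Proof. by move=> x; apply/val_inj; rewrite /= mulVf // circle_neq0. Qed.
Fact circle_mulrV : right_inverse circle_one circle_inv circle_mul.
Proof. by move=> x; apply/val_inj; rewrite /= mulfV // circle_neq0. Qed.

HB.instance Definition _ := isGroup.Build circle
  circle_mulA circle_left1 circle_right1 circle_mulV circle_mulrV.

End Circle.

Section FunctionalCalculus.
Variables (R : realType) (A : cstarAlgType R).

(* [Phi] is the unital star-homomorphism [C(T) -> A] sending the coordinate
   function to [u]; only its values at continuous functions matter. *)
Definition is_calculus (u : A) (Phi : (circle R -> R[i]^o) -> A) : Prop :=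
  [/\ forall (a : R[i]) (f g : circle R -> R[i]^o),
        continuous f -> continuous g ->
        Phi (fun z => a * f z + g z) = a *: Phi f + Phi g,
      forall f g : circle R -> R[i]^o, continuous f -> continuous g ->
        Phi (fun z => f z * g z) = Phi f * Phi g,
      forall f : circle R -> R[i]^o, continuous f ->
        Phi (fun z => (f z)^*) = star (Phi f),
      Phi (fun=> 1) = 1 &
      Phi (fun z => set_val z) = u].

(* [cfc u f] is [f(u)], for [u] unitary and [f] continuous. *)
Definition cfc (u : A) (f : circle R -> R[i]^o) : A :=
  xget 0 [set y | exists2 Phi, is_calculus u Phi & y = Phi f].

End FunctionalCalculus.

Section Monoid.
Variable S : set nat.

Definition mul_closed (M : set nat) : Prop :=
  M 1%N /\ forall p q, M p -> M q -> M (p * q)%N.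

Definition gen_monoid_set : set nat := smallest mul_closed S.
Definition gen_monoid := set_type gen_monoid_set.

HB.instance Definition _ := Choice.on gen_monoid.

Lemma gen_monoid_one_subproof : 1%N \in gen_monoid_set.
Proof. by apply/mem_set => M [[]]. Qed.

Lemma gen_monoid_mul_subproof (p q : gen_monoid) :
  (set_val p * set_val q)%N \in gen_monoid_set.
Proof.
apply/mem_set => M MS.
by have /(_ M MS) Mp := set_mem (valP p); have /(_ M MS) Mq := set_mem (valP q);
  case: MS => -[_ +] _; apply.
Qed.

Definition gen_monoid_one : gen_monoid := SigSub gen_monoid_one_subproof.
Definition gen_monoid_mul (p q : gen_monoid) : gen_monoid :=
  SigSub (gen_monoid_mul_subproof p q).

Fact gen_monoid_mulA : associative gen_monoid_mul.
Proof. by move=> p q r; apply/val_inj; rewrite /= mulnA. Qed.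
Fact gen_monoid_left1 : left_id gen_monoid_one gen_monoid_mul.
Proof. by move=> p; apply/val_inj; rewrite /= mul1n. Qed.
Fact gen_monoid_right1 : right_id gen_monoid_one gen_monoid_mul.
Proof. by move=> p; apply/val_inj; rewrite /= muln1. Qed.

HB.instance Definition _ := isMonoid.Build gen_monoid
  gen_monoid_mulA gen_monoid_left1 gen_monoid_right1.

Definition nat_of_gen (p : gen_monoid) : nat := set_val p.

(* The right ideal [pP]. *)
Definition pideal (p : gen_monoid) : set gen_monoid :=
  [set (p * x)%g | x in [set: gen_monoid]].

(* [P^-1 P], realized in the multiplicative group of nonzero rationals
   (provided that [0] is not in [S]). *)
Definition frac_set : set rat :=
  [set x | exists p q : gen_monoid,
     x = (nat_of_gen p)%:R / (nat_of_gen q)%:R].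
Definition frac_group := set_type frac_set.

Lemma frac_of_subproof (p : gen_monoid) :
  ((nat_of_gen p)%:R : rat) \in frac_set.
Proof. by apply/mem_set; exists p, 1%g; rewrite divr1. Qed.

Definition frac_of (p : gen_monoid) : frac_group := SigSub (frac_of_subproof p).

Variable R : realType.

(* [frac_group] is discrete: its Pontryagin dual consists of all the
   homomorphisms to the circle. *)
Definition dual_frac : set (frac_group -> circle R) :=
  [set chi : frac_group -> circle R | forall x y xy : frac_group,
     set_val xy = set_val x * set_val y ->
     chi xy = (chi x * chi y)%g].

Definition Hom_theta : set (gen_monoid -> circle R -> circle R) :=
  [set psi : gen_monoid -> circle R -> circle R |
     (forall p, continuous (psi p)) /\
     forall p q z, psi (p * q)%g z = (psi p z * psi q (z ^+ nat_of_gen p))%g].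

(* [Hom(P, T)], a homomorphism being identified with the family of constant
   functions that it defines. *)
Definition Hom_circle : set (gen_monoid -> circle R -> circle R) :=
  [set psi : gen_monoid -> circle R -> circle R |
     exists chi : gen_monoid -> circle R,
     [/\ chi 1%g = 1%g, forall p q, chi (p * q)%g = (chi p * chi q)%g &
         psi = fun p _ => chi p]].

End Monoid.

Coercion nat_of_gen : gen_monoid >-> nat.

Section Q.
Variables (R : realType) (S : set nat).
Local Notation P := (gen_monoid S).

Record Q_relations (A : cstarAlgType R) (u : A) (s : P -> A) : Prop := {
  Q_unitary : unitary u ;
  Q_isometry : forall p, star (s p) * s p = 1 ;
  Q_mul : forall p q, s (p * q)%g = s p * s q ;
  Q_one : s 1%g = 1 ;
  Q_I : forall p (m : int), s p * zpow u m = zpow u (p%:Z * m) * s p ;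
  Q_II : forall (p q p' q' : P) (m m1 m2 : int),
    m = p%:Z * m1 + q%:Z * m2 ->
    pideal p `&` pideal q = pideal (p * p')%g -> (p * p' = q * q')%g ->
    star (s p) * zpow u m * s q
      = zpow u m1 * s p' * star (s q') * zpow u m2 ;
  Q_II0 : forall (p q : P) (m : int),
    ~ (exists m1 m2 : int, m = p%:Z * m1 + q%:Z * m2) ->
    star (s p) * zpow u m * s q = 0 ;
  Q_III : forall p : P,
    \sum_(m < p) zpow u m * s p * star (s p) * zpow u (- m%:Z) = 1
}.

Definition is_universal_Q (A : cstarAlgType R) (u : A) (s : P -> A) : Prop :=
  [/\ Q_relations u s,
      cstar_gen ([set u] `|` range s) = setT &
      forall (B : cstarAlgType R) (v : B) (t : P -> B), Q_relations v t ->
        exists f : A -> B, [/\ star_hom f, f u = v & forall p, f (s p) = t p]].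

Variables (A : cstarAlgType R) (u : A) (s : P -> A).

Definition O_alg (n : P) : set A :=
  cstar_gen [set zpow u k%:Z * s n | k in [set k : nat | (k < n)%N]].

Definition is_beta (beta : (P -> circle R -> circle R) -> A -> A) : Prop :=
  [/\ set_bij (@Hom_theta S R) (Aut_fix (cstar_gen [set u])) beta,
      forall psi1 psi2, Hom_theta psi1 -> Hom_theta psi2 ->
        beta (fun p z => psi1 p z * psi2 p z)%g = beta psi1 \o beta psi2 &
      forall psi, Hom_theta psi -> beta psi u = u /\
        forall p, beta psi (s p) = cfc u (fun z => set_val (psi p z)) * s p].

Definition is_gauge_action (gamma : (frac_group S -> circle R) -> A -> A) : Prop :=
  [/\ forall chi, dual_frac chi -> star_aut (gamma chi),
      forall chi1 chi2, dual_frac chi1 -> dual_frac chi2 ->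
        gamma (fun x => chi1 x * chi2 x)%g = gamma chi1 \o gamma chi2 &
      forall chi, dual_frac chi -> gamma chi u = u /\
        forall p, gamma chi (s p) = (set_val (chi (frac_of p)) : R[i]) *: s p].

End Q.

(* Main.v *)
Require Import Defs.
From HB Require Import structures.
From mathcomp Require Import all_boot all_order all_algebra.
From mathcomp Require Import complex.
From mathcomp Require Import all_classical all_reals all_analysis.
From mathcomp Require Import ring lra zify.

(** Every cocycle [psi] defines an endomorphism [beta psi]: the elements
    [psi_p(u) s_p] satisfy the defining relations again, because
    [s_p f(u) = f(u^p) s_p] and the cocycle identity compensate each other
    ([twist_relations]). The constant cocycles give the gauge action.

    Conversely, let [phi] be an automorphism fixing [u]. The element
    [w_p = sum_(m < p) u^m phi(s_p) s_p^* u^-m] is a unitary which commutes with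
    [u], and [phi(s_p) = w_p s_p]. It is of the form [psi_p(u)] because [C*(u)] is
    maximal abelian ([masa]) and is an isometric copy of the algebra of continuous
    functions on the circle ([cabs_le_cfc], [cfc_surj]); multiplicativity of [phi]
    is then the cocycle identity ([beta_surj]).

    That [C*(u)] is maximal abelian uses the gauge action, hence universality. By
    spectral synthesis ([synthesis]) it suffices to consider an element [x] which
    commutes with [u] and is homogeneous. If its degree is [1], it is approximated
    by combinations of elements [u^a s_r s_r^* u^b], and averaging over the
    conjugates by the powers of [u] turns these into polynomials in [u]
    ([masa_deg0]). If its degree is a fraction [p / q] other than [1], then
    [u^(pM) x] is close to [x u^(qM)] for all [M], after expanding the fraction;
    so [x^* x = f(u)] is almost annihilated by all the [z^(pM) - z^(qM)], which
    forces [f] to vanish ([masa_deg_neq0]).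

    An automorphism [phi] fixing [O_n] fixes [u]: the element
    [y = u phi(u)^* - 1] satisfies [y = s_n y s_n^*], hence [y = s_N y s_N^*] for
    all powers [N] of [n]. By synthesis again [y] may be assumed homogeneous, of
    degree [p / q] say. Since [s_N^* u^p s_N = 0] for [N > p], the product
    [y^* u^p y] vanishes, although [u^p y] is close to [y u^q]: so [y = 0]
    ([rigid]). Therefore [phi = beta psi] with [psi_n = 1], and the cocycle identity
    for [p n = n p] reads [psi_p(z) = psi_p(z^n)]. A continuous function with
    this invariance is constant ([Hom_theta_const]).

    The estimates on norms all come from the C*-identity. The norm of a normal
    element is recovered from its powers [2 ^ k], and an estimate which loses a
    factor polynomial in the exponent becomes sharp in the limit; this gives the
    supremum norm as the norm of [p(u)] in both directions ([cnorm_peval_le],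
    [cabs_horner_le]). Continuity arguments on the circle and on the dual torus both
    rest on the Fejer kernel restricted to roots of unity ([fejer_approx]), so that
    only finite averages of automorphisms are needed. *)

Set Implicit Arguments.
Unset Strict Implicit.
Unset Printing Implicit Defensive.

Import Order.TTheory GRing.Theory Num.Theory.
Import numFieldNormedType.Exports.

Local Open Scope classical_set_scope.
Local Open Scope ring_scope.
Local Open Scope complex_scope.

Local Notation Re := complex.Re.
Local Notation Im := complex.Im.

(** * Moduli and norms *)

Section Modulus.
Variable R : realType.
Implicit Types a b : R[i].

Definition cabs a : R := Re `|a|.

Lemma cabsE a : (cabs a)%:C = `|a|.
Proof. by rewrite /cabs RRe_real // normr_real. Qed.

Lemma cabs_ge0 a : 0 <= cabs a.
Proof. by rewrite -lecR cabsE normr_ge0. Qed.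

Lemma cabsM a b : cabs (a * b) = cabs a * cabs b.
Proof. by apply: complexI; rewrite rmorphM !cabsE normrM. Qed.

Lemma cabs1 : cabs 1 = 1.
Proof. by apply: complexI; rewrite cabsE normr1. Qed.

Lemma cabs0 : cabs 0 = 0.
Proof. by apply: complexI; rewrite cabsE normr0. Qed.

Lemma cabs_eq0 a : cabs a = 0 -> a = 0.
Proof. by move=> h; apply/eqP; rewrite -normr_eq0 -cabsE h. Qed.

Lemma cabs1_neq0 a : cabs a = 1 -> a != 0.
Proof. by apply: contra_eq_neq => ->; rewrite cabs0 eq_sym oner_eq0. Qed.

Lemma cabsX a n : cabs (a ^+ n) = cabs a ^+ n.
Proof. by elim: n => [|n IH]; rewrite ?expr0 ?cabs1 // !exprS cabsM IH. Qed.

Lemma cabsD a b : cabs (a + b) <= cabs a + cabs b.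
Proof. by rewrite -lecR rmorphD !cabsE ler_normD. Qed.

Lemma cabsN a : cabs (- a) = cabs a.
Proof. by apply: complexI; rewrite !cabsE normrN. Qed.

Lemma cabsB a b : cabs (a - b) <= cabs a + cabs b.
Proof. by rewrite -(cabsN b) cabsD. Qed.

Lemma cabs_distrC a b : cabs (a - b) = cabs (b - a).
Proof. by rewrite -cabsN opprB. Qed.

Lemma cabs_dist a b : cabs a <= cabs b + cabs (a - b).
Proof. by rewrite -{1}(subrK b a) addrC cabsD. Qed.

Lemma cabsJ a : cabs (conjc a) = cabs a.
Proof. by apply: complexI; rewrite !cabsE normcJ. Qed.

Lemma cabsV a : cabs a^-1 = (cabs a)^-1.
Proof. by apply: complexI; rewrite fmorphV !cabsE normfV. Qed.

Lemma cabs_real (x : R) : cabs x%:C = `|x|.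
Proof. by apply: complexI; rewrite cabsE normc_def /= expr0n addr0 sqrtr_sqr. Qed.

Lemma cabs_nat n : cabs n%:R = n%:R.
Proof. by rewrite -[n%:R](rmorph_nat (real_complex R)) cabs_real ger0_norm. Qed.

Lemma cabs_sum (I : Type) (r : seq I) (P : pred I) (F : I -> R[i]) :
  cabs (\sum_(i <- r | P i) F i) <= \sum_(i <- r | P i) cabs (F i).
Proof.
elim/big_rec2: _ => [|i x y _ h]; first by rewrite cabs0.
by apply: le_trans (cabsD _ _) _; rewrite lerD2l.
Qed.

Lemma sqr_cabs a : a * conjc a = (cabs a ^+ 2)%:C.
Proof. by rewrite -sqr_normc rmorphXn /= cabsE. Qed.

Lemma cabs_Re a : `|Re a| <= cabs a.
Proof. by rewrite -lecR cabsE normc_ge_Re. Qed.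

Lemma cabs_sqrt a : cabs a = Num.sqrt (Re a ^+ 2 + Im a ^+ 2).
Proof. by rewrite /cabs normc_def. Qed.

Lemma cabs_Im a : `|Im a| <= cabs a.
Proof. by rewrite cabs_sqrt -sqrtr_sqr ler_wsqrtr // lerDr sqr_ge0. Qed.

Lemma conjcE a : Num.conj a = conjc a.
Proof.
have [->|a0] := eqVneq a 0; first by rewrite conjc0 conjC0.
by apply: (mulfI a0); rewrite -normCK sqr_normc.
Qed.

Lemma real_complexM (x y : R) : (x * y)%:C = x%:C * y%:C.
Proof. exact: rmorphM. Qed.

End Modulus.

Lemma le_eps (R : realType) (x y : R) : (forall e : R, 0 < e -> x <= y + e) -> x <= y.
Proof. by move=> h; apply/ler_addgt0Pr => e e0; exact: h. Qed.

Section Norm.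
Variables (R : realType) (A : cstarAlgType R).
Implicit Types (x y z u v : A) (a : R[i]) (e : R).

Lemma cnormZE a x : cnorm (a *: x) = cabs a * cnorm x.
Proof. by apply: complexI; rewrite rmorphM /= cabsE cnormZ. Qed.

Lemma cnorm0 : cnorm (0 : A) = 0.
Proof. by rewrite -(scale0r (0 : A)) cnormZE cabs0 mul0r. Qed.

Lemma cnormN x : cnorm (- x) = cnorm x.
Proof. by rewrite -scaleN1r cnormZE cabsN cabs1 mul1r. Qed.

Lemma cnorm_ge0 x : 0 <= cnorm x.
Proof. by have := cnormD x (- x); rewrite subrr cnorm0 cnormN; lra. Qed.

Lemma cnormB x y : cnorm (x - y) <= cnorm x + cnorm y.
Proof. by rewrite -(cnormN y) cnormD. Qed.

Lemma cnorm_distC x y : cnorm (x - y) = cnorm (y - x).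
Proof. by rewrite -cnormN opprB. Qed.

Lemma cnorm_dist x y : cnorm x <= cnorm y + cnorm (x - y).
Proof. by rewrite -{1}(subrK y x) addrC cnormD. Qed.

Lemma cnorm_trans y x z : cnorm (x - z) <= cnorm (x - y) + cnorm (y - z).
Proof. by rewrite -{1}(subrK y x) -addrA cnormD. Qed.

Lemma cnorm_sum (I : Type) (r : seq I) (P : pred I) (F : I -> A) :
  cnorm (\sum_(i <- r | P i) F i) <= \sum_(i <- r | P i) cnorm (F i).
Proof.
elim/big_rec2: _ => [|i x y _ h]; first by rewrite cnorm0.
by apply: le_trans (cnormD _ _) _; rewrite lerD2l.
Qed.

Lemma cnorm_small x : (forall e, 0 < e -> cnorm x <= e) -> x = 0.
Proof.
move=> h; apply: cnorm_eq0; apply/eqP; rewrite eq_le cnorm_ge0 andbT.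
by apply: le_eps => e e0; rewrite add0r h.
Qed.

Lemma starZE a x : star (a *: x) = conjc a *: star x.
Proof. by rewrite starZ conjcE. Qed.

Lemma star0 : star (0 : A) = 0.
Proof. by apply: (addrI (star 0)); rewrite addr0 -starD addr0. Qed.

Lemma starN x : star (- x) = - star x.
Proof. by apply: (addrI (star x)); rewrite subrr -starD subrr star0. Qed.

Lemma starB x y : star (x - y) = star x - star y.
Proof. by rewrite starD starN. Qed.

Lemma star1 : star (1 : A) = 1.
Proof. by rewrite -[LHS]mul1r -{1}(starK (1 : A)) -starM mul1r starK. Qed.

Lemma starX x n : star (x ^+ n) = star x ^+ n.
Proof. by elim: n => [|n IH]; rewrite ?expr0 ?star1 // exprSr starM IH exprS. Qed.

Lemma star_sum (I : Type) (r : seq I) (P : pred I) (F : I -> A) :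
  star (\sum_(i <- r | P i) F i) = \sum_(i <- r | P i) star (F i).
Proof. exact: (big_morph _ starD star0). Qed.

Lemma cnorm_star x : cnorm (star x) = cnorm x.
Proof.
suff H y : cnorm y <= cnorm (star y).
  by apply/eqP; rewrite eq_le H -{2}(starK x) H.
have [->|y0] := eqVneq (cnorm y) 0; first exact: cnorm_ge0.
have yp : 0 < cnorm y by rewrite lt_def y0 cnorm_ge0.
have := cnormM (star y) y; rewrite cstar_identity expr2.
by rewrite ler_pM2r.
Qed.

Lemma cstar_identity' x : cnorm (x * star x) = cnorm x ^+ 2.
Proof. by rewrite -{1}(starK x) cstar_identity cnorm_star. Qed.

Lemma cnorm_neq0 x : x != 0 -> cnorm x != 0.
Proof. by apply: contra_neq => /cnorm_eq0. Qed.

Lemma cnorm1 : cnorm (1 : A) = 1.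
Proof.
have := cstar_identity (1 : A); rewrite star1 mul1r expr2 -{1}[cnorm 1]mulr1.
by move=> /(mulfI (cnorm_neq0 (oner_neq0 A))).
Qed.

Lemma cnorm_isometry x : star x * x = 1 -> cnorm x = 1.
Proof.
move=> h; have := cstar_identity x; rewrite h cnorm1 => /esym/eqP.
by rewrite sqrf_eq1 => /orP[/eqP//|/eqP e]; have := cnorm_ge0 x; rewrite e; lra.
Qed.

Lemma cnorm_isoM x y : star x * x = 1 -> cnorm (x * y) = cnorm y.
Proof.
move=> h; apply: (@pexpIrn _ 2%N) => //; rewrite ?nnegrE ?cnorm_ge0 //.
by rewrite -!cstar_identity starM mulrA -(mulrA (star y)) h mulr1.
Qed.

Lemma cnormM_coiso x y : star x * x = 1 -> cnorm (y * star x) = cnorm y.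
Proof. by move=> h; rewrite -cnorm_star starM starK cnorm_isoM // cnorm_star. Qed.

Lemma cnormM_unitary x y : x * star x = 1 -> cnorm (y * x) = cnorm y.
Proof. by move=> h; rewrite -{1}(starK x) cnormM_coiso // starK. Qed.

Lemma cnorm_compress v w x : star v * v = 1 -> star w * w = 1 ->
  cnorm (star v * x * w) <= cnorm x.
Proof.
move=> hv hw; apply: le_trans (cnormM _ _) _; rewrite (cnorm_isometry hw) mulr1.
by apply: le_trans (cnormM _ _) _; rewrite cnorm_star (cnorm_isometry hv) mul1r.
Qed.

Lemma cnormX x n : cnorm (x ^+ n) <= cnorm x ^+ n.
Proof.
elim: n => [|n IH]; first by rewrite !expr0 cnorm1.
by rewrite !exprS; apply: le_trans (cnormM _ _) _; rewrite ler_wpM2l ?cnorm_ge0.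
Qed.

Lemma cnorm_normal_sqr x : star x * x = x * star x -> cnorm (x ^+ 2) = cnorm x ^+ 2.
Proof.
move=> nx; apply: (@pexpIrn _ 2%N) => //; rewrite ?nnegrE ?exprn_ge0 ?cnorm_ge0 //.
rewrite -(cstar_identity (x ^+ 2)) starX -exprMn_comm //.
have h : star (star x * x) = star x * x by rewrite starM starK.
by rewrite expr2 -{1}h !cstar_identity.
Qed.

(** The C*-identity alone shows that squaring a normal element squares its norm. *)
Lemma cnorm_normal_pow2 x k : star x * x = x * star x ->
  cnorm (x ^+ (2 ^ k)) = cnorm x ^+ (2 ^ k).
Proof.
move=> nx; elim: k => [|k IH]; first by rewrite expn0 !expr1.
rewrite expnSr !exprM cnorm_normal_sqr ?IH // starX.
by apply: commrX; apply: commr_sym; apply: commrX; apply: commr_sym.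
Qed.

Definition cconv (x : nat -> A) (l : A) : Prop :=
  forall e, 0 < e -> exists N, forall n, (N <= n)%N -> cnorm (x n - l) < e.

Lemma cconvP (x : nat -> A) l :
  (fun n => cnorm (x n - l)) @ \oo --> (0 : R) <-> cconv x l.
Proof.
split=> [/cvgrPdist_lt h e e0|h].
  have [N _ hN] := h e e0; exists N => n Nn.
  by have := hN n Nn; rewrite /= sub0r normrN ger0_norm ?cnorm_ge0.
apply/cvgrPdist_lt => e e0; have [N hN] := h e e0.
by exists N => // n Nn; rewrite /= sub0r normrN ger0_norm ?cnorm_ge0 // hN.
Qed.

Lemma cconv_cauchy (x : nat -> A) :
  (forall e, 0 < e ->
     exists N, forall m n, (N <= m)%N -> (N <= n)%N -> cnorm (x m - x n) < e) ->
  exists l, cconv x l.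
Proof. by move=> /cnorm_complete[l /cconvP h]; exists l. Qed.

(** Norm-closedness without sequences, for predicates defined by approximation. *)
Definition cclosed (B : set A) : Prop :=
  forall l, (forall e, 0 < e -> exists2 y, B y & cnorm (l - y) < e) -> B l.

Definition csubspace (B : set A) : Prop :=
  forall a x y, B x -> B y -> B (a *: x + y).

Lemma cclosed_lim B (x : nat -> A) l : cclosed B -> (forall n, B (x n)) -> cconv x l -> B l.
Proof.
move=> cB Bx xl; apply: cB => e /xl[N hN]; exists (x N) => //.
by rewrite cnorm_distC hN.
Qed.

Lemma natr_inv_lt e : 0 < e -> exists N, forall n, (N <= n)%N -> n.+1%:R^-1 < e.
Proof.
move=> e0; exists (Num.truncn e^-1) => n Nn.
rewrite invf_plt ?posrE //; apply: lt_le_trans (truncnS_gt _) _.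
by rewrite ler_nat ltnS.
Qed.

Lemma subalg_cclosed B : cstar_subalg B -> cclosed B.
Proof.
move=> [_ _ _ _ clB] l h.
have h' (n : nat) : exists y, B y /\ cnorm (l - y) < n.+1%:R^-1.
  by have [//|y By yl] := h n.+1%:R^-1; exists y.
pose x n := sval (cid (h' n)).
have hx n : B (x n) /\ cnorm (l - x n) < n.+1%:R^-1 by rewrite /x; case: cid.
apply: (clB x) => [n|]; first by case: (hx n).
apply/cconvP => e e0; have [N hN] := natr_inv_lt e0.
exists N => n Nn; rewrite cnorm_distC; apply: lt_trans (hN n Nn); by case: (hx n).
Qed.

Lemma cclosed_subalg B : cclosed B -> csubspace B ->
  (forall x y, B x -> B y -> B (x * y)) -> (forall x, B x -> B (star x)) ->
  B 0 -> cstar_subalg B.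
Proof. by move=> cB sB mB stB B0; split=> // x l Bx /cconvP; apply: cclosed_lim. Qed.

Lemma cstar_gen_subalg X : cstar_subalg (cstar_gen X : set A).
Proof.
split.
- by move=> a x y hx hy B [sB XB]; case: (sB) => h _ _ _ _; apply: h; [apply: hx|apply: hy].
- by move=> x y hx hy B [sB XB]; case: (sB) => _ h _ _ _; apply: h; [apply: hx|apply: hy].
- by move=> x hx B [sB XB]; case: (sB) => _ _ h _ _; apply: h; apply: hx.
- by move=> B [[_ _ _ h _] XB].
- move=> x l hx xl B [sB XB]; case: (sB) => _ _ _ _ h; apply: (h x) => // n.
  exact: hx.
Qed.

Lemma cstar_gen_sub X : X `<=` (cstar_gen X : set A).
Proof. by move=> x Xx B [_]; apply. Qed.

Lemma cstar_gen_min X B : cstar_subalg B -> X `<=` B -> (cstar_gen X : set A) `<=` B.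
Proof. by move=> sB XB x; apply. Qed.

End Norm.

Section Equalizer.
Variables (R : realType) (A B : cstarAlgType R).

Lemma cclosed_eq (F G : A -> B) (K L : R) :
  {morph F : x y / x - y} -> {morph G : x y / x - y} ->
  (forall x, cnorm (F x) <= K * cnorm x) -> (forall x, cnorm (G x) <= L * cnorm x) ->
  cclosed [set x | F x = G x].
Proof.
move=> FB GB FK GL l h; apply/eqP; rewrite -subr_eq0; apply/eqP/cnorm_small => e e0.
have M0 : 0 < `|K| + `|L| + 1 by rewrite ltr_wpDl // addr_ge0.
have [y /= FG ly] := h (e / (`|K| + `|L| + 1)) (divr_gt0 e0 M0).
have -> : F l - G l = F (l - y) - G (l - y) by rewrite FB GB FG opprB addrA subrK.
apply: le_trans (cnormB _ _) _.
rewrite ltr_pdivlMr // in ly; have := FK (l - y); have := GL (l - y).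
have := cnorm_ge0 (l - y); have := ler_norm K; have := ler_norm L.
have := normr_ge0 K; have := normr_ge0 L; nra.
Qed.

End Equalizer.

Lemma cclosed_comm (R : realType) (A : cstarAlgType R) (x : A) :
  cclosed [set y : A | y * x = x * y].
Proof.
apply: (@cclosed_eq _ _ _ (fun y => y * x) (fun y => x * y) (cnorm x) (cnorm x)).
- by move=> y z; rewrite mulrBl.
- by move=> y z; rewrite mulrBr.
- by move=> y; rewrite mulrC cnormM.
- by move=> y; rewrite cnormM.
Qed.

(** * Homomorphisms of C*-algebras are contractive *)

Lemma expr_small (R : realType) (r e : R) : 0 <= r -> r < 1 -> 0 < e ->
  exists N, r ^+ N < e.
Proof.
move=> r0 r1 e0.
have /cvgrPdist_lt/(_ e e0)[N _ hN] : (fun n => r ^+ n) @ \oo --> (0 : R).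
  by apply: cvg_expr; rewrite ger0_norm.
exists N; have := hN N (leqnn _).
by rewrite /= sub0r normrN ger0_norm // exprn_ge0.
Qed.

Section SqrtSubSqr.
Variables (R : realType) (A : cstarAlgType R).
Implicit Types (x y z : A) (e : R).

Let half : R[i] := 2%:R^-1.

Let cabs_half : cabs half = 2%:R^-1.
Proof. by rewrite /half cabsV cabs_nat. Qed.

Let addhh x : half *: x + half *: x = x.
Proof. by rewrite -scalerDl -mulr2n -[half *+ 2]mulr_natr mulVf ?scale1r // pnatr_eq0. Qed.

(** The square root of [1 - h ^ 2] is [1 - y], where [y] is the fixed point of
    the contraction [y |-> (h ^ 2 + y ^ 2) / 2] of the ball of radius [|h|]. *)
Lemma sqrt_sub_sqr (h : A) : star h = h -> cnorm h < 1 ->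
  exists g, [/\ star g = g, g * g = 1 - h * h & g * h = h * g].
Proof.
move=> hs h1; set r := cnorm h in h1 *; have r0 : 0 <= r := cnorm_ge0 h.
(* [1 - y] squares to [1 - h ^ 2] when [T y = y]. *)
pose T y := half *: (h * h + y * y).
have Tball y : cnorm y <= r -> cnorm (T y) <= r.
  move=> yr; rewrite /T cnormZE cabs_half.
  have := cnormD (h * h) (y * y); have := cnormM h h; have := cnormM y y.
  have := cnorm_ge0 y; rewrite -/r; nra.
have Tdist y z : cnorm y <= r -> cnorm z <= r -> cnorm (T y - T z) <= r * cnorm (y - z).
  move=> yr zr; rewrite /T -scalerBr cnormZE cabs_half opprD addrACA subrr add0r.
  have -> : y * y - z * z = y * (y - z) + (y - z) * z.
    by rewrite mulrBr mulrBl addrA subrK.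
  have := cnormD (y * (y - z)) ((y - z) * z).
  have := cnormM y (y - z); have := cnormM (y - z) z.
  have := cnorm_ge0 (y - z); have := cnorm_ge0 y; have := cnorm_ge0 z; nra.
pose Y n := iter n T 0.
have Yball n : cnorm (Y n) <= r by elim: n => [|n IH]; rewrite ?cnorm0 ?Tball.
have Ydist m n : cnorm (Y (n + m)%N - Y n) <= r ^+ n.
  elim: n => [|n IH].
    by rewrite subr0 expr0; apply: le_trans (Yball _) (ltW h1).
  rewrite exprS; apply: le_trans (Tdist _ _ (Yball _) (Yball _)) _.
  by rewrite ler_wpM2l.
have [l Yl] : exists l, cconv Y l.
  apply: cconv_cauchy => e e0.
  have [N hN] := @expr_small R r (e / 2%:R) r0 h1 (divr_gt0 e0 (ltr0Sn _ 1)).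
  exists N => m n /subnKC <- /subnKC <-.
  apply: le_lt_trans (cnorm_trans (Y N) _ _) _.
  by rewrite (cnorm_distC (Y N)); have := Ydist (m - N)%N N; have := Ydist (n - N)%N N; lra.
have cl B : cclosed B -> B 0 -> (forall y, B y -> B (T y)) -> B l.
  move=> cB B0 BT; apply: cclosed_lim Yl => // n.
  by elim: n => [|n IH] //; apply: BT.
have lr : cnorm l <= r.
  apply: (cl [set y | cnorm y <= r]); rewrite /= ?cnorm0 // => y hy.
  apply: le_eps => e e0; have [z /= zr yz] := hy e e0.
  by have := cnorm_dist y z; lra.
have ls : star l = l.
  apply: (cl [set y | star y = y]); rewrite /= ?star0 //.
    by apply: (@cclosed_eq _ _ _ (@star R A) id 1 1) => x; rewrite ?mul1r ?cnorm_star // => y; rewrite starB.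
  move=> y ys; rewrite /T starZE starD !starM ys hs; congr (_ *: _).
  by rewrite /half conjc_inv conjc_nat.
have lh : l * h = h * l.
  apply: (cl [set y | y * h = h * y]); rewrite /= ?mulr0 ?mul0r //; first exact: cclosed_comm.
  move=> y ys; rewrite /T -scalerAl -scalerAr mulrDl mulrDr; congr (_ *: (_ + _)).
    by rewrite mulrA.
  by rewrite -mulrA ys !mulrA ys.
have lT : l = T l.
  apply/eqP; rewrite -subr_eq0; apply/eqP/cnorm_small => e e0.
  have [N hN] := Yl (e / 2%:R) (divr_gt0 e0 (ltr0Sn _ 1)).
  have h1' := hN N.+1 (leqnSn _); have h2 := hN N (leqnn _).
  have h3 : cnorm (Y N.+1 - T l) <= r * cnorm (Y N - l) := Tdist _ _ (Yball N) lr.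
  have := cnorm_trans (Y N.+1) l (T l); rewrite (cnorm_distC l (Y N.+1)).
  by have := cnorm_ge0 (Y N - l); nra.
exists (1 - l); split.
- by rewrite starB star1 ls.
- have -> : h * h = l + l - l * l.
    by rewrite {1 2}lT addhh addrK.
  by rewrite mulrBl mul1r mulrBr mulr1 -addrA -opprD addrA.
- by rewrite mulrBl mulrBr mul1r mulr1 lh.
Qed.

End SqrtSubSqr.

Section StarHom.
Variables (R : realType) (A B : cstarAlgType R).
Variable f : A -> B.
Hypothesis hf : star_hom f.

Lemma star_homD x y : f (x + y) = f x + f y.
Proof. by case: hf => fl _ _ _; rewrite -{1}(scale1r x) fl scale1r. Qed.

Lemma star_hom0 : f 0 = 0.
Proof. by apply: (addrI (f 0)); rewrite addr0 -star_homD addr0. Qed.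

Lemma star_homZ a x : f (a *: x) = a *: f x.
Proof. by case: hf => fl _ _ _; rewrite -(addr0 (a *: x)) fl star_hom0 addr0. Qed.

Lemma star_homN x : f (- x) = - f x.
Proof. by rewrite -scaleN1r star_homZ scaleN1r. Qed.

Lemma star_homB x y : f (x - y) = f x - f y.
Proof. by rewrite star_homD star_homN. Qed.

Lemma star_homM x y : f (x * y) = f x * f y.
Proof. by case: hf. Qed.

Lemma star_hom1 : f 1 = 1.
Proof. by case: hf. Qed.

Lemma star_hom_star x : f (star x) = star (f x).
Proof. by case: hf. Qed.

Lemma star_hom_sum (I : Type) (r : seq I) (P : pred I) (F : I -> A) :
  f (\sum_(i <- r | P i) F i) = \sum_(i <- r | P i) f (F i).
Proof. exact: (big_morph _ star_homD star_hom0). Qed.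

Lemma star_homX x n : f (x ^+ n) = f x ^+ n.
Proof. by elim: n => [|n IH]; rewrite ?expr0 ?star_hom1 // !exprS star_homM IH. Qed.

Lemma star_hom_zpow u m : f (zpow u m) = zpow (f u) m.
Proof. by case: m => n; rewrite /= star_homX ?star_hom_star. Qed.

(** A self-adjoint contraction [h] of norm less than [1] is the real part of
    the unitary [h + i sqrt(1 - h ^ 2)], and a homomorphism maps unitaries to
    unitaries: it is therefore automatically contractive. *)
Lemma star_hom_le x : cnorm (f x) <= cnorm x.
Proof.
have sa h : star h = h -> cnorm h < 1 -> cnorm (f h) <= 1.
  move=> hs h1; have [g [gs gg gh]] := sqrt_sub_sqr hs h1.
  pose w := h + 'i%C *: g.
  have ws : star w = h - 'i%C *: g.
    rewrite starD starZE hs gs -scaleNr; congr (_ + _ *: _).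
    by apply/eqP; rewrite eq_complex /= oppr0 !eqxx.
  have ww : star w * w = 1.
    rewrite ws /w mulrDr !mulrBl -!scalerAl -!scalerAr scalerA -(expr2 'i%C) sqr_i scaleN1r gg gh.
    by rewrite opprK addrA subrK addrC subrK.
  have fw : cnorm (f w) = 1.
    by apply: cnorm_isometry; rewrite -star_hom_star -star_homM ww star_hom1.
  have hw : h + h = w + star w by rewrite ws addrACA subrr addr0.
  have : cnorm (f h + f h) <= 2%:R.
    rewrite -star_homD hw star_homD star_hom_star; apply: le_trans (cnormD _ _) _.
    by rewrite cnorm_star fw; lra.
  rewrite -[f h]scale1r -scalerDl cnormZE -mulr2n cabs_nat scale1r; lra.
have sa' h : star h = h -> cnorm (f h) <= cnorm h.
  move=> hs; apply: le_eps => e e0.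
  have p0 : 0 < cnorm h + e by have := cnorm_ge0 h; lra.
  have := sa ((cnorm h + e)^-1%:C *: h).
  rewrite starZE conjc_real hs star_homZ !cnormZE cabs_real ger0_norm ?invr_ge0; last exact: ltW.
  rewrite !(mulrC _^-1) ltr_pdivrMr // ler_pdivrMr // !mul1r.
  by apply => //; lra.
rewrite -(@ler_pXn2r _ 2%N) ?nnegrE ?cnorm_ge0 // -!cstar_identity.
rewrite -star_hom_star -star_homM; apply: sa'.
by rewrite starM starK.
Qed.

End StarHom.

Lemma star_hom_eq_closed (R : realType) (A B : cstarAlgType R) (f g : A -> B) :
  star_hom f -> star_hom g -> cstar_subalg [set x | f x = g x].
Proof.
move=> hf hg; apply: cclosed_subalg => /=.
- apply: (@cclosed_eq _ _ _ f g 1 1) => x; rewrite ?mul1r ?star_hom_le // => y.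
    by rewrite (star_homB hf).
  by rewrite (star_homB hg).
- by move=> a x y /= fx fy; rewrite !(star_homD hf, star_homD hg, star_homZ hf, star_homZ hg) fx fy.
- by move=> x y /= fx fy; rewrite (star_homM hf) (star_homM hg) fx fy.
- by move=> x /= fx; rewrite (star_hom_star hf) (star_hom_star hg) fx.
- by rewrite /= (star_hom0 hf) (star_hom0 hg).
Qed.

Lemma star_hom_eq_gen (R : realType) (A B : cstarAlgType R) (f g : A -> B) (X : set A) :
  star_hom f -> star_hom g -> (forall x, X x -> f x = g x) ->
  forall x, cstar_gen X x -> f x = g x.
Proof. by move=> hf hg fg; apply: cstar_gen_min fg; apply: star_hom_eq_closed. Qed.

Lemma star_hom_id (R : realType) (A : cstarAlgType R) : star_hom (@id A).
Proof. by split. Qed.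

Lemma star_hom_comp (R : realType) (A B D : cstarAlgType R) (f : A -> B) (g : B -> D) :
  star_hom f -> star_hom g -> star_hom (g \o f).
Proof.
move=> hf hg; split => [a x y|||] /=; rewrite ?(star_hom1 hf) ?(star_hom1 hg) //.
- by rewrite (star_homD hf) (star_homD hg) (star_homZ hf) (star_homZ hg).
- by move=> x y /=; rewrite (star_homM hf) (star_homM hg).
- by move=> x /=; rewrite (star_hom_star hf) (star_hom_star hg).
Qed.

Lemma star_hom_inv (R : realType) (A B : cstarAlgType R) (f : A -> B) (g : B -> A) :
  star_hom f -> cancel f g -> cancel g f -> star_hom g.
Proof.
move=> hf fK gK; have fI := can_inj fK; split => [a x y|||].
- by apply: fI; rewrite (star_homD hf) (star_homZ hf) !gK.
- by apply: fI; rewrite gK (star_hom1 hf).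
- by move=> x y; apply: fI; rewrite (star_homM hf) !gK.
- by move=> x; apply: fI; rewrite (star_hom_star hf) !gK.
Qed.

Lemma Aut_fix_group (R : realType) (A : cstarAlgType R) (X : set A) :
  is_comp_group (Aut_fix X).
Proof.
split.
- by split=> //; split; [exact: star_hom_id|exists id].
- move=> f g [[hf bf] fX] [[hg bg] gX]; split; first split.
  + exact: star_hom_comp.
  + exact: bij_comp.
  + by move=> x Xx /=; rewrite gX // fX.
- move=> f [[hf [g fK gK]] fX]; exists g; split=> //.
  split; first by split; [exact: star_hom_inv fK gK|exists f].
  by move=> x Xx; rewrite -{1}(fX x Xx) fK.
Qed.

(** * The unit circle *)

Section Circle.
Variable R : realType.
Local Notation C := R[i].
Local Notation T := (circle R).

Definition cval (z : T) : C := set_val z.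

Lemma cval_abs z : cabs (cval z) = 1.
Proof. by apply: complexI; rewrite cabsE; exact: (set_mem (valP z)). Qed.

Lemma cval_inj : injective cval.
Proof. by move=> z w h; apply: val_inj. Qed.

Lemma cval_neq0 z : cval z != 0.
Proof. exact: circle_neq0. Qed.

Lemma cvalM z w : cval (z * w)%g = cval z * cval w.
Proof. by []. Qed.

Lemma cvalX z n : cval (z ^+ n)%g = cval z ^+ n.
Proof. by elim: n => [|n IH]; rewrite ?expg0 ?expr0 // expgS exprS cvalM IH. Qed.

Fact mkcircle_subproof (a : C) (h : cabs a = 1) : a \in @circle_set R.
Proof. by apply/mem_set; rewrite /circle_set /= -cabsE h. Qed.

Definition mkcircle (a : C) (h : cabs a = 1) : T := SigSub (mkcircle_subproof h).

Lemma mkcircleE a h : cval (@mkcircle a h) = a.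
Proof. by []. Qed.

Lemma conjc_abs1 (a : C) : cabs a = 1 -> conjc a = a^-1.
Proof.
by move=> h; apply: (mulfI (cabs1_neq0 h)); rewrite sqr_cabs h expr1n mulfV // cabs1_neq0.
Qed.

Lemma conjc_cval z : conjc (cval z) = (cval z)^-1.
Proof. exact: conjc_abs1 (cval_abs z). Qed.

Lemma cabs_exprz (a : C) (m : int) : cabs a = 1 -> cabs (a ^ m) = 1.
Proof. by move=> h; case: m => n; rewrite /exprz ?cabsV cabsX h expr1n ?invr1. Qed.

Lemma cabs_i : cabs ('i%C : C) = 1.
Proof. by rewrite cabs_sqrt /= expr0n add0r expr1n sqrtr1. Qed.

Lemma cabs_ReIm (a : C) : cabs a <= `|Re a| + `|Im a|.
Proof.
by rewrite {1}(complexE a); apply: le_trans (cabsD _ _) _; rewrite cabsM cabs_i mul1r !cabs_real.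
Qed.

Definition expi (t : R) : C := cos t +i* sin t.

Lemma expiD s t : expi (s + t) = expi s * expi t.
Proof. by rewrite /expi cosD sinD; simpc; rewrite [sin s * cos t + _]addrC. Qed.

Lemma expi0 : expi 0 = 1.
Proof. by rewrite /expi cos0 sin0. Qed.

Lemma expiMn t n : expi (n%:R * t) = expi t ^+ n.
Proof.
elim: n => [|n IH]; first by rewrite mul0r expi0.
by rewrite -natr1 mulrDl mul1r expiD IH exprSr.
Qed.

Lemma expi_abs t : cabs (expi t) = 1.
Proof. by rewrite cabs_sqrt /= cos2Dsin2 sqrtr1. Qed.

Lemma expi_surj (a : C) : cabs a = 1 -> exists t, [/\ - pi <= t, t <= pi & a = expi t].
Proof.
case: a => x y h.
have hxy : x ^+ 2 + y ^+ 2 = 1.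
  have := sqr_sqrtr (_ : 0 <= x ^+ 2 + y ^+ 2).
  by move: h; rewrite cabs_sqrt /= => ->; rewrite expr1n => <- //; rewrite addr_ge0 ?sqr_ge0.
have x1 : -1 <= x <= 1 by apply/andP; split; nra.
have px := acosK x1; have s2 := sin_acos x1.
have y2 : Num.sqrt (1 - x ^+ 2) = `|y| by rewrite -hxy addrC addKr sqrtr_sqr.
have a0 := acos_ge0 x1; have api := acos_lepi x1; have p0 := @pi_gt0 R.
case: (lerP 0 y) => y0.
- exists (acos x); split=> //; first by lra.
  by rewrite /expi px s2 y2 ger0_norm.
- exists (- acos x); split; [by lra|by lra|].
  by rewrite /expi cosN sinN px s2 y2 ltr0_norm // opprK.
Qed.

Lemma expi_cont (t e : R) : 0 < e ->
  exists2 d : R, 0 < d & forall s, `|s - t| < d -> cabs (expi s - expi t) < e.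
Proof.
move=> e0; have e2 : 0 < e / 2%:R by rewrite divr_gt0.
have /cvgrPdist_lt/(_ _ e2)/nbhs_ballP[d1 /= d10 h1] := @continuous_cos R t.
have /cvgrPdist_lt/(_ _ e2)/nbhs_ballP[d2 /= d20 h2] := @continuous_sin R t.
exists (Num.min d1 d2); first by rewrite lt_min d10 d20.
move=> s; rewrite lt_min distrC => /andP[s1 s2].
apply: le_lt_trans (cabs_ReIm _) _; rewrite /expi /=.
have := h1 s s1; have := h2 s s2.
by rewrite /= (distrC (cos t)) (distrC (sin t)); lra.
Qed.

(** * Roots of unity *)

Definition zeta (N : nat) : C := expi (N%:R^-1 * (2%:R * pi)).

Lemma zeta_abs N : cabs (zeta N) = 1.
Proof. exact: expi_abs. Qed.

Lemma zetaX N m : (0 < N)%N -> zeta N ^+ m = expi (m%:R / N%:R * (2%:R * pi)).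
Proof. by rewrite /zeta -expiMn mulrA. Qed.

Lemma zeta_expN N : (0 < N)%N -> zeta N ^+ N = 1.
Proof.
move=> N0; rewrite zetaX // mulfV ?pnatr_eq0 -?lt0n // mul1r mulr_natl.
by rewrite /expi cos2pi sin2pi.
Qed.

(** The identity [cos t = 1 - 2 sin (t / 2) ^ 2] excludes the value [1] for [0 < t < 2 pi]. *)
Lemma zeta_neq1 N r : (0 < r < N)%N -> zeta N ^+ r != 1.
Proof.
move=> /andP[r0 rN]; have N0 : (0 < N)%N by apply: leq_trans rN.
rewrite zetaX //; set t := r%:R / N%:R.
have t0 : 0 < t by rewrite divr_gt0 ?ltr0n.
have t1 : t < 1 by rewrite ltr_pdivrMr ?ltr0n // mul1r ltr_nat.
have p0 := @pi_gt0 R.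
have : 0 < sin (t * pi) by apply: sin_gt0_pi; apply/andP; split; nra.
move=> s0; apply/eqP => -[]; rewrite mulrCA mulr_natl cos_mulr2n => hc _.
have := cos2Dsin2 (t * pi); move: hc; rewrite mulr2n; nra.
Qed.

Lemma zeta_prim N : (0 < N)%N -> N.-primitive_root (zeta N).
Proof.
move=> N0; rewrite /primitive_root_of_unity N0; apply/forallP => /= i.
rewrite unity_rootE; case: (ltngtP i.+1 N) (ltn_ord i) => // [iN _|iN _].
  by rewrite (negbTE (zeta_neq1 _)).
by rewrite iN zeta_expN // eqxx.
Qed.

Lemma zeta_exprz_eq1 N (m : int) : (0 < N)%N -> (zeta N ^ m == 1) = (N %| `|m|)%N.
Proof.
move=> N0; rewrite (prim_order_dvd (zeta_prim N0)); case: m => n //=.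
by rewrite NegzE -exprnN invr_eq1.
Qed.

(** Orthogonality of the characters of the cyclic group. *)
Lemma sum_zeta N (m : int) : (0 < N)%N ->
  \sum_(j < N) (zeta N ^+ j) ^ m = if (N %| `|m|)%N then N%:R else 0.
Proof.
move=> N0; have z0 : zeta N != 0 by rewrite (prim_root_eq0 (zeta_prim N0)) -lt0n.
have E (j : 'I_N) : (zeta N ^+ j) ^ m = (zeta N ^ m) ^+ j.
  by rewrite [zeta N ^+ j]exprnP [RHS]exprnP !exprz_exp mulrC.
rewrite (eq_bigr _ (fun j _ => E j)) -zeta_exprz_eq1 //.
case: eqP => [->|/eqP h].
  by rewrite (eq_bigr (fun=> 1)) => [|i _]; rewrite ?expr1n // sumr_const card_ord.
apply: (mulfI (_ : zeta N ^ m - 1 != 0)); first by rewrite subr_eq0.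
by rewrite mulr0 -subrX1 exprnP exprzAC -exprnP zeta_expN // exp1rz subrr.
Qed.

Definition zetac N : T := mkcircle (zeta_abs N).

Lemma cval_zetac N j : cval (zetac N ^+ j)%g = zeta N ^+ j.
Proof. exact: cvalX. Qed.

(** * The Fejer kernel on the roots of unity *)

(** The weight at the [j]-th root of unity of order [N] is the Fejer kernel of order
    [n], centred at [z]. *)
Definition fejer (n N : nat) (z : C) (j : nat) : R :=
  cabs (\sum_(k < n) (z / zeta N ^+ j) ^+ k) ^+ 2 / (n * N)%:R.

Lemma fejer_ge0 n N z j : 0 <= fejer n N z j.
Proof. by rewrite /fejer divr_ge0 // exprn_ge0 ?cabs_ge0. Qed.

Lemma fejerE n N z j : cabs z = 1 ->
  (fejer n N z j)%:C =
    (n * N)%:R^-1 * \sum_(k < n) \sum_(l < n) (z / zeta N ^+ j) ^ (k%:Z - l%:Z).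
Proof.
move=> z1; set a := z / _.
have a1 : cabs a = 1 by rewrite /a cabsM cabsV cabsX z1 zeta_abs expr1n invr1 mulr1.
have a0 := cabs1_neq0 a1.
rewrite /fejer -/a real_complexM -sqr_cabs fmorphV rmorph_nat mulrC; congr (_ * _).
rewrite rmorph_sum /= mulr_suml; apply: eq_bigr => k _; rewrite mulr_sumr.
apply: eq_bigr => l _; rewrite rmorphXn /= expfzDr // -exprnP.
congr (_ * _); rewrite -exprnN -exprVn; congr (_ ^+ _); exact: conjc_abs1.
Qed.

(** The Fourier coefficient of order [0] of the Fejer kernel is [1], and it is computed
    exactly by an average over at least [n] roots of unity. *)
Lemma fejer_sum n N z : (0 < n <= N)%N -> cabs z = 1 -> \sum_(j < N) fejer n N z j = 1.
Proof.
move=> /andP[n0 nN] z1; have N0 : (0 < N)%N by apply: leq_trans nN.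
apply: complexI; rewrite rmorph_sum /=.
rewrite (eq_bigr _ (fun (j : 'I_N) _ => fejerE n N j z1)) -mulr_sumr exchange_big /=.
have E (k : 'I_n) : \sum_(j < N) \sum_(l < n) (z / zeta N ^+ j) ^ (k%:Z - l%:Z) = N%:R.
  rewrite exchange_big /= (bigD1 k) //= [X in _ + X]big1 => [|l lk].
    by rewrite subrr addr0 (eq_bigr (fun=> 1)) ?sumr_const ?card_ord.
  rewrite (eq_bigr (fun j : 'I_N => z ^ (k%:Z - l%:Z) * (zeta N ^+ j) ^ (l%:Z - k%:Z))).
    rewrite -mulr_sumr sum_zeta // ifF ?mulr0 //; apply/negbTE.
    have : (l : nat) != k by [].
    have := ltn_ord l; have := ltn_ord k => kn ln /eqP lk'.
    by apply/negP => /dvdn_leq; lia.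
  by move=> j _; rewrite expfzMl exprz_inv opprB.
rewrite (eq_bigr _ (fun k _ => E k)) sumr_const card_ord -[N%:R *+ n]mulr_natl -natrM mulVf //.
by rewrite pnatr_eq0 -lt0n muln_gt0 n0.
Qed.

(** The factor [z - zeta ^ j] telescopes the geometric sum in the kernel, so that the
    product is at most [2] in modulus. *)
Lemma fejer_moment n N z : (0 < n)%N -> (0 < N)%N -> cabs z = 1 ->
  \sum_(j < N) fejer n N z j * cabs (z - zeta N ^+ j) ^+ 2 <= 4%:R / n%:R.
Proof.
move=> n0 N0 z1.
have E (j : 'I_N) : true -> fejer n N z j * cabs (z - zeta N ^+ j) ^+ 2 <= 4%:R / (n * N)%:R.
  move=> _; set b := zeta N ^+ j; have b1 : cabs b = 1 by rewrite /b cabsX zeta_abs expr1n.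
  have b0 := cabs1_neq0 b1.
  have -> : cabs (z - b) = cabs (z / b - 1).
    by rewrite -[RHS]mulr1 -b1 -cabsM mulrBl mul1r mulfVK.
  rewrite /fejer -/b mulrAC -exprMn -cabsM mulrC [X in cabs X]mulrC -subrX1.
  rewrite mulrC ler_wpM2r ?invr_ge0 //.
  have : cabs ((z / b) ^+ n - 1) <= 2%:R.
    apply: le_trans (cabsB _ _) _.
    by rewrite cabsX cabsM cabsV z1 b1 invr1 mulr1 expr1n cabs1.
  by have := cabs_ge0 ((z / b) ^+ n - 1); nra.
apply: le_trans (ler_sum _ E) _; rewrite sumr_const card_ord -[X in X <= _]mulr_natr.
by rewrite natrM invfM mulrA mulfVK // pnatr_eq0 -lt0n.
Qed.

(** The kernel concentrates at [z] by Chebyshev's inequality. The bound does not depend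
    on the number [N] of roots of unity, which may then tend to infinity. *)
Lemma fejer_approx (n N : nat) z (d e M : R) (D : nat -> R) :
  (0 < n <= N)%N -> cabs z = 1 -> 0 < d -> 0 <= e -> 0 <= M ->
  (forall j, (j < N)%N -> D j <= M) ->
  (forall j, (j < N)%N -> cabs (z - zeta N ^+ j) < d -> D j <= e) ->
  \sum_(j < N) fejer n N z j * D j <= e + M / d ^+ 2 * (4%:R / n%:R).
Proof.
move=> /[dup] nN /andP[n0 nN'] z1 d0 e0 M0 hM he.
have N0 : (0 < N)%N by apply: leq_trans nN'.
have E (j : 'I_N) : true -> fejer n N z j * D j <=
    fejer n N z j * e + M / d ^+ 2 * (fejer n N z j * cabs (z - zeta N ^+ j) ^+ 2).
  move=> _; rewrite mulrCA -mulrDr ler_wpM2l ?fejer_ge0 //.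
  have [h|h] := ltP (cabs (z - zeta N ^+ j)) d.
    by apply: le_trans (he _ _ h) _ => //; rewrite lerDl mulr_ge0 ?divr_ge0 ?sqr_ge0.
  apply: le_trans (hM _ _) _ => //.
  have h2 : 1 <= cabs (z - zeta N ^+ j) ^+ 2 / d ^+ 2.
    by rewrite ler_pdivlMr ?exprn_gt0 // mul1r ler_pXn2r ?nnegrE ?cabs_ge0 // ltW.
  rewrite mulrAC -mulrA; nra.
apply: le_trans (ler_sum _ E) _; rewrite big_split /= -mulr_suml fejer_sum // mul1r lerD2l.
by rewrite -mulr_sumr ler_wpM2l ?fejer_moment // divr_ge0 // sqr_ge0.
Qed.

End Circle.

Arguments cval {R} z.

(** * Continuous functions on the circle *)

Section Continuity.
Variable R : realType.
Local Notation C := R[i].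
Local Notation T := (circle R).
Implicit Types f g : T -> R[i]^o.

(** Continuity by [ccontP], with the real-valued modulus for the sake of estimates. *)
Definition ccont (f : T -> C) : Prop := forall z (e : R), 0 < e ->
  exists2 d : R, 0 < d & forall w, cabs (cval w - cval z) < d -> cabs (f w - f z) < e.

Lemma circle_nbhsP (z : T) (A : set T) :
  nbhs z A <-> exists2 d : R, 0 < d & forall w, cabs (cval w - cval z) < d -> A w.
Proof.
split.
  case=> B [[D oD <-] /= Dz] DA.
  have /nbhs_ballP[e /= e0 he] : nbhs (set_val z : R[i]^o) D by apply: open_nbhs_nbhs.
  have eR : (Re e)%:C = e by apply: RRe_real; apply: gtr0_real.
  exists (Re e); first by rewrite -ltcR eR.
  move=> w hw; apply: DA; apply: he.
  by rewrite -ball_normE /= -eR -cabsE ltcR -/(cval z) cabs_distrC.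
move=> [d d0 h].
have : nbhs (set_val z : R[i]^o) [set y | cabs (y - set_val z) < d].
  apply/nbhs_ballP; exists (d%:C); first by rewrite /= ltcR.
  by move=> y; rewrite -ball_normE /= -cabsE ltcR cabs_distrC.
move=> H; have := @initial_continuous _ _ (@set_val _ (@circle_set R)) z _ H.
by move=> /(@filterS T (nbhs z) _ _ A); apply => w /= hw; apply: h.
Qed.

Lemma ccontP f : continuous f <-> ccont f.
Proof.
split=> [fc z e e0|fc z].
  have /(fc z)/circle_nbhsP : nbhs (f z) [set y | cabs (y - f z) < e].
    apply/nbhs_ballP; exists (e%:C); first by rewrite /= ltcR.
    by move=> y; rewrite -ball_normE /= -cabsE ltcR cabs_distrC.
  by [].
move=> A /nbhs_ballP[e /= e0 he]; apply/circle_nbhsP.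
have eR : (Re e)%:C = e by apply: RRe_real; apply: gtr0_real.
have [|d d0 hd] := fc z (Re e); first by rewrite -ltcR eR.
exists d => // w /hd hw; apply: he.
by rewrite -ball_normE /= -eR -cabsE ltcR cabs_distrC.
Qed.

Lemma ccont_circle (psi : T -> T) : continuous psi <-> ccont (fun z => cval (psi z)).
Proof.
split=> [fc z e e0|fc z].
  have /(fc z)/circle_nbhsP : nbhs (psi z) [set y | cabs (cval y - cval (psi z)) < e].
    by apply/circle_nbhsP; exists e.
  by [].
move=> A /circle_nbhsP[e /= e0 he]; apply/circle_nbhsP.
by have [d d0 hd] := fc z e e0; exists d => // w /hd hw; apply: he.
Qed.

(** Heine's theorem, from the compactness of the interval of arguments. *)
Lemma ccont_unif (f : T -> C) (e : R) : ccont f -> 0 < e ->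
  exists2 d : R, 0 < d & forall z w, cabs (cval w - cval z) < d -> cabs (f w - f z) < e.
Proof.
move=> fc e0; have e2 : 0 < e / 2%:R by rewrite divr_gt0.
have /compact_near_coveringP cov := @segment_compact R (- pi) pi.
pose expc t : T := mkcircle (expi_abs t).
pose P (n : nat) t := forall w, cabs (cval w - expi t) < n.+1%:R^-1 ->
  cabs (f w - f (expc t)) < e.
have [|N _ hN] := cov nat \oo%classic P _.
  move=> t _; have [d d0 hd] := fc (expc t) _ e2.
  have d2 : 0 < d / 2%:R by rewrite divr_gt0.
  have [d' d'0 hd'] := expi_cont t d2.
  have [N hN] := natr_inv_lt d2.
  exists ([set s | `|s - t| < d'], [set n | (N <= n)%N]).
    split=> /=; last by exists N.
    by apply/nbhs_ballP; exists d' => // s; rewrite /= /ball /= distrC.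
  move=> [s n] [/= hs hn] w /= hw.
  have sd := hd' s hs; have /= nd := hN n hn.
  have h1 : cabs (f (expc s) - f (expc t)) < e / 2%:R by apply: hd; apply: lt_trans sd _; lra.
  have h2 : cabs (f w - f (expc t)) < e / 2%:R.
    apply: hd; have := cabsD (cval w - expi s) (expi s - expi t).
    rewrite addrA subrK mkcircleE => h; apply: le_lt_trans h _.
    by rewrite [d in _ < d]splitr ltrD //; apply: lt_trans hw nd.
  have := cabsB (f w - f (expc t)) (f (expc s) - f (expc t)).
  by rewrite opprB addrA subrK; lra.
exists N.+1%:R^-1; first by rewrite invr_gt0.
move=> z w hw; have [t [t1 t2 zt]] := expi_surj (cval_abs z).
have -> : z = expc t by apply: cval_inj.
by apply: (hN N (leqnn N) t) => /=; [rewrite in_itv /= t1 t2|rewrite -zt].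
Qed.

(** By the second moment of the Fejer kernel, some root of unity is close to [z];
    uniform continuity then bounds [f] by its values at finitely many points. *)
Lemma ccont_bounded (f : T -> C) : ccont f -> exists2 M : R, 0 < M & forall z, cabs (f z) <= M.
Proof.
move=> fc; have [d d0 hd] := ccont_unif fc (@ltr01 R).
have [n [n0 hn]] : exists n, (0 < n)%N /\ 4%:R / n%:R < d ^+ 2.
  have [|N hN] := @natr_inv_lt R (d ^+ 2 / 4%:R); first by rewrite divr_gt0 ?exprn_gt0.
  by exists N.+1; split=> //; have := hN N (leqnn N); rewrite ltr_pdivlMr // mulrC.
pose M := \sum_(j < n) cabs (f (zetac R n ^+ j)%g) + 1.
have M0 : 0 < M by rewrite ltr_wpDl // sumr_ge0 // => i _; apply: cabs_ge0.
exists M => // z.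
have [j hj] : exists j : 'I_n, cabs (cval z - zeta R n ^+ j) < d.
  apply: contrapT => /forallNP H.
  have := fejer_moment (z := cval z) n0 n0 (cval_abs z).
  apply/negP; rewrite -ltNge; apply: lt_le_trans hn _.
  rewrite -[leLHS]mul1r -(@fejer_sum R n n (cval z)) ?cval_abs ?n0 ?leqnn //.
  rewrite mulr_suml ler_sum // => j _; rewrite ler_wpM2l ?fejer_ge0 //.
  by rewrite ler_pXn2r ?nnegrE ?cabs_ge0 ?(ltW d0) // leNgt; apply/negP/H.
have h1 : cabs (f z - f (zetac R n ^+ j)%g) < 1 by apply: hd; rewrite cval_zetac.
have h2 : cabs (f (zetac R n ^+ j)%g) <= \sum_(j < n) cabs (f (zetac R n ^+ j)%g).
  by rewrite (bigD1 j) //= lerDl sumr_ge0 // => i _; apply: cabs_ge0.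
by have := cabs_dist (f z) (f (zetac R n ^+ j)%g); rewrite /M; lra.
Qed.

Lemma ccont_cst (a : C) : ccont (fun=> a).
Proof. by move=> z e e0; exists 1 => // w _; rewrite subrr cabs0. Qed.

Lemma ccont_cval : ccont cval.
Proof. by move=> z e e0; exists e. Qed.

Lemma ccontD (f g : T -> C) : ccont f -> ccont g -> ccont (fun z => f z + g z).
Proof.
move=> fc gc z e e0; have e2 : 0 < e / 2%:R by rewrite divr_gt0.
have [d d0 hd] := fc z _ e2; have [d' d'0 hd'] := gc z _ e2.
exists (Num.min d d'); first by rewrite lt_min d0.
move=> w; rewrite lt_min => /andP[/hd h1 /hd' h2].
rewrite opprD addrACA; apply: le_lt_trans (cabsD _ _) _; lra.
Qed.

Lemma ccontM (f g : T -> C) : ccont f -> ccont g -> ccont (fun z => f z * g z).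
Proof.
move=> fc gc z e e0.
pose M := cabs (f z) + cabs (g z) + 1.
have M0 : 0 < M by have := cabs_ge0 (f z); have := cabs_ge0 (g z); rewrite /M; lra.
pose k := Num.min 1 (e / (2%:R * M)).
have k0 : 0 < k by rewrite lt_min ltr01 divr_gt0 // mulr_gt0.
have [d d0 hd] := fc z _ k0; have [d' d'0 hd'] := gc z _ k0.
exists (Num.min d d'); first by rewrite lt_min d0.
move=> w; rewrite lt_min => /andP[/hd h1 /hd' h2].
have -> : f w * g w - f z * g z =
    (f w - f z) * (g w - g z) + f z * (g w - g z) + (f w - f z) * g z by ring.
apply: le_lt_trans (cabsD _ _) _.
have := cabsD ((f w - f z) * (g w - g z)) (f z * (g w - g z)); rewrite !cabsM.
have kM : k * (2%:R * M) <= e by rewrite -ler_pdivlMr ?mulr_gt0 // ge_min lexx orbT.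
have k1 : k <= 1 by rewrite ge_min lexx.
move: (cabs_ge0 (f w - f z)) (cabs_ge0 (g w - g z)) (cabs_ge0 (f z)) (cabs_ge0 (g z)) h1 h2 M0.
rewrite /M in kM *.
set a := cabs (f w - f z); set b := cabs (g w - g z); set x := cabs (f z); set y := cabs (g z).
move=> a0 b0 x0 y0 ak bk M0 h.
have H1 : a * b <= k by nra.
have H2 : x * b <= x * k by nra.
have H3 : a * y <= k * y by nra.
nra.
Qed.

Lemma ccontB (f g : T -> C) : ccont f -> ccont g -> ccont (fun z => f z - g z).
Proof.
move=> fc gc.
have -> : (fun z => f z - g z) = fun z => f z + (-1) * g z by apply/funext => z; rewrite mulN1r.
by apply: ccontD => //; apply: ccontM => //; exact: ccont_cst.
Qed.

Lemma ccontJ (f : T -> C) : ccont f -> ccont (fun z => conjc (f z)).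
Proof.
move=> fc z e e0; have [d d0 hd] := fc z e e0; exists d => // w /hd.
by rewrite -rmorphB cabsJ.
Qed.

Lemma ccont_comp (f : T -> C) (g : T -> T) :
  ccont f -> ccont (fun z => cval (g z)) -> ccont (fun z => f (g z)).
Proof.
move=> fc gc z e e0; have [d d0 hd] := fc (g z) e e0.
by have [d' d'0 hd'] := gc z d d0; exists d' => // w /hd'/hd.
Qed.

Lemma ccontX (f : T -> C) n : ccont f -> ccont (fun z => f z ^+ n).
Proof.
move=> fc; elim: n => [|n IH]; first exact: ccont_cst.
have -> : (fun z => f z ^+ n.+1) = (fun z => f z * f z ^+ n).
  by apply/funext => z; rewrite exprS.
exact: ccontM.
Qed.

Lemma ccont_powg (g : T -> T) n :
  ccont (fun z => cval (g z)) -> ccont (fun z => cval (g z ^+ n)%g).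
Proof.
have -> : (fun z => cval (g z ^+ n)%g) = (fun z => cval (g z) ^+ n).
  by apply/funext => z; rewrite cvalX.
exact: ccontX.
Qed.

(** * Density of the trigonometric polynomials *)

(** A Laurent polynomial is a polynomial shifted by a power of [z], which has
    modulus [1]: estimates reduce to polynomials. *)
Definition trig (D : nat) (p : {poly C}) (z : T) : C := cval z ^- D * p.[cval z].

(** The discrete Fejer mean of [f] is a Laurent polynomial in [z], as the kernel is one. *)
Lemma trig_dense (f : T -> C) (e : R) : ccont f -> 0 < e ->
  exists D p, forall z, cabs (f z - trig D p z) <= e.
Proof.
move=> fc e0; have e2 : 0 < e / 2%:R by rewrite divr_gt0.
have [M M0 hM] := ccont_bounded fc.
have [d d0 hd] := ccont_unif fc e2.
have K0 : 0 < 2%:R * M / d ^+ 2 * 4%:R by rewrite !mulr_gt0 // invr_gt0 exprn_gt0.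
have [|n' hn'] := @natr_inv_lt R (e / 2%:R / (2%:R * M / d ^+ 2 * 4%:R)).
  by rewrite divr_gt0.
set n := n'.+1.
have hn : 2%:R * M / d ^+ 2 * (4%:R / n%:R) < e / 2%:R.
  by have h := hn' n' (leqnn _); rewrite ltr_pdivlMr // in h; rewrite mulrA mulrC.
pose w := zeta R n.
pose p : {poly C} := \sum_(j < n) \sum_(k < n) \sum_(l < n)
  ((n * n)%:R^-1 * f (zetac R n ^+ j)%g * (w ^+ j) ^ (l%:Z - k%:Z)) *: 'X^(k + n - l).
exists n, p => z; set a := cval z.
have a0 : a != 0 := cval_neq0 z.
have E : trig n p z = \sum_(j < n) (fejer n n a j)%:C * f (zetac R n ^+ j)%g.
  rewrite /trig -/a /p horner_sum mulr_sumr; apply: eq_bigr => j _.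
  rewrite fejerE ?cval_abs // horner_sum !mulr_sumr mulr_suml; apply: eq_bigr => k _.
  rewrite horner_sum !mulr_sumr mulr_suml; apply: eq_bigr => l _.
  rewrite hornerZ hornerXn expfzMl exprz_inv opprB.
  have -> : a ^ (k%:Z - l%:Z) = a ^- n * a ^+ (k + n - l).
    rewrite exprnN [a ^+ _]exprnP -expfzDr //; congr (_ ^ _).
    by have := ltn_ord l; lia.
  by rewrite -/w; ring.
have F : f z = \sum_(j < n) (fejer n n a j)%:C * f z.
  rewrite -mulr_suml -(rmorph_sum (real_complex R)) /= fejer_sum ?leqnn ?cval_abs //.
  by rewrite mul1r.
rewrite E [f z in X in X <= _]F -sumrB; apply: le_trans (cabs_sum _ _ _) _.
have G (j : 'I_n) : true -> cabs ((fejer n n a j)%:C * f z - (fejer n n a j)%:C * f (zetac R n ^+ j)%g)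
   <= fejer n n a j * cabs (f z - f (zetac R n ^+ j)%g).
  by move=> _; rewrite -mulrBr cabsM cabs_real ger0_norm ?fejer_ge0.
apply: le_trans (ler_sum _ G) _.
have := @fejer_approx R n n a d (e / 2%:R) (2%:R * M) (fun j => cabs (f z - f (zetac R n ^+ j)%g)).
move=> H; apply: le_trans (H _ _ _ _ _ _ _) _; rewrite ?leqnn ?cval_abs //.
- by lra.
- by lra.
- by move=> j _; apply: le_trans (cabsB _ _) _; have := hM z; have := hM (zetac R n ^+ j)%g; lra.
- by move=> j _ hj; apply/ltW/hd; rewrite cval_zetac.
- by lra.
Qed.

Lemma ccont_trig D p : ccont (trig D p).
Proof.
have hp : ccont (fun z => p.[cval z]).
  elim/poly_ind: p => [|p c IH].
    have -> : (fun z : T => (0 : {poly C}).[cval z]) = fun=> 0.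
      by apply/funext => z; rewrite horner0.
    exact: ccont_cst.
  have -> : (fun z => (p * 'X + c%:P).[cval z]) = fun z => p.[cval z] * cval z + c.
    by apply/funext => z; rewrite hornerMXaddC.
  by apply: ccontD; [apply: ccontM => //; exact: ccont_cval|exact: ccont_cst].
have -> : trig D p = fun z => conjc (cval z) ^+ D * p.[cval z].
  by apply/funext => z; rewrite /trig conjc_cval exprVn.
by apply: ccontM => //; apply: ccontX; apply: ccontJ; exact: ccont_cval.
Qed.

End Continuity.

(** * Polynomials in a unitary *)

Section Growth.
Variable R : realType.

Lemma bernoulli (h : R) n : 0 <= h -> 1 + n%:R * h <= (1 + h) ^+ n.
Proof.
move=> h0; elim: n => [|n IH]; first by rewrite mul0r addr0 expr0.
rewrite exprS -natr1; have n0 : (0 : R) <= n%:R by [].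
have kh : 0 <= n%:R * (h * h) by rewrite !mulr_ge0.
move: IH n0 kh; move: (n%:R : R) ((1 + h) ^+ n) => k X IH n0 kh.
have : 0 <= (1 + h) * (X - (1 + k * h)) by apply: mulr_ge0; lra.
nra.
Qed.

(** Otherwise [(t / M) ^ m] exceeds [1 + m h] with [h > 0] by Bernoulli's inequality, and
    its square, of order [m ^ 2], exceeds a linear function of [m]. *)
Lemma pow2_growth (t M : R) (d : nat) : 0 <= t -> 0 <= M ->
  (forall k, t ^+ (2 ^ k) <= (d * 2 ^ k + 1)%:R * M ^+ (2 ^ k)) -> t <= M.
Proof.
move=> t0 M0 H; rewrite leNgt; apply/negP => Mt.
have [M00|Mp] := eqVneq M 0.
  by have := H 0%N; rewrite expn0 !expr1 M00 mulr0 leNgt -{1}M00 Mt.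
have {}Mp : 0 < M by rewrite lt_def Mp.
pose h := t / M - 1.
have h0 : 0 < h by rewrite subr_gt0 ltr_pdivlMr // mul1r.
have tE : t = (1 + h) * M by rewrite /h addrC subrK divfK // gt_eqF.
have [k hk] : exists k, 2%:R * d%:R / h ^+ 2 < (2 ^ k)%:R.
  exists (Num.truncn (2%:R * d%:R / h ^+ 2)).+1.
  apply: lt_le_trans (truncnS_gt _) _.
  by rewrite ler_nat; apply/ltnW/ltn_expl.
rewrite ltr_pdivrMr ?exprn_gt0 // in hk.
have := H k.+1; rewrite tE exprMn ler_pM2r ?exprn_gt0 // expnSr.
set m := (2 ^ k)%N in hk *; rewrite exprM.
have m0 : (0 : R) < m%:R by rewrite ltr0n expn_gt0.
have := bernoulli m (ltW h0) => B; rewrite natrD !natrM => H2.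
have mh : 0 <= m%:R * h by rewrite mulr_ge0 // ltW.
have : (1 + m%:R * h) ^+ 2 <= (1 + h) ^+ m ^+ 2.
  by rewrite lerXn2r // nnegrE; [lra|apply: le_trans B; lra].
move: H2; move: ((1 + h) ^+ m ^+ 2) => X H2 H3.
have : m%:R * (m%:R * h ^+ 2) <= m%:R * (2%:R * d%:R).
  by move: (m%:R : R) (d%:R : R) mh H2 H3 => x y; nra.
by rewrite ler_pM2l // leNgt hk.
Qed.

End Growth.

Section Zpow.
Variables (R : realType) (A : cstarAlgType R) (u : A).
Hypothesis hu : unitary u.

Let usu : star u * u = 1. Proof. by case: hu. Qed.
Let uus : u * star u = 1. Proof. by case: hu. Qed.

Lemma zpow1 : zpow u 1 = u.
Proof. by rewrite /= expr1. Qed.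

Lemma zpowSr m : zpow u (m + 1) = zpow u m * u.
Proof.
case: m => [n|[|n]].
- by rewrite -PoszD addn1 /= exprSr.
- by rewrite /= expr1 usu.
- have -> : Negz n.+1 + 1 = Negz n by lia.
  by rewrite /= [star u ^+ n.+2]exprSr -mulrA usu mulr1.
Qed.

Lemma zpowD m n : zpow u (m + n) = zpow u m * zpow u n.
Proof.
elim/int_ind: n => [|n IH|n IH].
- by rewrite addr0 mulr1.
- by rewrite -addn1 PoszD addrA zpowSr IH zpowSr mulrA.
- have E k : zpow u (k - 1) = zpow u k * star u.
    by rewrite -{2}(subrK 1 k) zpowSr -mulrA uus mulr1.
  have -> : - n.+1%:Z = - n%:Z - 1 by lia.
  by rewrite addrA E IH E mulrA.
Qed.

Lemma star_zpow m : star (zpow u m) = zpow u (- m).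
Proof.
case: m => [[|n]|n]; rewrite /= ?starX ?starK //.
Qed.

Lemma zpowNK m : zpow u (- m) * zpow u m = 1.
Proof. by rewrite -zpowD addNr. Qed.

Lemma zpowK m : zpow u m * zpow u (- m) = 1.
Proof. by rewrite -zpowD addrN. Qed.

Lemma zpow_iso m : star (zpow u m) * zpow u m = 1.
Proof. by rewrite star_zpow zpowNK. Qed.

Lemma cnorm_zpowM m x : cnorm (zpow u m * x) = cnorm x.
Proof. exact/cnorm_isoM/zpow_iso. Qed.

Lemma cnormM_zpow m x : cnorm (x * zpow u m) = cnorm x.
Proof. by apply: cnormM_unitary; rewrite star_zpow zpowK. Qed.

Lemma comm_staru x : x * u = u * x -> x * star u = star u * x.
Proof.
by move=> xu; rewrite -[LHS]mul1r -usu -!mulrA (mulrA u) -xu -mulrA uus mulr1.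
Qed.

Lemma zpow_comm x m : x * u = u * x -> x * zpow u m = zpow u m * x.
Proof. by move=> xu; case: m => n /=; apply: commrX => //; exact: comm_staru. Qed.

End Zpow.

Section Peval.
Variables (R : realType) (A : cstarAlgType R).
Local Notation C := R[i].
Implicit Types (p q : {poly C}) (u x : A).

Definition peval u p : A := horner_alg u p.

Lemma pevalE u p : peval u p = \sum_(i < size p) p`_i *: u ^+ i.
Proof.
rewrite /peval -{1}(coefK p) poly_def linear_sum /=; apply: eq_bigr => i _.
by rewrite linearZ /= rmorphXn /= horner_algX mulr_algl.
Qed.

Lemma peval_comm u p x : x * u = u * x -> x * peval u p = peval u p * x.
Proof.
move=> xu; rewrite pevalE mulr_sumr mulr_suml; apply: eq_bigr => i _.
by rewrite -scalerAr -scalerAl; congr (_ *: _); apply: commrX.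
Qed.

Lemma pevalM u p q : peval u (p * q) = peval u p * peval u q.
Proof. exact: rmorphM. Qed.

Lemma pevalX u p n : peval u (p ^+ n) = peval u p ^+ n.
Proof. exact: rmorphXn. Qed.

Lemma pevalD u p q : peval u (p + q) = peval u p + peval u q.
Proof. exact: rmorphD. Qed.

Lemma pevalZ u a p : peval u (a *: p) = a *: peval u p.
Proof. by rewrite /peval linearZ /= mulr_algl. Qed.

Lemma peval_Xn u n : peval u 'X^n = u ^+ n.
Proof. by rewrite pevalX /peval horner_algX. Qed.

Lemma peval_normal u p : unitary u ->
  star (peval u p) * peval u p = peval u p * star (peval u p).
Proof.
move=> [usu uus]; apply: peval_comm.
have h : star u * peval u p = peval u p * star u by apply: peval_comm; rewrite usu uus.
by rewrite -[X in _ = X * _]starK -starM -h starM starK.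
Qed.

Lemma cnorm_peval_coef u p : unitary u -> cnorm (peval u p) <= \sum_(i < size p) cabs p`_i.
Proof.
move=> [usu uus]; rewrite pevalE; apply: le_trans (cnorm_sum _ _ _) _.
apply: ler_sum => i _; rewrite cnormZE -[leRHS]mulr1 ler_wpM2l ?cabs_ge0 //.
by apply: le_trans (cnormX _ _) _; rewrite (cnorm_isometry usu) expr1n.
Qed.

Lemma size_pow2 p k : (size (p ^+ (2 ^ k)) <= size p * 2 ^ k + 1)%N.
Proof.
apply: leq_trans (size_poly_exp_leq _ _) _; rewrite addn1 ltnS leq_mul2r leq_pred orbT //.
Qed.

(** The other monomials are killed by orthogonality, as all degrees are below [N]. *)
Lemma coef_avg p N i (z : C) : (size p <= N)%N -> (i < N)%N -> cabs z = 1 ->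
  \sum_(j < N) (z * zeta R N ^+ j) ^- i * p.[z * zeta R N ^+ j] = N%:R * p`_i.
Proof.
move=> pN iN z1; have N0 : (0 < N)%N by apply: leq_ltn_trans iN.
have z0 := cabs1_neq0 z1.
have y0 j : zeta R N ^+ j != 0 by apply: cabs1_neq0; rewrite cabsX zeta_abs expr1n.
rewrite (eq_bigr (fun j : 'I_N => \sum_(k < N) p`_k * z ^ (k%:Z - i%:Z) *
    (zeta R N ^+ j) ^ (k%:Z - i%:Z))); last first.
  move=> j _; rewrite (horner_coef_wide _ pN) mulr_sumr; apply: eq_bigr => k _.
  rewrite -mulrA -expfzMl mulrCA; congr (_ * _).
  by rewrite [X in _ * X]exprnP exprnN -expfzDr ?mulf_neq0 // addrC.
rewrite exchange_big /= (bigD1 (Ordinal iN)) //= [X in _ + X]big1 => [|k ki].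
  by rewrite subrr -mulr_sumr sum_zeta // dvdn0 expr0z mulr1 addr0 mulrC.
rewrite -mulr_sumr sum_zeta // ifF ?mulr0 //; apply/negbTE.
have : (k : nat) != i by [].
have := ltn_ord k => kn /eqP lk'.
by apply/negP => /dvdn_leq; lia.
Qed.

Lemma coef_le p i M : (forall z : circle R, cabs p.[cval z] <= M) -> cabs p`_i <= M.
Proof.
move=> H; pose N := maxn (size p) i.+1.
have N0 : (0 < N)%N by rewrite leq_max ltn0Sn orbT.
have := coef_avg (p := p) (N := N) (i := i) (z := 1) (leq_maxl _ _) _ (cabs1 R).
rewrite leq_maxr => /(_ isT) E.
have : cabs (N%:R * p`_i) <= N%:R * M.
  rewrite -E; apply: le_trans (cabs_sum _ _ _) _.
  have F (j : 'I_N) : true -> cabs ((1 * zeta R N ^+ j) ^- i * p.[1 * zeta R N ^+ j]) <= M.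
    move=> _; rewrite mul1r cabsM cabsV !cabsX zeta_abs !expr1n invr1 mul1r.
    by rewrite -cval_zetac H.
  apply: le_trans (ler_sum _ F) _.
  by rewrite sumr_const card_ord mulr_natl.
by rewrite cabsM cabs_nat ler_pM2l ?ltr0n.
Qed.

(** The powers [p ^ (2 ^ k)] have at most [2 ^ k * size p + 1] coefficients, each
    bounded by [M ^ (2 ^ k)]. As [peval u p] is normal, this loss disappears in the
    limit of [2 ^ k]-th roots. *)
Lemma cnorm_peval_le u p M : unitary u ->
  (forall z : circle R, cabs p.[cval z] <= M) -> cnorm (peval u p) <= M.
Proof.
move=> hu H.
have M0 : 0 <= M by apply: le_trans (H 1%g); apply: cabs_ge0.
apply: (@pow2_growth R _ _ (size p)) => //; first exact: cnorm_ge0.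
move=> k; rewrite -cnorm_normal_pow2 -?pevalX; last exact: peval_normal.
apply: le_trans (cnorm_peval_coef _ hu) _.
have F (i : 'I_(size (p ^+ (2 ^ k)))) : true -> cabs (p ^+ (2 ^ k))`_i <= M ^+ (2 ^ k).
  move=> _; apply: coef_le => z; rewrite horner_exp cabsX.
  by rewrite lerXn2r ?nnegrE ?cabs_ge0.
apply: le_trans (ler_sum _ F) _; rewrite sumr_const card_ord -[X in X <= _]mulr_natl.
by rewrite ler_wpM2r ?exprn_ge0 // ler_nat size_pow2.
Qed.

(** The same power trick in the other direction: the coefficients are now controlled
    by the norm of the operator. *)
Lemma cabs_horner_le u p (z : circle R) : unitary u ->
  (forall q i, cabs q`_i <= cnorm (peval u q)) -> cabs p.[cval z] <= cnorm (peval u p).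
Proof.
move=> hu H; apply: (@pow2_growth R _ _ (size p)); rewrite ?cabs_ge0 ?cnorm_ge0 //.
move=> k; rewrite -cnorm_normal_pow2 -?pevalX; last exact: peval_normal.
rewrite -cabsX -horner_exp horner_coef; apply: le_trans (cabs_sum _ _ _) _.
have F (i : 'I_(size (p ^+ (2 ^ k)))) : true ->
    cabs ((p ^+ (2 ^ k))`_i * cval z ^+ i) <= cnorm (peval u (p ^+ (2 ^ k))).
  by move=> _; rewrite cabsM cabsX cval_abs expr1n mulr1.
apply: le_trans (ler_sum _ F) _; rewrite sumr_const card_ord -[X in X <= _]mulr_natl.
by rewrite ler_wpM2r ?cnorm_ge0 // ler_nat size_pow2.
Qed.

End Peval.

(** * Existence of the functional calculus *)

Section Calculus.
Variables (R : realType) (A : cstarAlgType R).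
Local Notation C := R[i].
Local Notation T := (circle R).
Implicit Types (p q : {poly C}) (x y : A) (D E : nat).

Definition trig_op (u : A) D p : A := star u ^+ D * peval u p.

Lemma trigD D E p q (z : T) :
  trig D p z + trig E q z = trig (D + E) (p * 'X^E + q * 'X^D) z.
Proof.
rewrite /trig hornerD !hornerM !hornerXn; set a := cval z.
have a0 : a != 0 := cval_neq0 z.
by rewrite exprD; field; rewrite !expf_neq0.
Qed.

Lemma trigZ a D p (z : T) : a * trig D p z = trig D (a *: p) z.
Proof. by rewrite /trig hornerZ mulrCA. Qed.

Lemma trigM D E p q (z : T) : trig D p z * trig E q z = trig (D + E) (p * q) z.
Proof. by rewrite /trig hornerM mulrACA -invfM -exprD. Qed.

(** On the circle, conjugation inverts [z]; the shift by [size p] restores nonnegative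
    exponents. *)
Definition conj_poly D p : {poly C} :=
  \sum_(i < size p) conjc p`_i *: 'X^(D + size p - i).

Lemma trigJ D p (z : T) : conjc (trig D p z) = trig (size p) (conj_poly D p) z.
Proof.
rewrite /trig /conj_poly horner_sum horner_coef rmorphM rmorph_sum /= !mulr_sumr.
apply: eq_bigr => i _; rewrite hornerZ hornerXn rmorphM /= mulrCA [RHS]mulrCA; congr (_ * _).
rewrite fmorphV !rmorphXn /= conjc_cval; set a := cval z.
have a0 : a != 0 := cval_neq0 z.
have -> : (D + size p - i = D + (size p - i))%N by rewrite addnBA // ltnW.
have -> : a ^- size p = a ^- (size p - i) * a ^- i.
  by rewrite -invfM -exprD subnK // ltnW.
by rewrite exprD !exprVn invrK; field; rewrite !expf_neq0.
Qed.

Variable u : A.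
Hypothesis hu : unitary u.

Let usu : star u * u = 1. Proof. by case: hu. Qed.
Let uus : u * star u = 1. Proof. by case: hu. Qed.
Let cu : star u * u = u * star u. Proof. by rewrite usu uus. Qed.

Lemma starXK D : star u ^+ D * u ^+ D = 1.
Proof. by rewrite -exprMn_comm // usu expr1n. Qed.

Lemma starX_peval D p : star u ^+ D * peval u p = peval u p * star u ^+ D.
Proof. by apply: peval_comm; apply/commr_sym/commrX. Qed.

Lemma trig_opXn D p E : trig_op u (D + E) (p * 'X^E) = trig_op u D p.
Proof.
by rewrite /trig_op pevalM peval_Xn exprD -mulrA [star u ^+ E * _]mulrA starX_peval -mulrA starXK mulr1.
Qed.

Lemma trig_opD D E p q : trig_op u D p + trig_op u E q = trig_op u (D + E) (p * 'X^E + q * 'X^D).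
Proof. by rewrite [RHS]/trig_op pevalD mulrDr -!/(trig_op _ _ _) trig_opXn [(D + E)%N]addnC trig_opXn. Qed.

Lemma trig_opZ a D p : a *: trig_op u D p = trig_op u D (a *: p).
Proof. by rewrite /trig_op pevalZ scalerAr. Qed.

Lemma trig_opM D E p q : trig_op u D p * trig_op u E q = trig_op u (D + E) (p * q).
Proof. by rewrite /trig_op exprD pevalM -!mulrA; congr (_ * _); rewrite !mulrA starX_peval. Qed.

Lemma trig_opJ D p : star (trig_op u D p) = trig_op u (size p) (conj_poly D p).
Proof.
rewrite /trig_op /conj_poly starM starX starK pevalE star_sum mulr_suml.
rewrite /peval linear_sum /= mulr_sumr; apply: eq_bigr => i _; rewrite -!/(peval _ _).
rewrite pevalZ peval_Xn starZE -scalerAl -scalerAr; congr (_ *: _); rewrite starX.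
have -> : (D + size p - i = (size p - i) + D)%N by rewrite [RHS]addnC addnBA // ltnW.
have -> : star u ^+ size p = star u ^+ i * star u ^+ (size p - i).
  by rewrite -exprD subnKC // ltnW.
by rewrite exprD -!mulrA [X in _ = _ * X]mulrA starXK mul1r.
Qed.

Lemma cnorm_trig_op D p : cnorm (trig_op u D p) = cnorm (peval u p).
Proof. by rewrite /trig_op cnorm_isoM // starX starK -exprMn_comm // uus expr1n. Qed.

Lemma cabs_trig D p (z : T) : cabs (trig D p z) = cabs p.[cval z].
Proof. by rewrite /trig cabsM cabsV cabsX cval_abs expr1n invr1 mul1r. Qed.

Lemma trig_op_le D p M : (forall z : T, cabs (trig D p z) <= M) -> cnorm (trig_op u D p) <= M.
Proof.
move=> H; rewrite cnorm_trig_op; apply: cnorm_peval_le => // z.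
by rewrite -(cabs_trig D).
Qed.

(** This estimate makes the calculus on Laurent polynomials contractive, hence
    extendable to their uniform limits. *)
Lemma trig_opB_le D E p q M : (forall z : T, cabs (trig D p z - trig E q z) <= M) ->
  cnorm (trig_op u D p - trig_op u E q) <= M.
Proof.
move=> H; rewrite -scaleN1r trig_opZ trig_opD; apply: trig_op_le => z.
by rewrite -trigD -trigZ mulN1r.
Qed.

(** The value at [u] is described by common approximations, so that uniqueness and the
    algebraic rules hold for a relation, before any choice of a value. *)
Definition is_val (f : T -> C) (y : A) : Prop := forall e : R, 0 < e ->
  exists D p, (forall z, cabs (f z - trig D p z) <= e) /\ cnorm (y - trig_op u D p) <= e.

Lemma is_val_ex (f : T -> C) : ccont f -> exists y, is_val f y.
Proof.
move=> fc.
have h (n : nat) : exists Dp : nat * {poly C},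
    forall z, cabs (f z - trig Dp.1 Dp.2 z) <= n.+1%:R^-1.
  have [|D [p hp]] := @trig_dense R f n.+1%:R^-1 fc; first by rewrite invr_gt0.
  by exists (D, p).
pose t n := sval (cid (h n)).
have ht n z : cabs (f z - trig (t n).1 (t n).2 z) <= n.+1%:R^-1 by rewrite /t; case: cid.
have [y hy] : exists y, cconv (fun n => trig_op u (t n).1 (t n).2) y.
  apply: cconv_cauchy => e e0; have [|N hN] := @natr_inv_lt R (e / 2%:R); first by rewrite divr_gt0.
  exists N => m n /hN Nm /hN Nn.
  apply: le_lt_trans (_ : _ <= m.+1%:R^-1 + n.+1%:R^-1) _; last first.
    by rewrite [e in _ < e]splitr ltrD.
  apply: trig_opB_le => z.
  have := cabsB (f z - trig (t n).1 (t n).2 z) (f z - trig (t m).1 (t m).2 z).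
  rewrite opprB addrC addrA subrK => H; apply: le_trans H _.
  by rewrite addrC lerD.
exists y => e e0; have [N hN] := hy e e0; have [N' hN'] := natr_inv_lt e0.
pose n := maxn N N'; exists (t n).1, (t n).2; split => [z|].
  by apply: le_trans (ht n z) _; apply/ltW/hN'; rewrite leq_maxr.
by rewrite cnorm_distC; apply/ltW/hN; rewrite leq_maxl.
Qed.

Lemma is_val_dist (f g : T -> C) x y M : is_val f x -> is_val g y ->
  (forall z, cabs (f z - g z) <= M) -> cnorm (x - y) <= M.
Proof.
move=> fx gy fg; apply: le_eps => e e0.
have [|D [p [fp xp]]] := fx (e / 4%:R); first by rewrite divr_gt0.
have [|E [q [gq yq]]] := gy (e / 4%:R); first by rewrite divr_gt0.
have H : cnorm (trig_op u D p - trig_op u E q) <= M + e / 2%:R.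
  apply: trig_opB_le => z.
  have := fp z; have := gq z; have := fg z; rewrite (cabs_distrC (f z) (trig _ _ _)).
  have := cabsD (trig D p z - f z + (f z - g z)) (g z - trig E q z).
  have := cabsD (trig D p z - f z) (f z - g z).
  by rewrite !addrA !subrK; lra.
have := cnorm_trans (trig_op u D p) x y; have := cnorm_trans (trig_op u E q) (trig_op u D p) y.
rewrite (cnorm_distC (trig_op u E q) y); lra.
Qed.

Lemma is_val_uniq (f : T -> C) x y : is_val f x -> is_val f y -> x = y.
Proof.
move=> fx fy; apply/eqP; rewrite -subr_eq0; apply/eqP/cnorm_small => e e0.
by apply: (is_val_dist fx fy) => z; rewrite subrr cabs0 ltW.
Qed.

Lemma is_val_trig D p : is_val (trig D p) (trig_op u D p).
Proof.
by move=> e e0; exists D, p; split => [z|]; rewrite subrr ?cabs0 ?cnorm0 ltW.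
Qed.

Lemma is_val0 : is_val (fun=> 0) 0.
Proof.
move=> e e0; exists 0%N, 0; split => [z|].
  by rewrite /trig horner0 mulr0 subrr cabs0 ltW.
by rewrite /trig_op /peval rmorph0 mulr0 subrr cnorm0 ltW.
Qed.

Lemma is_val_le (f : T -> C) x M : is_val f x -> (forall z, cabs (f z) <= M) -> cnorm x <= M.
Proof.
move=> fx fM; rewrite -[x]subr0; apply: (is_val_dist fx is_val0) => z.
by rewrite subr0.
Qed.

Lemma is_val_lin a (f g : T -> C) x y : is_val f x -> is_val g y ->
  is_val (fun z => a * f z + g z) (a *: x + y).
Proof.
move=> fx gy e e0; have a0 := cabs_ge0 a.
pose k := e / (2%:R * (cabs a + 1)).
have k0 : 0 < k by rewrite divr_gt0 // mulr_gt0 //; lra.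
have kE : (cabs a + 1) * k = e / 2%:R.
  by rewrite /k; field; rewrite gt_eqF //; lra.
have [D [p [fp xp]]] := fx k k0.
have [|E [q [gq yq]]] := gy (e / 2%:R); first by rewrite divr_gt0.
exists (D + E)%N, ((a *: p) * 'X^E + q * 'X^D); split => [z|].
  rewrite -trigD -trigZ opprD addrACA -mulrBr; apply: le_trans (cabsD _ _) _.
  by rewrite cabsM; have := gq z; have := fp z; have := cabs_ge0 (f z - trig D p z); nra.
rewrite -trig_opD -trig_opZ opprD addrACA -scalerBr; apply: le_trans (cnormD _ _) _.
by rewrite cnormZE; have := cnorm_ge0 (x - trig_op u D p); nra.
Qed.

Lemma is_valJ (f : T -> C) x : is_val f x -> is_val (fun z => conjc (f z)) (star x).
Proof.
move=> fx e /fx[D [p [fp xp]]]; exists (size p), (conj_poly D p); split => [z|].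
  by rewrite -trigJ -rmorphB cabsJ.
by rewrite -trig_opJ -starB cnorm_star.
Qed.

Lemma is_valM (f g : T -> C) x y : ccont f -> ccont g -> is_val f x -> is_val g y ->
  is_val (fun z => f z * g z) (x * y).
Proof.
move=> fc gc fx gy e e0.
have [M M0 fM] := ccont_bounded fc; have [N N0 gN] := ccont_bounded gc.
have xM := is_val_le fx fM; have yN := is_val_le gy gN.
(* the second factor of the product below is bounded by [N + 1] *)
pose k := Num.min 1 (e / (M + N + 1)).
have s0 : 0 < M + N + 1 by lra.
have k0 : 0 < k by rewrite lt_min ltr01 divr_gt0.
have k1 : k <= 1 by rewrite ge_min lexx.
have kS : k * (M + N + 1) <= e by rewrite -ler_pdivlMr // ge_min lexx orbT.
have [D [p [fp xp]]] := fx k k0; have [E [q [gq yq]]] := gy k k0.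
exists (D + E)%N, (p * q); split => [z|].
  rewrite -trigM.
  have -> : f z * g z - trig D p z * trig E q z =
    f z * (g z - trig E q z) + (f z - trig D p z) * (g z - (g z - trig E q z)) by ring.
  apply: le_trans (cabsD _ _) _; rewrite !cabsM.
  have := cabsB (g z) (g z - trig E q z).
  have := fM z; have := gN z; have := fp z; have := gq z.
  have := cabs_ge0 (g z - trig E q z); have := cabs_ge0 (f z - trig D p z).
  have := cabs_ge0 (f z); have := cabs_ge0 (g z - (g z - trig E q z)).
  move: (cabs (g z - trig E q z)) (cabs (f z - trig D p z)) (cabs (f z)) (cabs (g z)) (cabs (g z - (g z - trig E q z))) => a b c d l; clear -M0 N0 k0 k1 kS e0; nra.
rewrite -trig_opM.
have -> : x * y - trig_op u D p * trig_op u E q =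
    x * (y - trig_op u E q) + (x - trig_op u D p) * (y - (y - trig_op u E q)).
  by rewrite subKr mulrBr mulrBl addrA subrK.
apply: le_trans (cnormD _ _) _.
have := cnormM x (y - trig_op u E q); have := cnormM (x - trig_op u D p) (y - (y - trig_op u E q)).
have := cnormB y (y - trig_op u E q).
have := cnorm_ge0 (y - trig_op u E q); have := cnorm_ge0 (x - trig_op u D p).
have := cnorm_ge0 x; have := cnorm_ge0 (y - (y - trig_op u E q)).
move: (cnorm (y - trig_op u E q)) (cnorm (x - trig_op u D p)) xp yq xM yN (cnorm (x * (y - trig_op u E q))) (cnorm ((x - trig_op u D p) * (y - (y - trig_op u E q)))) (cnorm (y - (y - trig_op u E q))).
move: (cnorm x) (cnorm y) => c d a b; clear -M0 N0 k0 k1 kS e0 => bk ak cM dN s t l.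
nra.
Qed.

Let Phi (f : T -> R[i]^o) : A := xget 0 [set y | is_val f y].

Let PhiP f : ccont f -> is_val f (Phi f).
Proof. by move=> /is_val_ex[y hy]; exact: (xgetPex 0 (ex_intro (fun y => is_val f y) y hy)). Qed.

Lemma is_val_calculus : exists Phi, is_calculus u Phi.
Proof.
exists Phi; split.
- move=> a f g /ccontP fc /ccontP gc.
  apply: (is_val_uniq (f := fun z => a * f z + g z)).
    by apply/PhiP/ccontD => //; apply: ccontM => //; exact: ccont_cst.
  by apply: is_val_lin; exact: PhiP.
- move=> f g /ccontP fc /ccontP gc.
  apply: (is_val_uniq (f := fun z => f z * g z)); first exact/PhiP/ccontM.
  by apply: is_valM => //; exact: PhiP.
- move=> f /ccontP fc.
  apply: (is_val_uniq (f := fun z => conjc (f z))); first exact/PhiP/ccontJ.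
  by apply: is_valJ; exact: PhiP.
- apply: (is_val_uniq (f := fun=> 1)); first exact/PhiP/ccont_cst.
  move=> e e0; exists 0%N, 1; split => [z|].
    by rewrite /trig !(hornerE, expr0, invr1, mul1r, mulr1) subrr cabs0 ltW.
  by rewrite /trig_op /peval rmorph1 mul1r subrr cnorm0 ltW.
- apply: (is_val_uniq (f := cval)); first exact/PhiP/ccont_cval.
  move=> e e0; exists 0%N, 'X; split => [z|].
    by rewrite /trig !(hornerE, expr0, invr1, mul1r, mulr1) subrr cabs0 ltW.
  by rewrite /trig_op /peval horner_algX mul1r subrr cnorm0 ltW.
Qed.

End Calculus.

(** * Uniqueness and rules of the functional calculus *)

Section CalculusUnique.
Variables (R : realType) (A : cstarAlgType R) (u : A) (Psi : (circle R -> R[i]^o) -> A).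
Hypothesis hu : unitary u.
Hypothesis hP : is_calculus u Psi.
Local Notation C := R[i].
Local Notation T := (circle R).

(** The square root is uniformly continuous: [|x - y|] is at most [x + y]. *)
Lemma sqrt_dist (a b : R) : 0 <= a -> 0 <= b ->
  (Num.sqrt a - Num.sqrt b) ^+ 2 <= `|a - b|.
Proof.
move=> a0 b0; have sa := sqr_sqrtr a0; have sb := sqr_sqrtr b0.
have := sqrtr_ge0 a; have := sqrtr_ge0 b.
rewrite -{3}sa -{3}sb; move: (Num.sqrt a) (Num.sqrt b) => x y y0 x0.
rewrite subr_sqr normrM [`|x + y|]ger0_norm ?addr_ge0 // -[X in X <= _]real_normK ?num_real //.
rewrite expr2 ler_wpM2l // ler_norml; apply/andP; split; lra.
Qed.

Lemma ccont_sqrt (r : T -> R) : (forall z, 0 <= r z) -> ccont (fun z => (r z)%:C) ->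
  ccont (fun z => (Num.sqrt (r z))%:C).
Proof.
move=> r0 rc z e e0; have [|d d0 hd] := rc z (e ^+ 2); first by rewrite exprn_gt0.
exists d => // w /hd; rewrite -!rmorphB !cabs_real => h.
rewrite -(@ltr_pXn2r _ 2%N) ?nnegrE ?normr_ge0 ?(ltW e0) //.
by rewrite real_normK ?num_real //; apply: le_lt_trans h; apply: sqrt_dist.
Qed.

Let PsiD (f g : T -> C) : ccont f -> ccont g -> Psi (fun z => f z + g z) = Psi f + Psi g.
Proof.
case: hP => h _ _ _ _ /ccontP fc /ccontP gc; rewrite -[Psi f]scale1r -h //.
by congr Psi; apply/funext => z; rewrite mul1r.
Qed.

Let Psi0 : Psi (fun=> 0) = 0.
Proof.
have c0 : ccont (fun=> 0 : C) := @ccont_cst R 0.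
by apply: (addrI (Psi (fun=> 0))); rewrite -PsiD // [RHS]addr0; congr Psi; apply/funext => z; rewrite addr0.
Qed.

Let PsiZ a (f : T -> C) : ccont f -> Psi (fun z => a * f z) = a *: Psi f.
Proof.
case: hP => h _ _ _ _ /ccontP fc; have /ccontP c0 := @ccont_cst R 0.
rewrite -[RHS]addr0 -Psi0 -h //; congr Psi; apply/funext => z; by rewrite addr0.
Qed.

Let PsiM (f g : T -> C) : ccont f -> ccont g -> Psi (fun z => f z * g z) = Psi f * Psi g.
Proof. by case: hP => _ h _ _ _ /ccontP fc /ccontP gc; apply: h. Qed.

Let PsiJ (f : T -> C) : ccont f -> Psi (fun z => conjc (f z)) = star (Psi f).
Proof. by case: hP => _ _ h _ _ /ccontP fc; apply: h. Qed.

Let Psi1 : Psi (fun=> 1) = 1. Proof. by case: hP. Qed.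
Let PsiU : Psi cval = u. Proof. by case: hP. Qed.

Let PsiX (f : T -> C) n : ccont f -> Psi (fun z => f z ^+ n) = Psi f ^+ n.
Proof.
move=> fc; elim: n => [|n IH]; first by rewrite expr0 -Psi1.
rewrite exprS -IH -PsiM //; last exact: ccontX.
by congr Psi; apply/funext => z; rewrite exprS.
Qed.

Let Psi_trig D p : Psi (trig D p) = trig_op u D p.
Proof.
have cv := @ccont_cval R; have cvJ := ccontJ cv.
have cp (q : {poly C}) : ccont (fun z : T => q.[cval z]).
  have -> : (fun z : T => q.[cval z]) = trig 0 q.
    by apply/funext => z; rewrite /trig expr0 invr1 mul1r.
  exact: ccont_trig.
have -> : trig D p = fun z => conjc (cval z) ^+ D * p.[cval z].
  by apply/funext => z; rewrite /trig conjc_cval exprVn.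
rewrite PsiM //; last exact: ccontX.
rewrite /trig_op PsiX // PsiJ // PsiU; congr (_ * _).
elim/poly_ind: p => [|p c IH].
  have -> : (fun z : T => (0 : {poly C}).[cval z]) = fun=> 0.
    by apply/funext => z; rewrite horner0.
  by rewrite Psi0 /peval rmorph0.
have -> : (fun z : T => (p * 'X + c%:P).[cval z]) = fun z => p.[cval z] * cval z + c * 1.
  by apply/funext => z; rewrite hornerMXaddC mulr1.
have c1 := @ccont_cst R 1.
have h1 := ccontM (cp p) cv; have h2 := ccontM (@ccont_cst R c) c1.
rewrite PsiD // PsiM // PsiZ // Psi1 PsiU IH.
by rewrite /peval rmorphD rmorphM /= horner_algX horner_algC.
Qed.

Let Psi_real (r : T -> R) : ccont (fun z => (r z)%:C) -> (forall z, `|r z| <= 1) ->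
  cnorm (Psi (fun z => (r z)%:C)) <= 1.
Proof.
move=> rc r1.
have r2 z : r z * r z <= 1.
  by have := r1 z; rewrite ler_norml => /andP[h1 h2]; nra.
pose q z := Num.sqrt (1 - r z * r z).
have qc : ccont (fun z => (q z)%:C).
  apply: ccont_sqrt => [z|]; first by rewrite subr_ge0.
  have -> : (fun z => (1 - r z * r z)%:C) = fun z => 1 + (-1) * ((r z)%:C * (r z)%:C).
    by apply/funext => z; rewrite rmorphB rmorphM rmorph1 mulN1r.
  apply: ccontD; first exact: ccont_cst.
  by apply: ccontM; [exact: ccont_cst|exact: ccontM].
pose w z := (r z)%:C + 'i%C * (q z)%:C.
have wc : ccont w by apply: ccontD => //; apply: ccontM => //; exact: ccont_cst.
have ww z : conjc (w z) * w z = 1.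
  have q2 : q z ^+ 2 = 1 - r z * r z by rewrite sqr_sqrtr // subr_ge0.
  rewrite mulrC sqr_cabs cabs_sqrt sqr_sqrtr ?addr_ge0 ?sqr_ge0 //.
  rewrite (_ : Re (w z) = r z); last by rewrite /w /=; ring.
  rewrite (_ : Im (w z) = q z); last by rewrite /w /=; ring.
  by rewrite q2 expr2 addrC subrK.
have Pw : cnorm (Psi w) = 1.
  apply: cnorm_isometry; rewrite -PsiJ // -PsiM //; last exact: ccontJ.
  by rewrite (_ : (fun z => _) = fun=> 1) //; apply/funext.
have E : (2%:R : C) *: Psi (fun z => (r z)%:C) = Psi w + star (Psi w).
  rewrite -PsiJ // -PsiD //; last exact: ccontJ.
  rewrite -PsiZ //; congr Psi; apply/funext => z; rewrite addcJ; congr (_ * _%:C).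
  by rewrite /w /=; ring.
have := cnormD (Psi w) (star (Psi w)); rewrite -E cnormZE cabs_nat cnorm_star Pw; lra.
Qed.

Let Psi_le (f : T -> C) M : ccont f -> (forall z, cabs (f z) <= M) -> cnorm (Psi f) <= M.
Proof.
move=> fc fM; have M0 : 0 <= M by apply: le_trans (fM 1%g); exact: cabs_ge0.
apply: le_eps => e e0; have Me : 0 < M + e by lra.
pose r z := (M + e) ^- 2 * cabs (f z) ^+ 2.
have rE : (fun z => (r z)%:C) = fun z => ((M + e) ^- 2)%:C * (conjc (f z) * f z).
  by apply/funext => z; rewrite real_complexM [conjc _ * _]mulrC sqr_cabs.
have cff : ccont (fun z => conjc (f z) * f z) by apply: ccontM => //; exact: ccontJ.
have rc : ccont (fun z => (r z)%:C).
  by rewrite rE; apply: ccontM => //; exact: ccont_cst.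
have := Psi_real rc _; rewrite rE PsiZ // PsiM //; last exact: ccontJ.
rewrite PsiJ // cnormZE cstar_identity cabs_real ger0_norm ?invr_ge0 ?exprn_ge0 ?(ltW Me) //.
rewrite mulrC ler_pdivrMr ?exprn_gt0 // mul1r => H.
rewrite -(@ler_pXn2r _ 2%N) ?nnegrE ?cnorm_ge0 ?(ltW Me) //; apply: H => z.
rewrite ger0_norm /r; last by rewrite mulr_ge0 ?sqr_ge0 // invr_ge0 sqr_ge0.
rewrite mulrC ler_pdivrMr ?exprn_gt0 // mul1r lerXn2r ?nnegrE ?cabs_ge0 ?(ltW Me) //.
by apply: le_trans (fM z) _; lra.
Qed.

(** A calculus is contractive on real functions, which are real parts of unimodular ones,
    and then on all functions by the C*-identity. It is thus determined by its values on
    Laurent polynomials. *)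
Lemma calculus_is_val (f : T -> C) : ccont f -> is_val u f (Psi f).
Proof.
move=> fc e e0; have [D [p fp]] := trig_dense fc e0; exists D, p; split=> //.
have tc := @ccont_trig R D p.
have tc' := ccontM (@ccont_cst R (-1)) tc.
rewrite -Psi_trig -scaleN1r -PsiZ // -PsiD //; apply: Psi_le; first exact: ccontD.
by move=> z; rewrite mulN1r.
Qed.

End CalculusUnique.

Section Cfc.
Variables (R : realType) (A : cstarAlgType R) (u : A).
Hypothesis hu : unitary u.
Local Notation C := R[i].
Local Notation T := (circle R).
Implicit Types (f g : T -> C).

(** Whichever calculus defines [cfc u f], its value is the same. *)
Lemma cfcP f : ccont f -> is_val u f (cfc u f).
Proof.
move=> fc; have [Phi hPhi] := is_val_calculus hu.
rewrite /cfc; set X := [set y | _].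
have : X (xget 0 X) by apply: (xgetPex 0 (P := X)); exists (Phi f); exists Phi.
by case=> Psi hPsi ->; exact: calculus_is_val.
Qed.

Lemma cfcE f y : is_val u f y -> ccont f -> cfc u f = y.
Proof. by move=> fy fc; apply: is_val_uniq (cfcP fc) fy. Qed.

Lemma cfc_trig D p : cfc u (trig D p) = trig_op u D p.
Proof. by apply: cfcE; [exact: is_val_trig|exact: ccont_trig]. Qed.

Lemma cfcM f g : ccont f -> ccont g -> cfc u (fun z => f z * g z) = cfc u f * cfc u g.
Proof. by move=> fc gc; apply: cfcE; [apply: is_valM => //; exact: cfcP|exact: ccontM]. Qed.

Lemma cfcJ f : ccont f -> cfc u (fun z => conjc (f z)) = star (cfc u f).
Proof. by move=> fc; apply: cfcE; [apply: is_valJ => //; exact: cfcP|exact: ccontJ]. Qed.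

Lemma cfcD f g : ccont f -> ccont g -> cfc u (fun z => f z + g z) = cfc u f + cfc u g.
Proof.
move=> fc gc; apply: cfcE; last exact: ccontD.
have := is_val_lin hu 1 (cfcP fc) (cfcP gc); rewrite scale1r.
by have -> : (fun z => 1 * f z + g z) = fun z => f z + g z by apply/funext => z; rewrite mul1r.
Qed.

Lemma cfc_cst a : cfc u (fun=> a) = a *: 1.
Proof.
apply: cfcE; last exact: ccont_cst.
move=> e e0; exists 0%N, a%:P; split => [z|].
  by rewrite /trig hornerC expr0 invr1 mul1r subrr cabs0 ltW.
by rewrite /trig_op /peval horner_algC mul1r subrr cnorm0 ltW.
Qed.

Lemma cfc_cval : cfc u cval = u.
Proof.
have -> : cval = trig 0 'X :> (T -> C).
  by apply/funext => z; rewrite /trig hornerX expr0 invr1 mul1r.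
by rewrite cfc_trig /trig_op /peval horner_algX mul1r.
Qed.

Lemma cfc_le f M : ccont f -> (forall z, cabs (f z) <= M) -> cnorm (cfc u f) <= M.
Proof. by move=> fc; apply: is_val_le (cfcP fc). Qed.

Lemma cfcB f g : ccont f -> ccont g -> cfc u (fun z => f z - g z) = cfc u f - cfc u g.
Proof.
move=> fc gc; apply: (addIr (cfc u g)); rewrite subrK -cfcD //; last exact: ccontB.
by congr (cfc u _); apply/funext => z; rewrite subrK.
Qed.

Lemma cfc_unitary f : ccont f -> (forall z, cabs (f z) = 1) -> unitary (cfc u f).
Proof.
move=> fc f1; have fJ := ccontJ fc.
have E z : f z * conjc (f z) = 1 by rewrite sqr_cabs f1 expr1n.
have H1 : (fun=> 1) = fun z => conjc (f z) * f z by apply/funext => z; rewrite mulrC E.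
have H2 : (fun=> 1) = fun z => f z * conjc (f z) by apply/funext => z; rewrite E.
by split; rewrite -cfcJ // -cfcM // -?H1 -?H2 cfc_cst scale1r.
Qed.

Lemma peval_gen p : cstar_gen [set u] (peval u p).
Proof.
have [gZ gM gS g0 _] := cstar_gen_subalg (A := A) [set u].
have gu : cstar_gen [set u] u by apply: cstar_gen_sub.
have g1 : cstar_gen [set u] 1 by case: hu => <- _; apply: gM => //; apply: gS.
elim/poly_ind: p => [|p c IH]; first by rewrite /peval rmorph0.
rewrite /peval rmorphD rmorphM /= horner_algX horner_algC addrC.
by apply: gZ => //; apply: gM.
Qed.

Lemma trig_op_gen D p : cstar_gen [set u] (trig_op u D p).
Proof.
have [gZ gM gS g0 _] := cstar_gen_subalg (A := A) [set u].
rewrite /trig_op; apply: gM; last exact: peval_gen.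
by rewrite -starX; apply: gS; rewrite -peval_Xn; exact: peval_gen.
Qed.

Lemma zpow_gen m : cstar_gen [set u] (zpow u m).
Proof.
have := trig_op_gen; case: m => n /= h.
  by rewrite -(mul1r (u ^+ n)) -(peval_Xn u) -(expr0 (star u)); exact: h.
by rewrite -(mulr1 (_ ^+ _)) -(rmorph1 (horner_alg u)); exact: h.
Qed.

Lemma cfc_gen f : ccont f -> cstar_gen [set u] (cfc u f).
Proof.
move=> fc; apply: subalg_cclosed; first exact: cstar_gen_subalg.
move=> e e0; have [|D [p [_ h]]] := cfcP fc (e := e / 2%:R); first by rewrite divr_gt0.
by exists (trig_op u D p); [exact: trig_op_gen|lra].
Qed.

Lemma cstar_gen_comm x y : x * u = u * x -> cstar_gen [set u] y -> x * y = y * x.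
Proof.
move=> xu; have xus := comm_staru hu xu.
suff H : cstar_subalg [set y | y * x = x * y /\ star y * x = x * star y].
  by move=> /(cstar_gen_min H)[] // _ -> /=.
apply: cclosed_subalg => /=.
- move=> l h; split; apply: (cclosed_comm (x := x)) => e /h[z [z1 z2] lz]; first by exists z.
  by exists (star z) => //; rewrite -starB cnorm_star.
- move=> a y1 y2 [h1 h2] [h3 h4] /=; rewrite starD starZE.
  by rewrite !mulrDr !mulrDl -!scalerAr -!scalerAl h1 h2 h3 h4.
- move=> y1 y2 [h1 h2] [h3 h4]; rewrite starM.
  by split; [rewrite -mulrA h3 mulrA h1 mulrA|rewrite -mulrA h2 mulrA h4 mulrA].
- by move=> y1 [h1 h2]; rewrite starK.
- by rewrite star0 !mulr0 !mul0r.
Qed.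

Lemma cfc_comm x f : ccont f -> x * u = u * x -> x * cfc u f = cfc u f * x.
Proof. by move=> fc xu; apply: cstar_gen_comm => //; exact: cfc_gen. Qed.

(** It suffices to check Laurent polynomials, for which the substitution of [z ^ n] is
    explicit. *)
Lemma cfc_intertwine x f n : ccont f -> x * u = u ^+ n * x -> x * star u = star u ^+ n * x ->
  x * cfc u f = cfc u (fun z => f (z ^+ n)%g) * x.
Proof.
move=> fc xu xus.
have fnc : ccont (fun z => f (z ^+ n)%g).
  by apply: ccont_comp => //; apply: ccont_powg; exact: ccont_cval.
have xX (m : nat) : x * u ^+ m = u ^+ (n * m) * x.
  elim: m => [|m IH]; first by rewrite muln0 mulr1 mul1r.
  by rewrite exprSr mulrA IH -mulrA xu mulrA -exprD mulnS addnC.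
have xXs (m : nat) : x * star u ^+ m = star u ^+ (n * m) * x.
  elim: m => [|m IH]; first by rewrite muln0 mulr1 mul1r.
  by rewrite exprSr mulrA IH -mulrA xus mulrA -exprD mulnS addnC.
have xt D p : x * trig_op u D p = trig_op u (n * D) (p \Po 'X^n) * x.
  rewrite /trig_op mulrA xXs -!mulrA; congr (_ * _).
  rewrite pevalE mulr_sumr comp_polyE /peval linear_sum /= mulr_suml; apply: eq_bigr => i _.
  by rewrite -!/(peval _ _) pevalZ -exprM peval_Xn -scalerAr -scalerAl xX.
have tE D p z : trig D p (z ^+ n)%g = trig (n * D) (p \Po 'X^n) z :> C.
  by rewrite /trig cvalX -exprM horner_comp hornerXn.
apply/eqP; rewrite -subr_eq0; apply/eqP/cnorm_small => e e0.
pose k := e / (2%:R * (cnorm x + 1)); have x0 := cnorm_ge0 x.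
have k0 : 0 < k by rewrite divr_gt0 // mulr_gt0 //; lra.
have kE : (cnorm x + 1) * k = e / 2%:R by rewrite /k; field; rewrite gt_eqF //; lra.
have [D [p [fp yp]]] := cfcP fc k0.
set y := cfc u f in yp *; set y' := cfc u _.
have h2 : cnorm (y' - trig_op u (n * D) (p \Po 'X^n)) <= k.
  rewrite -cfc_trig -cfcB //; last exact: ccont_trig.
  apply: cfc_le; last by move=> z; rewrite -tE.
  by apply: ccontB => //; exact: ccont_trig.
have -> : x * y - y' * x = x * (y - trig_op u D p) - (y' - trig_op u (n * D) (p \Po 'X^n)) * x.
  by rewrite mulrBr mulrBl xt opprB addrA subrK.
move: yp h2; set s := y - _; set t := y' - _ => yp h2.
have := cnormB (x * s) (t * x); have := cnormM x s; have := cnormM t x.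
have := cnorm_ge0 s; have := cnorm_ge0 t; nra.
Qed.

End Cfc.

(** * Twisting the relations by a cocycle *)

Section CircleGroup.
Variables (R : realType) (S : set nat).
Local Notation T := (circle R).
Local Notation P := (gen_monoid S).
Implicit Types (z w : T) (p q : P).

Lemma circle_mulgI z w1 w2 : (z * w1 = z * w2)%g -> w1 = w2.
Proof. by move=> /(congr1 cval); rewrite !cvalM => /(mulfI (cval_neq0 z))/cval_inj. Qed.

Lemma circle_expgMn z w n : ((z * w) ^+ n = z ^+ n * w ^+ n)%g.
Proof. by apply: cval_inj; rewrite cvalM !cvalX cvalM exprMn. Qed.

Lemma circle_expgM z m n : ((z ^+ m) ^+ n = z ^+ (m * n))%g.
Proof. by apply: cval_inj; rewrite !cvalX exprM. Qed.

Lemma cvalV z : cval (z^-1)%g = (cval z)^-1.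
Proof. by []. Qed.

Lemma gen_mulC p q : (p * q = q * p)%g.
Proof. by apply/val_inj; rewrite /= mulnC. Qed.

Lemma gen_valM p q : nat_of_gen (p * q)%g = (p * q)%N.
Proof. by []. Qed.

Lemma gen_val_inj : injective (@nat_of_gen S).
Proof. by move=> p q h; apply: val_inj. Qed.

Hypothesis S_gt1 : forall a, S a -> (1 < a)%N.

Lemma gen_gt0 p : (0 < p)%N.
Proof.
have : gen_monoid_set S `<=` [set n | (0 < n)%N].
  move=> n; apply; split=> [|a /S_gt1]; last exact: ltnW.
  by split=> // a b /= a0 b0; rewrite muln_gt0 a0.
by apply; exact: (set_mem (valP p)).
Qed.

Definition gen_pow p k : P := iter k (gen_monoid_mul p) (@gen_monoid_one S).

Lemma gen_powE p k : nat_of_gen (gen_pow p k) = (p ^ k)%N.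
Proof. by elim: k => [|k IH] //; rewrite expnS -IH. Qed.

End CircleGroup.

Section Relations.
Variables (R : realType) (S : set nat) (A : cstarAlgType R).
Local Notation P := (gen_monoid S).
Local Notation T := (circle R).
Variables (u : A) (s : P -> A).
Hypothesis rel : Q_relations u s.
Implicit Types (p q : P) (f g : T -> R[i]).

Lemma rel_unitary : unitary u. Proof. exact: Q_unitary rel. Qed.
Local Notation hu := rel_unitary.

Lemma rel_iso p : star (s p) * s p = 1. Proof. exact: Q_isometry rel p. Qed.

Lemma sE p (m : int) : s p * zpow u m = zpow u (p%:Z * m) * s p.
Proof. exact: Q_I rel p m. Qed.

Lemma sstarE p (m : int) : star (s p) * zpow u (p%:Z * m) = zpow u m * star (s p).
Proof.
have := congr1 (@star R A) (sE p (- m)).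
by rewrite !starM !star_zpow // mulrN !opprK.
Qed.

Lemma s_u p : s p * u = u ^+ p * s p.
Proof. by have := sE p 1; rewrite zpow1 mulr1. Qed.

Lemma s_ustar p : s p * star u = star u ^+ p * s p.
Proof.
have := sE p (-1); rewrite mulrN1 [zpow u (-1)]/= expr1 => ->; congr (_ * _).
by case: (nat_of_gen p).
Qed.

Lemma s_cfc p f : ccont f -> s p * cfc u f = cfc u (fun z => f (z ^+ p)%g) * s p.
Proof. move=> fc; exact: (cfc_intertwine hu fc (s_u p) (s_ustar p)). Qed.

Lemma ccont_pow f n : ccont f -> ccont (fun z => f (z ^+ n)%g).
Proof. by move=> fc; apply: ccont_comp => //; apply: ccont_powg; exact: ccont_cval. Qed.

Lemma sstar_cfc p f : ccont f -> star (s p) * cfc u (fun z => f (z ^+ p)%g) = cfc u f * star (s p).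
Proof.
have hu' := hu; move=> fc; have fJ := ccontJ fc; have := congr1 (@star R A) (s_cfc p fJ).
rewrite !starM -!cfcJ //; last exact: (ccont_pow p fJ).
have E g : (fun z => conjc (conjc (g z))) = g by apply/funext => z; rewrite conjcK.
by rewrite E (E (fun z => f (z ^+ p)%g)) => <-.
Qed.

Lemma zpow_cfc m f : ccont f -> zpow u m * cfc u f = cfc u f * zpow u m.
Proof. by move=> fc; apply: (cfc_comm hu fc); apply/esym; apply: (zpow_comm hu). Qed.

(** [Q_III] as a decomposition of [x], to be used with the products [x u^m s_p]. *)
Lemma rel_sum p x : x = \sum_(m < p) x * (zpow u m * s p) * star (zpow u m * s p).
Proof.
rewrite -{1}(mulr1 x) -(Q_III rel p) mulr_sumr; apply: eq_bigr => m _.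
by rewrite starM star_zpow // !mulrA.
Qed.

(** The elements [u^m s_p] separate by [Q_III], and [u^m] can be moved to the left
    of [x] and [y]. *)
Lemma cancel_s p x y : x * u = u * x -> y * u = u * y -> x * s p = y * s p -> x = y.
Proof.
move=> xu yu xy; rewrite (rel_sum p x) [RHS](rel_sum p y); apply: eq_bigr => m _.
by rewrite !mulrA (zpow_comm hu _ xu) (zpow_comm hu _ yu) -!(mulrA (zpow u m)) xy.
Qed.

Section Twist.
Variable psi : P -> T -> T.
Hypothesis hpsi : Hom_theta psi.
Local Notation psiv p := (fun z => cval (psi p z)).
Local Notation W p := (cfc u (psiv p)).

Lemma psi_cont p : ccont (psiv p).
Proof. by case: hpsi => h _; apply/ccont_circle. Qed.

Lemma psi_mul p q z : psi (p * q)%g z = (psi p z * psi q (z ^+ p))%g.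
Proof. by case: hpsi. Qed.

Lemma psi_one z : psi 1%g z = 1%g.
Proof.
have := psi_mul 1%g 1%g z; rewrite mulg1 expg1 -{1}[psi 1%g z]mulg1.
by move=> /circle_mulgI.
Qed.

Lemma W_unitary p : unitary (W p).
Proof. by apply: (cfc_unitary hu (psi_cont p)) => z; exact: cval_abs. Qed.

Lemma W_mul p q : W (p * q)%g = W p * cfc u (fun z => cval (psi q (z ^+ p)%g)).
Proof.
rewrite -cfcM //; [|exact: hu|exact: psi_cont|exact: (ccont_pow p (psi_cont q))].
by congr (cfc u _); apply/funext => z; rewrite psi_mul cvalM.
Qed.

(** The cocycle identity for [p p'] and for [q q'] exchanges functions of [z] for functions
    of [z ^ p] and [z ^ q], which can be moved across [s_p^*] and [s_q]. *)
Lemma W_star p q p' q' : (p * p' = q * q')%g ->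
  star (W p) * W q = cfc u (fun z => cval (psi p' (z ^+ p)%g)) *
                     star (cfc u (fun z => cval (psi q' (z ^+ q)%g))).
Proof.
move=> pq; have c1 := psi_cont p; have c2 := psi_cont q.
have c3 := ccont_pow p (psi_cont p'); have c4 := ccont_pow q (psi_cont q').
have hu' := hu.
rewrite -!cfcJ // -!cfcM //; [|exact: ccontJ|exact: ccontJ].
congr (cfc u _); apply/funext => z; rewrite !conjc_cval.
have := congr1 (fun r => cval (psi r z)) pq; rewrite !psi_mul !cvalM => E.
apply: (mulfI (cval_neq0 (psi p z))); apply: (mulIf (cval_neq0 (psi q' (z ^+ q)%g))).
by rewrite !mulrA mulfV ?cval_neq0 // mul1r E -!mulrA mulVf ?cval_neq0 // mulr1.
Qed.

(** In [Q_II], [W_star] carries the twist from one side to the other. When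
    the product vanishes there is no given pair [p', q'], and [q, p] serves instead. *)
Lemma twist_relations : Q_relations u (fun p => W p * s p).
Proof.
have hu' := hu.
have Wz p m : zpow u m * W p = W p * zpow u m by apply: zpow_cfc; exact: psi_cont.
have Wzs p m : zpow u m * star (W p) = star (W p) * zpow u m.
  have := congr1 (@star R A) (Wz p (- m)).
  by rewrite !starM !star_zpow // !opprK.
split.
- exact: hu.
- move=> p; rewrite starM mulrA -(mulrA (star (s p))); case: (W_unitary p) => -> _.
  by rewrite mulr1 rel_iso.
- move=> p q; rewrite W_mul (Q_mul rel) mulrA -(mulrA (W p)).
  by rewrite -(s_cfc p (psi_cont q)) !mulrA.
- have -> : psiv 1%g = fun=> 1 by apply/funext => z; rewrite psi_one.
  by rewrite cfc_cst // scale1r mul1r (Q_one rel).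
- by move=> p m; rewrite -mulrA sE mulrA -Wz mulrA.
- move=> p q p' q' m m1 m2 mE pI pq; rewrite !starM.
  have -> : star (s p) * star (W p) * zpow u m * (W q * s q) =
     zpow u m1 * (star (s p) * (star (W p) * W q) * s q) * zpow u m2.
    (* split [u ^ m] and push each half outwards through its isometry *)
    have E1 : zpow u (q%:Z * m2) * (W q * s q) = W q * s q * zpow u m2.
      by rewrite mulrA Wz -mulrA -sE mulrA.
    have E2 : star (s p) * star (W p) * zpow u (p%:Z * m1) = zpow u m1 * star (s p) * star (W p).
      by rewrite -mulrA -Wzs mulrA sstarE.
    by rewrite mE zpowD // [_ * (zpow u _ * zpow u _)]mulrA E2 -[LHS]mulrA E1 !mulrA.
  rewrite (W_star pq) [star (s p) * (_ * _)]mulrA (sstar_cfc p (psi_cont p')) .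
  have hq := psi_cont q'.
  rewrite -[_ * star _ * s q]mulrA.
  have -> : star (cfc u (fun z => cval (psi q' (z ^+ q)%g))) * s q = s q * star (W q').
    have c := psi_cont q'; have cJ := ccontJ c; rewrite -!cfcJ //; last exact: (ccont_pow q c).
    by rewrite (s_cfc q cJ).
  have h0 := Q_II rel (m := 0) (m1 := 0) (m2 := 0) _ pI pq.
  rewrite !mulr0 addr0 !mulr1 !mul1r in h0; have {}h0 := h0 erefl.
  by rewrite -!mulrA [star (s p) * _]mulrA h0 -!mulrA.
- move=> p q m hm; rewrite starM.
  have -> : star (s p) * star (W p) * zpow u m * (W q * s q) =
     star (s p) * (star (W p) * W q) * zpow u m * s q.
    by rewrite -!mulrA; do 2 congr (_ * _); rewrite !mulrA Wz.
  rewrite (W_star (gen_mulC p q)) [star (s p) * (_ * _)]mulrA (sstar_cfc p (psi_cont q)).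
  have c := psi_cont p; have cJ := ccontJ c; have cJq := ccont_pow q cJ.
  rewrite -(cfcJ (u := u)) //; last exact: (ccont_pow q c).
  rewrite -!mulrA [cfc u _ * (zpow u m * _)]mulrA -zpow_cfc // -(mulrA (zpow u m)) -(s_cfc q cJ).
  by rewrite [zpow u m * _]mulrA [star (s p) * _]mulrA [star (s p) * _]mulrA (Q_II0 rel) // mul0r mulr0.
- move=> p; rewrite (eq_bigr (fun m : 'I_p => W p * (zpow u m * s p * star (s p) * zpow u (- m%:Z)) * star (W p))).
    by rewrite -mulr_suml -mulr_sumr (Q_III rel) mulr1; case: (W_unitary p).
  by move=> m _; rewrite starM !mulrA -Wz -!mulrA; do 4 congr (_ * _); rewrite Wzs.
Qed.

End Twist.

End Relations.

(** * The automorphisms attached to cocycles *)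

Section HomTheta.
Variables (R : realType) (S : set nat).
Local Notation P := (gen_monoid S).
Local Notation T := (circle R).
Implicit Types psi : P -> T -> T.

Lemma Hom_theta_mul psi1 psi2 : Hom_theta psi1 -> Hom_theta psi2 ->
  Hom_theta (fun p z => psi1 p z * psi2 p z)%g.
Proof.
move=> h1 h2; split=> [p|p q z].
  by apply/ccont_circle; apply: ccontM; [exact: (psi_cont h1)|exact: (psi_cont h2)].
rewrite (psi_mul h1) (psi_mul h2); apply: cval_inj; rewrite !cvalM; ring.
Qed.

Lemma Hom_theta_inv psi : Hom_theta psi -> Hom_theta (fun p z => (psi p z)^-1)%g.
Proof.
move=> h; split=> [p|p q z].
  apply/ccont_circle.
  have -> : (fun z => cval (psi p z)^-1%g) = fun z => conjc (cval (psi p z)).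
    by apply/funext => z; rewrite conjc_cval.
  exact/ccontJ/(psi_cont h).
by rewrite (psi_mul h); apply: cval_inj; rewrite cvalM !cvalV cvalM invfM.
Qed.

Lemma Hom_theta_cst (chi : P -> T) : (forall p q, chi (p * q)%g = (chi p * chi q)%g) ->
  Hom_theta (fun p _ => chi p).
Proof. by move=> h; split=> [p|p q z]; [apply: cst_continuous|exact: h]. Qed.

End HomTheta.

Section Universal.
Variables (R : realType) (S : set nat).
Local Notation P := (gen_monoid S).
Local Notation T := (circle R).
Local Notation C := R[i].
Hypothesis S_gt1 : forall a, S a -> (1 < a)%N.
Variables (Q : cstarAlgType R) (u : Q) (s : P -> Q).
Hypothesis univ : is_universal_Q u s.
Implicit Types (p q : P) (g : T -> C) (psi : P -> T -> T) (x y : Q).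

Lemma univ_rel : Q_relations u s. Proof. by case: univ. Qed.
Local Notation rel := univ_rel.
Let hu : unitary u := rel_unitary univ_rel.

Lemma hom_eq (B : cstarAlgType R) (f h : Q -> B) : star_hom f -> star_hom h ->
  f u = h u -> (forall p, f (s p) = h (s p)) -> f = h.
Proof.
move=> hf hg fu fs; apply/funext => x; have [_ gen _] := univ.
apply: (star_hom_eq_gen hf hg (X := [set u] `|` range s)); last by rewrite gen.
by move=> y [->|[p _ <-]].
Qed.

Lemma hom_fix_cfc (f : Q -> Q) g : star_hom f -> f u = u -> ccont g -> f (cfc u g) = cfc u g.
Proof.
move=> hf fu gc; apply: (star_hom_eq_gen hf (star_hom_id Q) (X := [set u])).
  by move=> y ->.
exact: cfc_gen.
Qed.

Definition beta_spec psi (f : Q -> Q) : Prop :=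
  [/\ star_hom f, f u = u &
     forall p, f (s p) = cfc u (fun z => cval (psi p z)) * s p].

Definition beta psi : Q -> Q :=
  if pselect (exists f : Q -> Q, beta_spec psi f) is left e then sval (cid e) else id.

Lemma betaP psi : Hom_theta psi -> beta_spec psi (beta psi).
Proof.
move=> hpsi; have [_ _ un] := univ; have ex := un _ _ _ (twist_relations rel hpsi).
by rewrite /beta; case: pselect => [e|/(_ ex)//]; case: cid.
Qed.

Lemma beta_hom psi : Hom_theta psi -> star_hom (beta psi).
Proof. by move=> /betaP[]. Qed.
Lemma beta_u psi : Hom_theta psi -> beta psi u = u.
Proof. by move=> /betaP[]. Qed.
Lemma beta_s psi p : Hom_theta psi ->
  beta psi (s p) = cfc u (fun z => cval (psi p z)) * s p.
Proof. by move=> /betaP[]. Qed.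

Lemma beta_mul psi1 psi2 : Hom_theta psi1 -> Hom_theta psi2 ->
  beta (fun p z => psi1 p z * psi2 p z)%g = beta psi1 \o beta psi2.
Proof.
move=> h1 h2; have h12 := Hom_theta_mul h1 h2.
apply: hom_eq; first exact: beta_hom.
- by apply: star_hom_comp; exact: beta_hom.
- by rewrite /= !beta_u.
- move=> p /=; rewrite !beta_s // (star_homM (beta_hom h1)) beta_s //.
  rewrite (hom_fix_cfc (beta_hom h1) (beta_u h1) (psi_cont h2 p)) mulrA.
  rewrite -cfcM //; [|exact: (psi_cont h2)|exact: (psi_cont h1)].
  by congr (cfc u _ * _); apply/funext => z; rewrite mulrC.
Qed.

Lemma beta_id psi : Hom_theta psi -> (forall p z, psi p z = 1%g) -> beta psi = id.
Proof.
move=> h h1; apply: hom_eq; [exact: beta_hom|exact: star_hom_id|exact: beta_u|].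
move=> p; rewrite beta_s //.
have -> : (fun z => cval (psi p z)) = fun=> 1 by apply/funext => z; rewrite h1.
by rewrite cfc_cst // scale1r mul1r.
Qed.

(** The inverse cocycle gives the inverse endomorphism. *)
Lemma beta_aut psi : Hom_theta psi -> Aut_fix (cstar_gen [set u]) (beta psi).
Proof.
move=> h; have h' := Hom_theta_inv h; split; first split; first exact: beta_hom.
  have hi psi1 psi2 : Hom_theta psi1 -> Hom_theta psi2 ->
      (forall p z, psi1 p z * psi2 p z = 1)%g -> cancel (beta psi2) (beta psi1).
    move=> h1 h2 E x; have := beta_mul h1 h2; rewrite beta_id //; last exact: Hom_theta_mul.
    by move=> /(congr1 (fun f => f x)) /= <-.
  exists (beta (fun p z => (psi p z)^-1)%g); apply: hi => // p z.
    by rewrite mulVg.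
  by rewrite mulgV.
apply: (star_hom_eq_gen (beta_hom h) (star_hom_id Q)).
by move=> y ->; rewrite /= beta_u.
Qed.

(** * The gauge automorphisms *)

Section Gauge.
Variable chi : P -> T.
Hypothesis chiM : forall p q, chi (p * q)%g = (chi p * chi q)%g.
Let hc := Hom_theta_cst chiM.

Lemma gauge_s p : beta (fun p _ => chi p) (s p) = cval (chi p) *: s p.
Proof. by rewrite beta_s // cfc_cst // -scalerAl mul1r. Qed.

End Gauge.

Definition gchi (l : nat) (z : T) p : T := (z ^+ logn l p)%g.

Lemma gchiM l z p q : gchi l z (p * q)%g = (gchi l z p * gchi l z q)%g.
Proof. by rewrite /gchi gen_valM lognM ?gen_gt0 // expgnDr. Qed.

(** The gauge action of the [l]-th coordinate of a torus: prime exponents embed the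
    group of fractions into a direct sum of copies of the integers, indexed here by all
    natural numbers. *)
Definition gam l z : Q -> Q := beta (fun p _ => gchi l z p).

Let hgam l z := Hom_theta_cst (gchiM l z).

Lemma gam_hom l z : star_hom (gam l z). Proof. exact: beta_hom (hgam l z). Qed.
Lemma gam_u l z : gam l z u = u. Proof. exact: beta_u (hgam l z). Qed.
Lemma gam_s l z p : gam l z (s p) = cval z ^+ logn l p *: s p.
Proof. by rewrite /gam gauge_s; [rewrite cvalX|exact: gchiM]. Qed.

Lemma gam_zpow l z m : gam l z (zpow u m) = zpow u m.
Proof. by rewrite (star_hom_zpow (gam_hom l z)) gam_u. Qed.

Lemma gam_comm l z l' z' x : gam l z (gam l' z' x) = gam l' z' (gam l z x).
Proof.
suff /(congr1 (fun f => f x)) : gam l z \o gam l' z' = gam l' z' \o gam l z by [].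
apply: hom_eq; rewrite /= ?gam_u //; try by apply: star_hom_comp; exact: gam_hom.
move=> p /=; rewrite !gam_s !(star_homZ (gam_hom _ _)) !gam_s !scalerA mulrC //.
Qed.

Lemma gam_le l z x : cnorm (gam l z x) <= cnorm x.
Proof. exact/star_hom_le/gam_hom. Qed.

(** * The spanning monomials *)

Definition spanmon (m : int) p q (n : int) : Q := zpow u m * s p * star (s q) * zpow u n.

(** The exponent of [l] in the fraction [p / q] if [l] is prime, and [0] otherwise. *)
Definition deg l p q : int := (logn l p)%:Z - (logn l q)%:Z.

Lemma gam_spanmon l z m p q n : gam l z (spanmon m p q n) = cval z ^ deg l p q *: spanmon m p q n.
Proof.
rewrite /spanmon !(star_homM (gam_hom _ _)) !gam_zpow (star_hom_star (gam_hom _ _)) !gam_s.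
rewrite starZE -!(scalerAl, scalerAr) scalerA; congr (_ *: _).
rewrite rmorphXn /= conjc_cval /deg expfzDr ?cval_neq0 // -exprnP -exprnN mulrC exprVn.
by rewrite mulrC.
Qed.

(** A span presented as a list of monomials, for inductions that add them one by one. *)
Inductive span (B : P -> P -> Prop) : Q -> Prop :=
| span_nil : span B 0
| span_cons a m p q n x of B p q & span B x : span B (a *: spanmon m p q n + x).

Lemma spanD B x y : span B x -> span B y -> span B (x + y).
Proof.
by elim=> [|a m p q n z Bpq _ IH] hy; rewrite ?add0r // -addrA; right=> //; exact: IH.
Qed.

Lemma spanZ B a x : span B x -> span B (a *: x).
Proof.
elim=> [|b m p q n z Bpq _ IH]; first by rewrite scaler0; left.
by rewrite scalerDr scalerA; right.
Qed.

Lemma span_spanmon (B : P -> P -> Prop) m p q n : B p q -> span B (spanmon m p q n).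
Proof.
by move=> h; rewrite -[spanmon _ _ _ _]addr0 -[spanmon _ _ _ _]scale1r; right=> //; left.
Qed.

Lemma span_sum B (I : Type) (r : seq I) (F : I -> Q) :
  (forall i, span B (F i)) -> span B (\sum_(i <- r) F i).
Proof.
move=> h; elim: r => [|i r IH]; first by rewrite big_nil; left.
by rewrite big_cons; apply: spanD.
Qed.

Lemma span_lin (B B' : P -> P -> Prop) (F : Q -> Q) x : (forall a x y, F (a *: x + y) = a *: F x + F y) ->
  F 0 = 0 -> (forall m p q n, B p q -> span B' (F (spanmon m p q n))) -> span B x -> span B' (F x).
Proof.
move=> Fl F0 Fb; elim=> [|a m p q n y Bpq _ IH]; first by rewrite F0; left.
by rewrite Fl; apply: spanD => //; apply: spanZ; exact: Fb.
Qed.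

Let full : P -> P -> Prop := fun _ _ => True.
Local Notation spanT := (span full).

Lemma spanT_zl m x : spanT x -> spanT (zpow u m * x).
Proof.
apply: (@span_lin full full (fun x => zpow u m * x)) => [a y z||m' p q n _]; [by rewrite mulrDr scalerAr|by rewrite mulr0|].
by rewrite /spanmon !mulrA -zpowD //; exact: (@span_spanmon full).
Qed.

Lemma spanT_zr m x : spanT x -> spanT (x * zpow u m).
Proof.
apply: (@span_lin full full (fun x => x * zpow u m)) => [a y z||m' p q n _]; [by rewrite mulrDl scalerAl|by rewrite mul0r|].
by rewrite /spanmon -!mulrA -zpowD // !mulrA; exact: (@span_spanmon full).
Qed.

Lemma spanT_sl p x : spanT x -> spanT (s p * x).
Proof.
apply: (@span_lin full full (fun x => s p * x)) => [a y z||m' p' q n _]; [by rewrite mulrDr scalerAr|by rewrite mulr0|].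
rewrite /spanmon !mulrA (sE rel) -(mulrA _ (s p)) -(Q_mul rel).
exact: (@span_spanmon full).
Qed.

Lemma spanT_sstarr p x : spanT x -> spanT (x * star (s p)).
Proof.
apply: (@span_lin full full (fun x => x * star (s p))) => [a y z||m' p' q n _]; [by rewrite mulrDl scalerAl|by rewrite mul0r|].
rewrite /spanmon -mulrA -(sstarE rel) !mulrA -(mulrA _ (star _) (star _)) -starM -(Q_mul rel).
exact: (@span_spanmon full).
Qed.

(** [Q_II] and [Q_II0] for [q = p], where the condition on ideals is trivial. *)
Lemma sstar_z_s p (j : int) : (exists i : int, j = p%:Z * i /\ star (s p) * zpow u j * s p = zpow u i)
  \/ star (s p) * zpow u j * s p = 0.
Proof.
have [[i ji]|h] := pselect (exists i : int, j = p%:Z * i).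
  left; exists i; split=> //; rewrite ji (sstarE rel) -mulrA (rel_iso rel) mulr1 //.
right; apply: (Q_II0 rel) => -[m1 [m2 jE]]; apply: h; exists (m1 + m2).
by rewrite mulrDr.
Qed.

Lemma sstar_z_s_dvd p (j : int) : ~~ (p %| `|j|)%N -> star (s p) * zpow u j * s p = 0.
Proof.
move=> h; have [[i [ji _]]|//] := sstar_z_s p j.
by case/negP: h; rewrite ji abszM dvdn_mulr.
Qed.

(** Inserting the resolution of the identity by the [u^k s_q] on the right leaves only
    the products [s_q^* u^j s_q], which are known without computing common multiples. *)
Lemma spanT_sstar_z_s q m p : spanT (star (s q) * zpow u m * s p).
Proof.
rewrite (rel_sum rel q (_ * s p)); apply: span_sum => k.
rewrite starM star_zpow !mulrA; apply: spanT_zr; apply: spanT_sstarr.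
have -> : star (s q) * zpow u m * s p * zpow u k * s q =
    star (s q) * zpow u (m + p%:Z * k%:Z) * s q * s p.
  rewrite -(mulrA _ (s p)) (sE rel) zpowD // !mulrA -!(mulrA _ (s _) (s _)).
  by rewrite -!(Q_mul rel) gen_mulC.
have [[i [_ ->]]|->] := sstar_z_s q (m + p%:Z * k%:Z); last by rewrite mul0r; left.
have -> : zpow u i * s p = spanmon i p 1%g 0 by rewrite /spanmon (Q_one rel) star1 !mulr1.
exact: (@span_spanmon full).
Qed.

Lemma spanT_sstarl q x : spanT x -> spanT (star (s q) * x).
Proof.
apply: (@span_lin full full (fun x => star (s q) * x)) => [a y z||m p q' n _]; [by rewrite mulrDr scalerAr|by rewrite mulr0|].
rewrite /spanmon !mulrA; apply: spanT_zr; apply: spanT_sstarr; exact: spanT_sstar_z_s.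
Qed.

Lemma spanTM x y : spanT x -> spanT y -> spanT (x * y).
Proof.
move=> hx hy; elim: hx => [|a m p q n z _ _ IH]; first by rewrite mul0r; left.
rewrite mulrDl -scalerAl; apply: spanD => //; apply: spanZ.
rewrite /spanmon -!mulrA; apply: spanT_zl; apply: spanT_sl; apply: spanT_sstarl; exact: spanT_zl.
Qed.

Lemma spanT_star x : spanT x -> spanT (star x).
Proof.
elim=> [|a m p q n z _ _ IH]; first by rewrite star0; left.
rewrite starD starZE; apply: spanD => //; apply: spanZ.
by rewrite /spanmon !starM starK !star_zpow // !mulrA; exact: (@span_spanmon full).
Qed.

(** The span of the monomials is a *-algebra, and contains the generators. *)
Lemma spanT_dense x (e : R) : 0 < e -> exists2 y, spanT y & cnorm (x - y) < e.
Proof.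
pose B := [set x : Q | forall e : R, 0 < e -> exists2 y, spanT y & cnorm (x - y) < e].
suff : B x by apply.
have spB y : spanT y -> B y by move=> h e' e'0; exists y => //; rewrite subrr cnorm0.
have sB : cstar_subalg B.
  apply: cclosed_subalg.
  - move=> l h d d0; have d2 : 0 < d / 2%:R by rewrite divr_gt0.
    have [y By ly] := h _ d2; have [z z1 yz] := By _ d2; exists z => //.
    by have := cnorm_trans y l z; lra.
  - move=> a y z By Bz d d0; have d2 : 0 < d / 2%:R by rewrite divr_gt0.
    have a0 := cabs_ge0 a; pose k := d / (2%:R * (cabs a + 1)).
    have k0 : 0 < k by rewrite divr_gt0 // mulr_gt0 //; lra.
    have kE : (cabs a + 1) * k = d / 2%:R by rewrite /k; field; rewrite gt_eqF //; lra.
    have [y' hy yy] := By _ k0; have [z' hz zz] := Bz _ d2.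
    exists (a *: y' + z'); first by apply: spanD => //; exact: spanZ.
    rewrite opprD addrACA -scalerBr; apply: le_lt_trans (cnormD _ _) _.
    by rewrite cnormZE; have := cnorm_ge0 (y - y'); nra.
  - move=> y z By Bz d d0; have y0 := cnorm_ge0 y; have z0 := cnorm_ge0 z.
    pose k := Num.min 1 (d / (cnorm y + cnorm z + 2%:R)).
    have s0 : 0 < cnorm y + cnorm z + 2%:R by lra.
    have k0 : 0 < k by rewrite lt_min ltr01 divr_gt0.
    have k1 : k <= 1 by rewrite ge_min lexx.
    have kS : k * (cnorm y + cnorm z + 2%:R) <= d by rewrite -ler_pdivlMr // ge_min lexx orbT.
    have [y' hy yy] := By _ k0; have [z' hz zz] := Bz _ k0.
    exists (y' * z'); first exact: spanTM.
    have -> : y * z - y' * z' = y * (z - z') + (y - y') * (z - (z - z')).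
      by rewrite subKr mulrBr mulrBl addrA subrK.
    apply: le_lt_trans (cnormD _ _) _.
    have h1 := cnormM y (z - z'); have h2 := cnormM (y - y') (z - (z - z')).
    have h3 := cnormB z (z - z'); have := cnorm_ge0 (z - (z - z')).
    have := cnorm_ge0 (z - z'); have := cnorm_ge0 (y - y').
    move: h1 h2 h3 yy zz; move: (cnorm (y - y')) (cnorm (z - z')) (cnorm (z - (z - z')))
      (cnorm (y * (z - z'))) (cnorm ((y - y') * (z - (z - z')))) => a b c t l.
    clear -y0 z0 s0 k0 k1 kS d0; move: (cnorm y) (cnorm z) y0 z0 s0 kS => Y Z Y0 Z0 s0 kS.
    move=> h1 h2 h3 ak bk a0 b0 c0.
    have H1 : Y * b <= Y * k by nra.
    have H2 : a * c <= k * (Z + 1) by nra.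
    nra.
  - move=> y By d d0; have [y' hy yy] := By _ d0; exists (star y'); first exact: spanT_star.
    by rewrite -starB cnorm_star.
  - by apply: spB; left.
have [_ gen _] := univ.
suff : (cstar_gen ([set u] `|` range s) : set Q) `<=` B by rewrite gen; apply.
apply: cstar_gen_min => // y [->|[p _ <-]]; apply: spB.
  have -> : u = spanmon 1 1%g 1%g 0 by rewrite /spanmon zpow1 (Q_one rel) star1 !mulr1.
  exact: (@span_spanmon full).
have -> : s p = spanmon 0 p 1%g 0 by rewrite /spanmon (Q_one rel) star1 mul1r !mulr1.
exact: (@span_spanmon full).
Qed.

End Universal.

(** * Averages over the gauge automorphisms *)

Section Synthesis.
Variables (R : realType) (S : set nat).
Local Notation P := (gen_monoid S).
Local Notation T := (circle R).
Local Notation C := R[i].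
Hypothesis S_gt1 : forall a, S a -> (1 < a)%N.
Variables (Q : cstarAlgType R) (u : Q) (s : P -> Q).
Hypothesis univ : is_universal_Q u s.
Implicit Types (p q : P) (x y : Q) (I J : set Q).
Local Notation spanmon := (spanmon u s).
Local Notation gam := (gam u s).
Local Notation span := (span u s).
Local Notation spanT := (span (fun _ _ => True)).
Let gh l z := gam_hom S_gt1 univ l z.
Let gb := gam_spanmon S_gt1 univ.
Let gle := gam_le S_gt1 univ.
Let dense := spanT_dense univ.

Definition lin_contr (F : Q -> Q) : Prop :=
  (forall a x y, F (a *: x + y) = a *: F x + F y) /\ forall x, cnorm (F x) <= cnorm x.

Lemma lin_contr0 F : lin_contr F -> F 0 = 0.
Proof. by case=> _ h; apply: cnorm_small => e e0; apply: le_trans (h 0) _; rewrite cnorm0 ltW. Qed.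

Lemma lin_contrB F x y : lin_contr F -> F (x - y) = F x - F y.
Proof.
by case=> h _; rewrite addrC -[in LHS](scaleN1r y) h scaleN1r addrC.
Qed.

Lemma lin_contrZ F a x : lin_contr F -> F (a *: x) = a *: F x.
Proof. by move=> cF; case: (cF) => h _; rewrite -[in LHS](addr0 (a *: x)) h (lin_contr0 cF) addr0. Qed.

Lemma lin_contr_comp F G : lin_contr F -> lin_contr G -> lin_contr (F \o G).
Proof.
move=> [F1 F2] [G1 G2]; split=> [a x y|x] /=; first by rewrite G1 F1.
by apply: le_trans (F2 _) (G2 _).
Qed.

Lemma gam_lin_contr l z : lin_contr (gam l z).
Proof.
split=> [a x y|x]; last exact: gle.
by rewrite (star_homD (gh l z)) (star_homZ (gh l z)).
Qed.

(** The Fourier coefficient of order [k] in the [l]-th coordinate, as an average over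
    roots of unity. It is exact on monomials when [N] is large. *)
Definition avg l N (k : int) x : Q :=
  N%:R^-1 *: \sum_(j < N) (zeta R N ^+ j) ^ (- k) *: gam l (zetac R N ^+ j)%g x.

Lemma zetaX_abs N j : cabs (zeta R N ^+ j) = 1.
Proof. by rewrite cabsX zeta_abs expr1n. Qed.

Lemma avg_lin_contr l N k : (0 < N)%N -> lin_contr (avg l N k).
Proof.
move=> N0; split=> [a x y|x]; rewrite /avg.
  rewrite (eq_bigr (fun j : 'I_N => a *: ((zeta R N ^+ j) ^ (- k) *: gam l (zetac R N ^+ j)%g x) +
      (zeta R N ^+ j) ^ (- k) *: gam l (zetac R N ^+ j)%g y)).
    by rewrite big_split /= -scaler_sumr scalerDr !scalerA mulrC.
  by move=> j _; rewrite (gam_lin_contr _ _).1 scalerDr !scalerA mulrC.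
rewrite cnormZE cabsV cabs_nat ler_pdivrMl ?ltr0n //.
apply: le_trans (cnorm_sum _ _ _) _.
have F (j : 'I_N) : true -> cnorm ((zeta R N ^+ j) ^ (- k) *: gam l (zetac R N ^+ j)%g x) <= cnorm x.
  by move=> _; rewrite cnormZE cabs_exprz ?zetaX_abs // mul1r gle.
by apply: le_trans (ler_sum _ F) _; rewrite sumr_const card_ord -[X in X <= _]mulr_natl.
Qed.

Lemma avg_spanmon l N k m p q n : (0 < N)%N ->
  avg l N k (spanmon m p q n) = if (N %| `|deg l p q - k|)%N then spanmon m p q n else 0.
Proof.
move=> N0; rewrite /avg.
rewrite (eq_bigr (fun j : 'I_N => (zeta R N ^+ j) ^ (deg l p q - k) *: spanmon m p q n)).
  rewrite -scaler_suml sum_zeta //; case: ifP => _; last by rewrite scale0r scaler0.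
  by rewrite scalerA mulVf ?scale1r // pnatr_eq0 -lt0n.
move=> j _; rewrite gb cval_zetac scalerA -expfzDr; last exact/cabs1_neq0/zetaX_abs.
by rewrite addrC.
Qed.

Lemma avg_in I l N k x : csubspace I -> I 0 -> (forall l z x, I x -> I (gam l z x)) ->
  I x -> I (avg l N k x).
Proof.
move=> sI I0 gI Ix.
have IZ a y : I y -> I (a *: y) by move=> Iy; rewrite -[_ *: _]addr0; apply: sI.
rewrite /avg; apply: (IZ).
apply: (big_ind I) => // [y z Iy Iz|j _]; first by rewrite -[y]scale1r; apply: sI.
exact/IZ/gI.
Qed.

Lemma avg_hom l N k x : (0 < N)%N -> (forall z, gam l z x = cval z ^ k *: x) -> avg l N k x = x.
Proof.
move=> N0 h; rewrite /avg (eq_bigr (fun=> x)) => [|j _].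
  by rewrite sumr_const card_ord -[x *+ N]scaler_nat scalerA mulVf ?scale1r // pnatr_eq0 -lt0n.
by rewrite h cval_zetac scalerA -expfzDr ?addNr ?expr0z ?scale1r //; exact/cabs1_neq0/zetaX_abs.
Qed.

Lemma avg_gam_comm l N k l' z x : (0 < N)%N -> gam l' z (avg l N k x) = avg l N k (gam l' z x).
Proof.
move=> N0; have g := gh l' z; rewrite /avg (star_homZ g) (star_hom_sum g).
congr (_ *: _); apply: eq_bigr => j _.
by rewrite (star_homZ g) (gam_comm S_gt1 univ).
Qed.

(** * Limits of averages *)

Lemma ev_span B (Pr : nat -> Q -> Prop) x : (forall n, Pr n 0) ->
  (forall n a x y, Pr n x -> Pr n y -> Pr n (a *: x + y)) ->
  (forall m p q k, B p q -> exists N, forall n, (N <= n)%N -> Pr n (spanmon m p q k)) ->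
  span B x -> exists N, forall n, (N <= n)%N -> Pr n x.
Proof.
move=> P0 Pl Pb; elim=> [|a m p q k y Bpq _ [N hN]]; first by exists 0%N.
have [N' hN'] := Pb m p q k Bpq; exists (maxn N N') => n.
by rewrite geq_max => /andP[Nn Nn']; apply: Pl; [exact: hN'|exact: hN].
Qed.

(** Contractivity transfers the convergence from the monomials to their closed span. *)
Lemma lin_contr_lim (F : nat -> Q -> Q) x : (forall n, lin_contr (F n)) ->
  (forall m p q k, exists N y, forall n, (N <= n)%N -> F n (spanmon m p q k) = y) ->
  exists y, cconv (F ^~ x) y.
Proof.
move=> cF Fb; apply: cconv_cauchy => e e0.
have [x0 sx0 xx0] := dense x (e := e / 2%:R) (divr_gt0 e0 (ltr0Sn _ 1)).
have [N [y hN]] : exists N y, forall n, (N <= n)%N -> F n x0 = y.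
  elim: sx0 => [|a m p q k z _ _ [N [y hN]]].
    by exists 0%N, 0 => n _; exact: lin_contr0.
  have [N' [y' hN']] := Fb m p q k; exists (maxn N N'), (a *: y' + y) => n.
  by rewrite geq_max => /andP[Nn Nn']; rewrite (cF n).1 hN // hN'.
exists N => m n Nm Nn.
have -> : F m x - F n x = F m (x - x0) - F n (x - x0).
  by rewrite (lin_contrB _ _ (cF m)) (lin_contrB _ _ (cF n)) (hN m Nm) (hN n Nn) opprB addrA subrK.
apply: le_lt_trans (cnormB _ _) _.
by have := (cF m).2 (x - x0); have := (cF n).2 (x - x0); lra.
Qed.

Lemma lin_contr_lim_eq (F : nat -> Q -> Q) (G : Q -> Q) (c : C) x y : (forall n, lin_contr (F n)) ->
  lin_contr G -> cabs c = 1 ->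
  (forall m p q k, exists N, forall n, (N <= n)%N -> G (F n (spanmon m p q k)) = c *: F n (spanmon m p q k)) ->
  cconv (F ^~ x) y -> G y = c *: y.
Proof.
move=> cF cG c1 Fb Fx; apply/eqP; rewrite -subr_eq0; apply/eqP/cnorm_small => e e0.
have [x0 sx0 xx0] := dense x (e := e / 4%:R) (divr_gt0 e0 (ltr0Sn _ 3)).
have [N hN] : exists N, forall n, (N <= n)%N -> G (F n x0) = c *: F n x0.
  apply: (ev_span (Pr := fun n x => G (F n x) = c *: F n x)) sx0 => //.
  - by move=> n; rewrite (lin_contr0 (cF n)) (lin_contr0 cG) scaler0.
  - move=> n a z w hz hw; rewrite (cF n).1 cG.1 hz hw scalerDr !scalerA mulrC //.
have [N' hN'] := Fx (e / 4%:R) (divr_gt0 e0 (ltr0Sn _ 3)).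
pose n := maxn N N'.
have h1 := hN n (leq_maxl _ _); have h2 := hN' n (leq_maxr _ _).
have h3 : cnorm (y - F n x0) <= e / 2%:R.
  apply: le_trans (cnorm_trans (F n x) _ _) _; rewrite (cnorm_distC y) -(lin_contrB _ _ (cF n)).
  by have := (cF n).2 (x - x0); lra.
have -> : G y - c *: y = G (y - F n x0) - c *: (y - F n x0).
  by rewrite (lin_contrB _ _ cG) h1 scalerBr opprB addrA subrK.
apply: le_trans (cnormB _ _) _; rewrite cnormZE c1 mul1r.
by have := cG.2 (y - F n x0); lra.
Qed.

Lemma lim_in I F x y : cclosed I -> (forall n : nat, I (F n x)) -> cconv (F ^~ x) y -> I y.
Proof. by move=> cI Fx; apply: cclosed_lim. Qed.

(** * Degrees *)

Lemma logn_le (l n : nat) : (logn l n <= n)%N.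
Proof. by case: n => [|n]; [rewrite logn0|apply/ltnW/ltn_logl]. Qed.

Lemma deg_bound l p q (k : int) : (`|deg l p q - k| <= p + q + `|k|)%N.
Proof. by rewrite /deg; have := logn_le l p; have := logn_le l q; lia. Qed.

Lemma deg_big l p q : (p + q < l)%N -> deg l p q = 0.
Proof.
have := gen_gt0 S_gt1 p; have := gen_gt0 S_gt1 q => q0 p0 h.
by rewrite /deg !ltn_log0 //; lia.
Qed.

Lemma dvd_deg N l p q k : (p + q + `|k| < N)%N -> (N %| `|deg l p q - k|)%N = (deg l p q == k).
Proof.
move=> h; apply/idP/eqP => [d|->]; last by rewrite subrr dvdn0.
apply/eqP; rewrite -subr_eq0 -absz_eq0; apply/eqP; have := deg_bound l p q k => b.
by apply/eqP; rewrite -leqn0 leqNgt; apply/negP => p0; have := dvdn_leq p0 d; lia.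
Qed.

Fixpoint avg_range (k : nat -> int) N m d x : Q :=
  if d is d'.+1 then avg (m + d') N (k (m + d')%N) (avg_range k N m d' x) else x.

Lemma avg_range_lin_contr k N m d : (0 < N)%N -> lin_contr (avg_range k N m d).
Proof.
move=> N0; elim: d => [|d IH] /=; first by split.
exact: (lin_contr_comp (avg_lin_contr _ _ N0) IH).
Qed.

Lemma avg_range_spanmon_fix k N m d a p q b : (0 < N)%N ->
  (forall l, (m <= l < m + d)%N -> deg l p q = k l) -> avg_range k N m d (spanmon a p q b) = spanmon a p q b.
Proof.
move=> N0; elim: d => [|d IH] //= h; rewrite IH => [|l /andP[ml ld]].
  by rewrite avg_spanmon // h ?subrr ?dvdn0 //; apply/andP; lia.
by apply: h; rewrite ml addnS ltnW.
Qed.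

Lemma avg_range_spanmon_0 k N m d a p q b l : (0 < N)%N -> (m <= l < m + d)%N -> deg l p q != k l ->
  (p + q + `|k l| < N)%N -> avg_range k N m d (spanmon a p q b) = 0.
Proof.
move=> N0; elim: d => [|d IH] /= hl hd hN; first by exfalso; lia.
have [/eqP ld|ld] := boolP (l == m + d)%N; last first.
  by rewrite IH //; [exact: lin_contr0 (avg_lin_contr _ _ N0)|lia].
have [h|h] : avg_range k N m d (spanmon a p q b) = spanmon a p q b \/ avg_range k N m d (spanmon a p q b) = 0.
- elim: (d) => [|d' [E|E]] /=; [by left|rewrite E avg_spanmon //|rewrite E].
    by case: ifP; [left|right].
  by right; exact: lin_contr0 (avg_lin_contr _ _ N0).
- by rewrite h avg_spanmon // -ld dvd_deg // (negbTE hd).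
- by rewrite h; exact: lin_contr0 (avg_lin_contr _ _ N0).
Qed.

Lemma avg_range_in I k N m d x : csubspace I -> I 0 -> (forall l z x, I x -> I (gam l z x)) ->
  I x -> I (avg_range k N m d x).
Proof. by move=> sI I0 gI Ix; elim: d => [|d IH] //=; apply: avg_in. Qed.

(** Averaging fixes [x], and kills the monomials of other degrees in an approximation of
    [x], provided that enough coordinates and enough roots of unity are used. *)
Lemma hom_dense (k : nat -> int) x (e : R) : (forall l z, gam l z x = cval z ^ k l *: x) -> 0 < e ->
  exists2 y, span (fun p q => forall l, deg l p q = k l) y & cnorm (x - y) < e.
Proof.
move=> hx e0; have [x0 sx0 xx0] := dense x e0.
have [N hN] : exists N, forall n, (N <= n)%N ->
    span (fun p q => forall l, deg l p q = k l) (avg_range k n.+1 0 n x0).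
  apply: (ev_span (Pr := fun n x => span (fun p q => forall l, deg l p q = k l) (avg_range k n.+1 0 n x))) sx0.
  - by move=> n; rewrite (lin_contr0 (avg_range_lin_contr k 0 n (ltn0Sn n))); left.
  - by move=> n a y z hy hz; rewrite (avg_range_lin_contr _ _ _ _).1 //; apply: spanD => //; exact: spanZ.
  - move=> m p q b _; have [h|] := pselect (forall l, deg l p q = k l).
      by exists 0%N => n _; rewrite avg_range_spanmon_fix //; exact: (@span_spanmon _ _ _ _ _ (fun p q => forall l, deg l p q = k l)).
    move=> /existsNP[l /eqP hl]; exists (maxn l.+1 (p + q + `|k l|)) => n.
    rewrite geq_max => /andP[ln bn]; rewrite (@avg_range_spanmon_0 _ _ _ _ _ _ _ _ l) //.
    by left.
exists (avg_range k N.+1 0 N x0); first exact: hN.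
have fx d : avg_range k N.+1 0 d x = x.
  by elim: d => [|d IH] //=; rewrite IH avg_hom.
rewrite -{1}(fx N) -(lin_contrB _ _ (avg_range_lin_contr k 0 N (ltn0Sn N))).
by apply: le_lt_trans xx0; apply: (avg_range_lin_contr _ _ _ _).2.
Qed.

(** A finite combination of monomials involves finitely many primes, hence is invariant
    under almost all coordinates. An approximation of [x] that is invariant is obtained as
    the limit of the averages of [x] over the coordinates from [m] on. *)
Lemma almost_invariant I x (e : R) : cclosed I -> csubspace I -> I 0 ->
  (forall l z x, I x -> I (gam l z x)) -> I x -> 0 < e ->
  exists m y, [/\ I y, cnorm (x - y) <= e & forall l z, (m <= l)%N -> gam l z y = y].
Proof.
move=> cI sI I0 gI Ix e0.
pose k0 (_ : nat) : int := 0.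
have [x0 sx0 xx0] := dense x (e := e / 2%:R) (divr_gt0 e0 (ltr0Sn _ 1)).
have [m hm] : exists m, forall n, (m <= n)%N -> forall N d, (0 < N)%N -> avg_range k0 N n d x0 = x0.
  apply: (ev_span (Pr := fun n x => forall N d, (0 < N)%N -> avg_range k0 N n d x = x)) sx0.
  - by move=> n N d N0; exact: (lin_contr0 (avg_range_lin_contr _ _ _ N0)).
  - by move=> n a y z hy hz N d N0; rewrite (avg_range_lin_contr _ _ _ N0).1 hy // hz.
  - move=> a p q b _; exists (p + q).+1 => n hn N d N0; apply: avg_range_spanmon_fix => // l hl.
    by apply: deg_big; lia.
pose F n x := avg_range k0 n.+1 m n x.
have cF n : lin_contr (F n) by apply: avg_range_lin_contr.
have Fb a p q b : exists N, (forall n, (N <= n)%N -> F n (spanmon a p q b) = spanmon a p q b /\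
     forall l, (m <= l)%N -> deg l p q = 0) \/ (forall n, (N <= n)%N -> F n (spanmon a p q b) = 0).
  have [h|] := pselect (forall l, (m <= l)%N -> deg l p q = 0).
    exists 0%N; left=> n _; split=> //; apply: avg_range_spanmon_fix => // l /andP[ml _]; exact: h.
  move=> /existsNP[l /not_implyP[ml /eqP hl]].
  exists (maxn l.+1 (p + q)); right=> n; rewrite geq_max => /andP[ln bn].
  by apply: (@avg_range_spanmon_0 _ _ _ _ _ _ _ _ l) => //; rewrite ?ml /=; rewrite /k0 /=; lia.
have [y Fy] : exists y, cconv (F ^~ x) y.
  apply: lin_contr_lim => // a p q b; have [N [h|h]] := Fb a p q b.
    by exists N, (spanmon a p q b) => n /h[].
  by exists N, 0.
exists m, y; split.
- by apply: (lim_in cI _ Fy) => n; exact: avg_range_in.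
- apply: le_eps => d d0; have [N hN] := Fy d d0.
  apply: le_trans (cnorm_trans (F N x) _ _) _; apply: lerD; last exact/ltW/hN.
  have E : F N x0 = x0 by apply: hm.
  apply: le_trans (cnorm_trans x0 _ _) _; rewrite -{2}E -(lin_contrB _ _ (cF N)).
  have := (cF N).2 (x0 - x); rewrite (cnorm_distC x0); lra.
- move=> l z ml; rewrite -[RHS]scale1r.
  apply: (lin_contr_lim_eq cF (gam_lin_contr l z) (cabs1 R) _ Fy) => a p q b.
  have [N [h|h]] := Fb a p q b; exists N => n /h.
    by move=> [-> h2]; rewrite gb h2 // expr0z.
  by move=> ->; rewrite (lin_contr0 (gam_lin_contr l z)) scaler0.
Qed.

Lemma exprz1_small (z : T) (k : int) : cabs (cval z ^ k - 1) <= `|k|%:R * cabs (cval z - 1).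
Proof.
have nat_case n (a : C) : cabs a = 1 -> cabs (a ^+ n - 1) <= n%:R * cabs (a - 1).
  move=> a1; elim: n => [|n IH]; first by rewrite expr0 subrr cabs0 mul0r.
  have -> : a ^+ n.+1 - 1 = a * (a ^+ n - 1) + (a - 1) by rewrite exprS; ring.
  apply: le_trans (cabsD _ _) _; rewrite cabsM a1 mul1r -natr1 mulrDl mul1r lerD2r //.
case: k => n; first exact: nat_case (cval_abs z).
have c1 : cabs (cval z)^-1 = 1 by rewrite cabsV cval_abs invr1.
have := nat_case n.+1 _ c1; rewrite NegzE -exprnN exprVn => h; apply: le_trans h _.
have -> : (cval z)^-1 - 1 = - (cval z)^-1 * (cval z - 1).
  by rewrite mulrBr mulNr mulVf ?cval_neq0 // mulr1 opprK addrC.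
by rewrite cabsM cabsN c1 mul1r abszN.
Qed.

(** The orbit maps of the torus are continuous: monomials are eigenvectors. *)
Lemma gam_cont l x (e : R) : 0 < e ->
  exists2 d : R, 0 < d & forall z, cabs (cval z - 1) < d -> cnorm (gam l z x - x) <= e.
Proof.
move=> e0; have [x0 sx0 xx0] := dense x (e := e / 4%:R) (divr_gt0 e0 (ltr0Sn _ 3)).
have [K K0 hK] : exists2 K : R, 0 < K & forall z, cnorm (gam l z x0 - x0) <= K * cabs (cval z - 1).
  elim: sx0 => [|a m p q n y _ _ [K K0 hK]].
    by exists 1 => // z; rewrite (lin_contr0 (gam_lin_contr l z)) subrr cnorm0 mulr_ge0 ?cabs_ge0.
  pose K' := cabs a * (`|deg l p q|%:R * cnorm (spanmon m p q n)).
  have K'0 : 0 <= K' by rewrite !mulr_ge0 ?cabs_ge0 ?cnorm_ge0.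
  exists (K' + K) => [|z]; first by rewrite ltr_wpDl.
  rewrite (gam_lin_contr l z).1 gb opprD addrACA -scalerBr -{2}[spanmon m p q n]scale1r -scalerBl.
  apply: le_trans (cnormD _ _) _; rewrite mulrDl lerD //.
  rewrite !cnormZE /K' -!mulrA ler_wpM2l ?cabs_ge0 // [cnorm _ * cabs _]mulrC mulrA.
  by rewrite ler_wpM2r ?cnorm_ge0 // exprz1_small.
exists (e / (2%:R * K)) => [|z hz]; first by rewrite divr_gt0 ?mulr_gt0.
have h1 : K * cabs (cval z - 1) <= e / 2%:R.
  by move/ltW: hz; rewrite ler_pdivlMr ?mulr_gt0 //; lra.
have -> : gam l z x - x = gam l z (x - x0) + (gam l z x0 - x0) - (x - x0).
  by rewrite (lin_contrB _ _ (gam_lin_contr l z)) !addrA subrK opprB addrA subrK.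
apply: le_trans (cnormB _ _) _.
have := cnormD (gam l z (x - x0)) (gam l z x0 - x0); have := gle l z (x - x0); have := hK z; lra.
Qed.

(** Fejer's theorem for the [l]-th coordinate, by continuity of the orbit of [x]. The
    order [n] of the mean is fixed before the number [N] of roots of unity. *)
Lemma fejer_mean l x (e : R) : 0 < e -> exists2 n, (0 < n)%N & forall N, (n <= N)%N ->
  cnorm (x - n%:R^-1 *: \sum_(a < n) \sum_(b < n) avg l N (a%:Z - b%:Z) x) <= e.
Proof.
move=> e0; have e2 : 0 < e / 2%:R by rewrite divr_gt0.
have [d d0 hd] := gam_cont l x e2.
pose M := 2%:R * cnorm x; have M0 : 0 <= M by rewrite mulr_ge0 ?cnorm_ge0.
have K0 : 0 < M / d ^+ 2 * 4%:R + 1 by rewrite ltr_wpDl // mulr_ge0 // divr_ge0 // sqr_ge0.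
have [|n' hn'] := @natr_inv_lt R (e / 2%:R / (M / d ^+ 2 * 4%:R + 1)).
  by rewrite divr_gt0.
set n := n'.+1.
have hn : M / d ^+ 2 * (4%:R / n%:R) <= e / 2%:R.
  have h := hn' n' (leqnn _); rewrite ltr_pdivlMr // in h; rewrite mulrA mulrC.
  apply: le_trans (ltW h); rewrite ler_wpM2l ?invr_ge0 //; lra.
exists n => // N nN; have N0 : (0 < N)%N by apply: leq_trans nN.
have nN' : (0 < n <= N)%N by rewrite nN.
have -> : n%:R^-1 *: \sum_(a < n) \sum_(b < n) avg l N (a%:Z - b%:Z) x =
    \sum_(j < N) (fejer n N 1 j)%:C *: gam l (zetac R N ^+ j)%g x.
  rewrite /avg; under eq_bigr do rewrite -scaler_sumr; rewrite -scaler_sumr scalerA.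
  rewrite (eq_bigr (fun j : 'I_N => (n * N)%:R^-1 *: \sum_(a < n) \sum_(b < n)
     (zeta R N ^+ j) ^ (- (a%:Z - b%:Z)) *: gam l (zetac R N ^+ j)%g x)); last first.
    move=> j _; rewrite fejerE ?cabs1 // -scalerA; congr (_ *: _).
    rewrite scaler_suml; apply: eq_bigr => a _; rewrite scaler_suml; apply: eq_bigr => b _.
    by rewrite mul1r exprz_inv.
  rewrite -scaler_sumr natrM invfM; congr (_ *: _).
  rewrite [RHS]exchange_big /=; apply: eq_bigr => a _.
  by rewrite exchange_big.
have E : x = \sum_(j < N) (fejer n N 1 j)%:C *: x.
  by rewrite -scaler_suml -(rmorph_sum (real_complex R)) /= fejer_sum ?cabs1 // scale1r.
rewrite {1}E -sumrB; apply: le_trans (cnorm_sum _ _ _) _.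
have G (j : 'I_N) : true -> cnorm ((fejer n N 1 j)%:C *: x - (fejer n N 1 j)%:C *: gam l (zetac R N ^+ j)%g x)
    <= fejer n N 1 j * cnorm (gam l (zetac R N ^+ j)%g x - x).
  by move=> _; rewrite -scalerBr cnormZE cabs_real ger0_norm ?fejer_ge0 // cnorm_distC.
apply: le_trans (ler_sum _ G) _.
apply: le_trans (fejer_approx (D := fun j => cnorm (gam l (zetac R N ^+ j)%g x - x))
  (e := e / 2%:R) (M := M) nN' (cabs1 R) d0 (ltW e2) M0 _ _) _.
- by move=> j _; apply: le_trans (cnormB _ _) _; have := gle l (zetac R N ^+ j)%g x; rewrite /M; lra.
- by move=> j _ hj; apply: hd; rewrite cval_zetac cabs_distrC.
- by lra.
Qed.

(** Spectral synthesis for the gauge action. By Fejer's theorem [x] is recovered from its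
    coefficients for one coordinate, so that homogeneity may be assumed for one more
    coordinate; this settles the elements that are homogeneous for almost all
    coordinates, and these are dense by [almost_invariant]. *)
Theorem synthesis I J : cclosed I -> csubspace I -> I 0 ->
  (forall l z x, I x -> I (gam l z x)) -> cclosed J -> csubspace J -> J 0 ->
  (forall x (k : nat -> int), I x -> (forall l z, gam l z x = cval z ^ k l *: x) -> J x) ->
  I `<=` J.
Proof.
move=> cI sI I0 gI cJ sJ J0 hIJ.
have JZ a y : J y -> J (a *: y) by move=> Jy; rewrite -[_ *: _]addr0; apply: sJ.
have JD y z : J y -> J z -> J (y + z) by move=> Jy Jz; rewrite -[y]scale1r; apply: sJ.
(* induction on the number of coordinates without known homogeneity *)
have claim m : forall x (k : nat -> int), I x ->
    (forall l z, (m <= l)%N -> gam l z x = cval z ^ k l *: x) -> J x.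
  elim: m => [|m IH] x k Ix hx; first by apply: (hIJ x k) => // l z; exact: hx.
  (* the coefficients of [x] for the coordinate [m] are limits of averages *)
  have coef (kk : int) : exists2 y, J y & cconv (fun n => avg m n.+1 kk x) y.
    pose F n x := avg m n.+1 kk x.
    have cF n : lin_contr (F n) by apply: avg_lin_contr.
    have Fb a p q b : exists N, (forall n, (N <= n)%N -> F n (spanmon a p q b) = spanmon a p q b /\ deg m p q = kk)
        \/ (forall n, (N <= n)%N -> F n (spanmon a p q b) = 0).
      exists (p + q + `|kk|)%N; have [h|h] := eqVneq (deg m p q) kk.
        by left=> n hn; rewrite /F avg_spanmon // dvd_deg ?ltnS // h eqxx.
      by right=> n hn; rewrite /F avg_spanmon // dvd_deg ?ltnS // (negbTE h).
    have [y Fy] : exists y, cconv (F ^~ x) y.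
      apply: lin_contr_lim => // a p q b; have [N [h|h]] := Fb a p q b.
        by exists N, (spanmon a p q b) => n /h[].
      by exists N, 0.
    exists y => //; apply: (IH y (fun l => if l == m then kk else k l)).
      by apply: (lim_in cI _ Fy) => n; exact: avg_in.
    move=> l z ml; have [->|lm] := eqVneq l m.
      apply: (lin_contr_lim_eq cF (gam_lin_contr m z) (cabs_exprz _ (cval_abs z)) _ Fy) => a p q b.
      have [N [h|h]] := Fb a p q b; exists N => n /h.
        by move=> [-> h2]; rewrite gb h2.
      by move=> ->; rewrite (lin_contr0 (gam_lin_contr m z)) scaler0.
    have {ml lm}ml : (m < l)%N by rewrite ltn_neqAle eq_sym lm.
    have cB : cclosed [set y | gam l z y = cval z ^ k l *: y].
      apply: (@cclosed_eq _ _ _ (gam l z) (fun y => cval z ^ k l *: y) 1 1) => w.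
      - by move=> v; exact: lin_contrB (gam_lin_contr l z).
      - by move=> v; rewrite scalerBr.
      - by rewrite mul1r gle.
      - by rewrite cnormZE cabs_exprz ?cval_abs.
    apply: (lim_in cB _ Fy) => n /=; rewrite /F avg_gam_comm // hx //.
    by rewrite (lin_contrZ _ _ (avg_lin_contr _ _ _)).
  (* [n] is fixed here; the [n ^ 2] averages are then replaced by their limits *)
  apply: cJ => e e0; have [n n0 hn] := fejer_mean m x (divr_gt0 e0 (ltr0Sn _ 2)).
  have ch (a b : 'I_n) : exists2 y, J y & cconv (fun N => avg m N.+1 (a%:Z - b%:Z) x) y := coef _.
  have e3 : 0 < e / 3%:R / n%:R by rewrite !divr_gt0 // ltr0n.
  have ch' (a b : 'I_n) : exists yN : Q * nat, J yN.1 /\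
      forall N, (yN.2 <= N)%N -> cnorm (avg m N.+1 (a%:Z - b%:Z) x - yN.1) < e / 3%:R / n%:R.
    by have [y Jy /(_ _ e3)[N hN]] := ch a b; exists (y, N).
  pose Y a b := (sval (cid (ch' a b))).1; pose NN a b := (sval (cid (ch' a b))).2.
  have YJ a b : J (Y a b) by rewrite /Y; case: cid => ? [].
  have YN a b N : (NN a b <= N)%N -> cnorm (avg m N.+1 (a%:Z - b%:Z) x - Y a b) < e / 3%:R / n%:R.
    by rewrite /Y /NN; case: (cid (ch' a b)) => yN [_ h] /=; exact: h.
  pose N := maxn n (\max_a \max_b NN a b).
  have NNle a b : (NN a b <= N)%N.
    rewrite leq_max; apply/orP; right; apply: leq_trans (leq_bigmax (F := fun a => \max_b NN a b) a).
    exact: (leq_bigmax (F := fun b => NN a b) b).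
  exists (n%:R^-1 *: \sum_(a < n) \sum_(b < n) Y a b).
    by apply: (JZ); apply: (big_ind J) => // a _; apply: (big_ind J).
  have h1 := hn N.+1 (leq_trans (leq_maxl _ _) (leqnSn _)).
  set X := n%:R^-1 *: _ in h1; set Z := n%:R^-1 *: _.
  have h2 : cnorm (X - Z) <= e / 3%:R.
    rewrite /X /Z -scalerBr cnormZE cabsV cabs_nat ler_pdivrMl ?ltr0n // -sumrB.
    apply: le_trans (cnorm_sum _ _ _) _.
    have G (a : 'I_n) : true -> cnorm (\sum_(b < n) avg m N.+1 (a%:Z - b%:Z) x - \sum_(b < n) Y a b) <= e / 3%:R.
      move=> _; rewrite -sumrB; apply: le_trans (cnorm_sum _ _ _) _.
      have G' (b : 'I_n) : true -> cnorm (avg m N.+1 (a%:Z - b%:Z) x - Y a b) <= e / 3%:R / n%:R.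
        by move=> _; apply/ltW/YN.
      apply: le_trans (ler_sum _ G') _; rewrite sumr_const card_ord -[X in X <= _]mulr_natr divfK //.
      by rewrite pnatr_eq0 -lt0n.
    by apply: le_trans (ler_sum _ G) _; rewrite sumr_const card_ord -[X in X <= _]mulr_natl.
  by have := cnorm_trans X x Z; lra.
move=> x Ix; apply: cJ => e e0.
have [m [y [Iy xy hy]]] := almost_invariant cI sI I0 gI Ix (divr_gt0 e0 (ltr0Sn _ 1)).
exists y; last by lra.
by apply: (claim m y (fun=> 0)) => // l z ml; rewrite hy // expr0z scale1r.
Qed.

End Synthesis.

(** * The functions of [u] *)

Section RealComplete.
Variable R : realType.

Lemma real_cauchy (x : nat -> R) :
  (forall e : R, 0 < e -> exists N, forall n, (N <= n)%N -> `|x n - x N| < e) ->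
  exists l, forall e : R, 0 < e -> exists N, forall n, (N <= n)%N -> `|x n - l| < e.
Proof.
move=> h; have cx : cvg (x @ \oo).
  apply/cauchy_cvgP/cauchy_exP => e e0; have [N hN] := h e e0.
  by exists (x N); exists N => // n /= Nn; rewrite /ball /= distrC; exact: hN.
exists (lim (x @ \oo)) => e e0.
have /cvgrPdist_lt/(_ e e0)[N _ hN] := cx.
by exists N => n Nn; rewrite distrC; exact: hN.
Qed.

Lemma complex_cauchy (x : nat -> R[i]) :
  (forall e : R, 0 < e -> exists N, forall n, (N <= n)%N -> cabs (x n - x N) < e) ->
  exists l, forall e : R, 0 < e -> exists N, forall n, (N <= n)%N -> cabs (x n - l) < e.
Proof.
move=> h.
have [a ha] : exists l, forall e : R, 0 < e -> exists N, forall n, (N <= n)%N -> `|Re (x n) - l| < e.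
  apply: real_cauchy => e /h[N hN]; exists N => n /hN; apply: le_lt_trans.
  by have := cabs_Re (x n - x N); case: (x n) => ? ?; case: (x N).
have [b hb] : exists l, forall e : R, 0 < e -> exists N, forall n, (N <= n)%N -> `|Im (x n) - l| < e.
  apply: real_cauchy => e /h[N hN]; exists N => n /hN; apply: le_lt_trans.
  by have := cabs_Im (x n - x N); case: (x n) => ? ?; case: (x N).
exists (a +i* b) => e e0; have e2 : 0 < e / 2%:R by rewrite divr_gt0.
have [N hN] := ha _ e2; have [N' hN'] := hb _ e2; exists (maxn N N') => n.
rewrite geq_max => /andP[/hN h1 /hN' h2]; apply: le_lt_trans (cabs_ReIm _) _.
by case: (x n) h1 h2 => c d /=; lra.
Qed.

End RealComplete.

Section Masa.
Variables (R : realType) (S : set nat).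
Local Notation P := (gen_monoid S).
Local Notation T := (circle R).
Local Notation C := R[i].
Hypothesis S_gt1 : forall a, S a -> (1 < a)%N.
Variables (Q : cstarAlgType R) (u : Q) (s : P -> Q).
Hypothesis univ : is_universal_Q u s.
Implicit Types (p q : P) (x y : Q).
Local Notation spanmon := (spanmon u s).
Local Notation gam := (gam u s).
Local Notation span := (span u s).
Let rel := univ_rel univ.
Let hu : unitary u := rel_unitary rel.
Let gb := gam_spanmon S_gt1 univ.

Lemma deg0_eq p q : (forall l, deg l p q = 0) -> p = q.
Proof.
move=> h; apply: gen_val_inj; apply: eqn_from_log; rewrite ?gen_gt0 // => l.
by have := h l; rewrite /deg; lia.
Qed.

Lemma degM l p q p' q' : deg l (p * p')%g (q * q')%g = deg l p q + deg l p' q'.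
Proof. by rewrite /deg !gen_valM !lognM ?gen_gt0 //; lia. Qed.

Lemma zpow_nat n : zpow u n%:Z = u ^+ n. Proof. by []. Qed.

Lemma spanmon_intertwine m p q n : u ^+ p * spanmon m p q n = spanmon m p q n * u ^+ q.
Proof.
rewrite /spanmon -!zpow_nat !mulrA -zpowD // addrC zpowD // -!mulrA; congr (_ * _).
rewrite mulrA -[p%:Z]mulr1 -(sE rel) -!mulrA; congr (_ * _).
by rewrite mulrA -(sstarE rel) mulr1 -!mulrA -!zpowD // addrC.
Qed.

(** Each monomial intertwines [u ^ p] and [u ^ q]; over a common expansion of the fractions
    [p / q], which are all equal, a combination does so too. *)
Lemma span_intertwine k y : span (fun p q => forall l, deg l p q = k l) y ->
  y = 0 \/ exists p q, (forall l, deg l p q = k l) /\ u ^+ p * y = y * u ^+ q.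
Proof.
elim=> [|a m p q n z hpq _ [->|[p' [q' [hpq' zE]]]]]; first by left.
  right; exists p, q; split=> //.
  by rewrite addr0 -scalerAr -scalerAl spanmon_intertwine.
right; exists (p * p')%g, (q * p')%g.
have pq : (p * q' = q * p')%g.
  by rewrite [RHS]gen_mulC; apply: deg0_eq => l; have := hpq l; have := hpq' l;
     rewrite /deg !gen_valM !lognM ?gen_gt0 //; lia.
split=> [l|].
  by rewrite degM hpq /deg subrr addr0.
have pw v w c d : u ^+ c * v = v * u ^+ d -> u ^+ (c * w) * v = v * u ^+ (d * w).
  move=> E; elim: w => [|w IH]; first by rewrite !muln0 mul1r mulr1.
  by rewrite !mulnS !exprD -mulrA IH mulrA E mulrA.
rewrite !gen_valM mulrDr mulrDl -scalerAr -scalerAl; congr (_ *: _ + _).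
  by apply: pw; exact: spanmon_intertwine.
have -> : (q * p' = q' * p)%N by have := congr1 (@nat_of_gen S) pq; rewrite !gen_valM => <-; rewrite mulnC.
by rewrite mulnC; apply: pw.
Qed.

(** The fraction of degree [k] may have to be expanded for a better approximation, so that
    [p] and [q] depend on [e]. The estimate is uniform in the powers [M], as the approximating
    combination intertwines exactly. *)
Lemma hom_intertwine (k : nat -> int) x (e : R) :
  (forall l z, gam l z x = cval z ^ k l *: x) -> 0 < e ->
  cnorm x <= e \/ exists p q, (forall l, deg l p q = k l) /\
    forall M : nat, cnorm (u ^+ (p * M) * x - x * u ^+ (q * M)) <= e.
Proof.
move=> hx e0; have [y sy xy] := hom_dense S_gt1 univ hx (e := e / 2%:R) (divr_gt0 e0 (ltr0Sn _ 1)).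
have [y0|[p [q [hpq yE]]]] := span_intertwine sy.
  by left; move: xy; rewrite y0 subr0; lra.
right; exists p, q; split=> // M.
have yM : u ^+ (p * M) * y = y * u ^+ (q * M).
  elim: M => [|w IH]; first by rewrite !muln0 mul1r mulr1.
  by rewrite !mulnS !exprD -mulrA IH mulrA yE mulrA.
have -> : u ^+ (p * M) * x - x * u ^+ (q * M) = u ^+ (p * M) * (x - y) - (x - y) * u ^+ (q * M).
  by rewrite mulrBr mulrBl yM opprB addrA subrK.
apply: le_trans (cnormB _ _) _.
by rewrite -!zpow_nat (cnorm_zpowM hu) (cnormM_zpow hu); lra.
Qed.

(** * The copy of the continuous functions on the circle *)

Section Nontrivial.
Variable p0 : P.
Hypothesis p0_gt1 : (1 < p0)%N.

Lemma gen_big n : exists p, (n < p)%N.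
Proof. by exists (gen_pow p0 n); rewrite gen_powE ltn_expl. Qed.

(** Compression by [s_N] kills all the powers of [u] with exponents between [-N] and [N],
    except [1]: it extracts a coefficient. *)
Lemma coef_le_peval (r : {poly C}) i : cabs r`_i <= cnorm (peval u r).
Proof.
have [N hN] := gen_big (size r + i).
have E : star (s N) * (zpow u (- i%:Z) * peval u r) * s N = r`_i *: 1.
  rewrite pevalE !mulr_sumr mulr_suml.
  rewrite (eq_bigr (fun j : 'I_(size r) => (if j == i :> nat then r`_i else 0) *: 1)).
    rewrite -scaler_suml; congr (_ *: _).
    have [ir|ir] := ltnP i (size r).
      rewrite (bigD1 (Ordinal ir)) //= eqxx big1 ?addr0 // => j ji.
      by rewrite ifF //; apply/negbTE.
    rewrite big1 => [|j _]; first by rewrite nth_default.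
    by rewrite ifF //; have := ltn_ord j; apply: contraTF => /eqP ->; rewrite -leqNgt.
  move=> j _; rewrite -!(scalerAr, scalerAl) mulrA -mulrA -/(zpow u j%:Z) mulrA.
  rewrite -[_ * zpow u _ * zpow u _]mulrA -zpowD //.
  have [ji|ji] := eqVneq (j : nat) i.
    by rewrite ji addNr mulr1 (rel_iso rel).
  rewrite (sstar_z_s_dvd univ) ?scaler0 ?scale0r //.
  apply/negP => /dvdn_leq; have := ltn_ord j; move/eqP: ji; lia.
have := cnorm_compress (zpow u (- i%:Z) * peval u r) (rel_iso rel N) (rel_iso rel N).
by rewrite E cnormZE cnorm1 mulr1 cnorm_zpowM.
Qed.

Lemma cabs_le_cfc (f : T -> C) z : ccont f -> cabs (f z) <= cnorm (cfc u f).
Proof.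
move=> fc; apply: le_eps => e e0.
have [D [p [fp yp]]] := cfcP hu fc (e := e / 2%:R) (divr_gt0 e0 (ltr0Sn _ 1)).
have h1 : cabs (trig D p z) <= cnorm (trig_op u D p).
  by rewrite cabs_trig cnorm_trig_op //; apply: cabs_horner_le hu coef_le_peval.
have := cabs_dist (f z) (trig D p z); have := fp z.
have := cnorm_dist (trig_op u D p) (cfc u f); rewrite (cnorm_distC (trig_op u D p)); lra.
Qed.

Lemma cfc_inj (f g : T -> C) : ccont f -> ccont g -> cfc u f = cfc u g -> f = g.
Proof.
move=> fc gc fg; apply/funext => z; apply/eqP; rewrite -subr_eq0; apply/eqP/cabs_eq0.
apply/eqP; rewrite eq_le cabs_ge0 andbT.
by have := cabs_le_cfc z (ccontB fc gc); rewrite cfcB // fg subrr cnorm0.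
Qed.

(** The calculus is isometric, so that its range is closed. *)
Lemma cfc_surj y : cstar_gen [set u] y -> exists2 f : T -> C, ccont f & y = cfc u f.
Proof.
pose B := [set y : Q | exists2 f : T -> C, ccont f & y = cfc u f].
suff sB : cstar_subalg B.
  move=> /(cstar_gen_min sB); apply => x ->; exists cval; first exact: ccont_cval.
  by rewrite cfc_cval.
apply: cclosed_subalg.
- move=> l h.
  have h' (n : nat) : exists f : T -> C, ccont f /\ cnorm (l - cfc u f) < n.+1%:R^-1.
    by have [|x [f fc ->] lf] := h n.+1%:R^-1; [rewrite invr_gt0|exists f].
  pose F n := sval (cid (h' n)).
  have Fc n : ccont (F n) by rewrite /F; case: cid => f [].
  have Fl n : cnorm (l - cfc u (F n)) < n.+1%:R^-1 by rewrite /F; case: cid => f [].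
  have Fd n m z : cabs (F n z - F m z) < n.+1%:R^-1 + m.+1%:R^-1.
    apply: le_lt_trans (cabs_le_cfc z (ccontB (Fc n) (Fc m))) _; rewrite cfcB //.
    apply: le_lt_trans (cnorm_trans l _ _) _; rewrite cnorm_distC.
    exact: ltrD (Fl n) (Fl m).
  have ex z : exists a, forall e : R, 0 < e -> exists N, forall n, (N <= n)%N -> cabs (F n z - a) < e.
    apply: complex_cauchy => e e0.
    have [N hN] := natr_inv_lt (divr_gt0 e0 (ltr0Sn _ 1)).
    exists N => n Nn; apply: lt_trans (Fd n N z) _; rewrite [e in _ < e]splitr.
    by rewrite ltrD // hN.
  pose f z := sval (cid (ex z)).
  have fP z : forall e : R, 0 < e -> exists N, forall n, (N <= n)%N -> cabs (F n z - f z) < e.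
    by rewrite /f; case: cid.
  have Ff n z : cabs (F n z - f z) <= n.+1%:R^-1.
    apply: le_eps => e e0; have e2 : 0 < e / 2%:R by rewrite divr_gt0.
    have [N hN] := fP z _ e2; have [N' hN'] := natr_inv_lt e2.
    pose m := maxn N N'; have h1 := hN m (leq_maxl _ _); have h2 := hN' m (leq_maxr _ _).
    have := cabsD (F n z - F m z) (F m z - f z); rewrite addrA subrK => h3.
    apply: le_trans h3 _; apply: le_trans (lerD (ltW (Fd n m z)) (ltW h1)) _.
    by rewrite -addrA lerD2l [e in _ <= e]splitr lerD // ltW.
  have fc : ccont f.
    move=> z e e0; have e3 : 0 < e / 3%:R by rewrite divr_gt0.
    have [N hN] := natr_inv_lt e3; have [d d0 hd] := Fc N z _ e3.
    exists d => // w /hd hw; have h1 := Ff N z; have h2 := Ff N w; have h3 := hN N (leqnn _).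
    have h4 := le_lt_trans h1 h3; have h5 := le_lt_trans h2 h3.
    have := cabsD (f w - F N w + (F N w - F N z)) (F N z - f z).
    have := cabsD (f w - F N w) (F N w - F N z).
    rewrite !addrA !subrK (cabs_distrC (f w) (F N w)); lra.
  exists f => //; apply/eqP; rewrite -subr_eq0; apply/eqP/cnorm_small => e e0.
  have [N hN] := natr_inv_lt (divr_gt0 e0 (ltr0Sn _ 1)).
  apply: le_trans (cnorm_trans (cfc u (F N)) _ _) _.
  have h1 : cnorm (cfc u (F N) - cfc u f) <= N.+1%:R^-1.
    by rewrite -cfcB //; exact: (cfc_le hu (ccontB (Fc N) fc) (Ff N)).
  by rewrite [e in _ <= e]splitr lerD //; apply/ltW; [apply: lt_trans (Fl N) _|apply: le_lt_trans h1 _]; apply: hN.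
- move=> a x y' [f fc ->] [g gc ->]; exists (fun z => a * f z + g z).
    by apply: ccontD => //; apply: ccontM => //; exact: ccont_cst.
  rewrite cfcD //; last by apply: ccontM => //; exact: ccont_cst.
  by rewrite cfcM ?cfc_cst -?scalerAl ?mul1r //; exact: ccont_cst.
- move=> x y' [f fc ->] [g gc ->]; exists (fun z => f z * g z); first exact: ccontM.
  by rewrite cfcM.
- by move=> x [f fc ->]; exists (fun z => conjc (f z)); [exact: ccontJ|rewrite cfcJ].
- by exists (fun=> 0); [exact: ccont_cst|rewrite cfc_cst // scale0r].
Qed.

End Nontrivial.

(** * Conjugation averages *)

Definition conj_sum M x : Q := \sum_(j < M) zpow u j%:Z * x * zpow u (- j%:Z).

(** By [Q_III], the conjugates of [s_p s_p^*] over a period of length [p] sum to [1]. *)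
Lemma conj_sum_spanmon p t : conj_sum (p * t) (s p * star (s p)) = t%:R.
Proof.
elim: t => [|t IH]; first by rewrite muln0 /conj_sum big_ord0.
rewrite mulnS addnC /conj_sum big_split_ord /= -/(conj_sum _ _) IH.
rewrite (eq_bigr (fun j : 'I_p => zpow u (p * t)%:Z * (zpow u j%:Z * s p * star (s p) * zpow u (- j%:Z)) * zpow u (- (p * t)%:Z))).
  by rewrite -mulr_suml -mulr_sumr (Q_III rel) mulr1 zpowK // natr1.
move=> j _; have -> : (p * t + j)%:Z = (p * t)%:Z + j%:Z by lia.
by rewrite exprD -!zpow_nat opprD [_ - j%:Z]addrC zpowD // !mulrA.
Qed.

Lemma conj_sum_span y : span (fun p q => forall l, deg l p q = 0) y ->
  exists2 M, (0 < M)%N & forall t, cstar_gen [set u] (conj_sum (M * t) y).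
Proof.
have [gZ gM gS g0 _] := cstar_gen_subalg (A := Q) [set u].
elim=> [|a m p q n z /deg0_eq -> _ [M M0 hM]].
  exists 1%N => // t; rewrite /conj_sum big1 // => j _; by rewrite mulr0 mul0r.
exists (q * M)%N; first by rewrite muln_gt0 M0 gen_gt0.
move=> t.
have -> : conj_sum (q * M * t) (a *: spanmon m q q n + z) =
    a *: (zpow u m * (M * t)%:R * zpow u n) + conj_sum (q * M * t) z.
  rewrite -(conj_sum_spanmon q (M * t)) mulnA /conj_sum mulr_sumr mulr_suml scaler_sumr -big_split /=.
  apply: eq_bigr => j _; rewrite mulrDr mulrDl -scalerAr -scalerAl; congr (_ *: _ + _).
  have E (i k : int) : zpow u i * zpow u k = zpow u k * zpow u i by rewrite -!zpowD // addrC.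
  by rewrite /spanmon !mulrA (E j%:Z m) -[LHS]mulrA (E n) !mulrA.
apply: (gZ).
  rewrite -mulr_natr mulrA mulr_natr -scaler_nat -scalerAl -[_ *: _]addr0 mulr1.
  by apply: gZ => //; apply: gM; exact: zpow_gen.
by rewrite [(q * M)%N]mulnC -mulnA; exact: hM.
Qed.

End Masa.

(** * The commutant of [u] *)

Section Automorphisms.
Variables (R : realType) (S : set nat).
Local Notation P := (gen_monoid S).
Local Notation T := (circle R).
Local Notation C := R[i].
Hypothesis S_gt1 : forall a, S a -> (1 < a)%N.
Variables (Q : cstarAlgType R) (u : Q) (s : P -> Q).
Hypothesis univ : is_universal_Q u s.
Implicit Types (p q : P) (x y : Q).
Local Notation gam := (gam u s).
Local Notation conj_sum := (conj_sum u).
Let rel := univ_rel univ.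
Let hu : unitary u := rel_unitary rel.
Let gh l z := gam_hom S_gt1 univ l z.
Variable p0 : P.
Hypothesis p0_gt1 : (1 < p0)%N.

Lemma comm_star x : x * u = u * x -> star x * u = u * star x.
Proof.
by move=> /(comm_staru hu) /(congr1 (@star R Q)); rewrite !starM starK => <-.
Qed.

(** Averaging over the conjugates by the powers of [u] fixes [x], and maps its
    approximations by monomials to polynomials in [u]. *)
Lemma masa_deg0 x : x * u = u * x -> (forall l z, gam l z x = x) -> cstar_gen [set u] x.
Proof.
move=> xu hx; apply: subalg_cclosed; first exact: cstar_gen_subalg.
move=> e e0.
have [|y sy xy] := hom_dense S_gt1 univ (k := fun=> 0) (x := x) _ e0.
  by move=> l z; rewrite hx expr0z scale1r.
have [M M0 hM] := conj_sum_span S_gt1 univ sy.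
have := hM 1%N; rewrite muln1 => yM.
have [gZ gM gS g0 _] := cstar_gen_subalg (A := Q) [set u].
exists (M%:R^-1 *: conj_sum M y); first by rewrite -[_ *: _]addr0; apply: gZ.
have -> : x = M%:R^-1 *: conj_sum M x.
  rewrite /conj_sum (eq_bigr (fun=> x)) => [|j _].
    by rewrite sumr_const card_ord -[x *+ M]scaler_nat scalerA mulVf ?scale1r // pnatr_eq0 -lt0n.
  by rewrite -(zpow_comm hu _ xu) -mulrA zpowK // mulr1.
rewrite -scalerBr cnormZE cabsV cabs_nat ltr_pdivrMl ?ltr0n // /conj_sum -sumrB.
apply: le_lt_trans (cnorm_sum _ _ _) _.
rewrite (eq_bigr (fun=> cnorm (x - y))) => [|j _].
  by rewrite sumr_const card_ord -[cnorm _ *+ M]mulr_natl ltr_pM2l ?ltr0n.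
by rewrite -mulrBl -mulrBr (cnormM_zpow hu) (cnorm_zpowM hu).
Qed.

Lemma expi_root (L : nat) : (0 < L)%N -> expi (pi / L%:R) ^+ L = -1 :> C.
Proof.
move=> L0; rewrite -expiMn mulrC divfK ?pnatr_eq0 -?lt0n //.
by rewrite /expi cospi sinpi; apply/eqP; rewrite eq_complex /= oppr0 !eqxx.
Qed.

Lemma expi_root_small (d : R) : 0 < d ->
  exists N, forall L, (N <= L)%N -> cabs (expi (pi / L.+1%:R) - 1) < d.
Proof.
move=> d0; have [d' d'0 hd'] := expi_cont 0 d0.
have [N hN] := natr_inv_lt (divr_gt0 d'0 (pi_gt0 R)); exists N => L /hN h.
rewrite -(expi0 R); apply: hd'; rewrite subr0 ger0_norm ?divr_ge0 ?pi_ge0 //.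
by rewrite mulrC -ltr_pdivlMr ?pi_gt0.
Qed.

(** If [z ^ L] is close to [1], a rotation of [z] by the small angle [pi / L] changes its sign.
    Hence [z ^ L - 1] has modulus at least [1] at [z] or close to it. *)
Lemma small_of_roots (f : T -> C) (K : nat) (e : R) : ccont f -> (0 < K)%N ->
  (forall (M : nat) z, cabs (f z) * cabs (cval z ^+ (K * M) - 1) <= e) ->
  forall z, cabs (f z) <= e.
Proof.
move=> fc K0 H z; apply: le_eps => d d0.
have [d' d'0 hd'] := fc z d d0.
have [N hN] := expi_root_small d'0.
have [L LE] : exists L, (K * N.+1)%N = L.+1 by exists (K * N.+1).-1; rewrite prednK ?muln_gt0 ?K0.
have NL : (N <= L)%N by rewrite -ltnS -LE leq_pmull.
pose w : T := mkcircle (expi_abs (pi / L.+1%:R)).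
have wL : cval w ^+ L.+1 = -1 by apply: expi_root.
have h1 := H N.+1 z; have h2 := H N.+1 (z * w)%g.
rewrite LE in h1 h2; rewrite cvalM exprMn wL mulrN1 in h2.
set a := cval z ^+ L.+1 in h1 h2.
have h3 : cabs (f (z * w)%g - f z) < d.
  apply: hd'; rewrite cvalM -{2}[cval z]mulr1 -mulrBr cabsM cval_abs mul1r.
  exact: hN.
have h4 : 2%:R <= cabs (a - 1) + cabs (- a - 1).
  have := cabsD (a - 1) (- a - 1); rewrite addrACA subrr add0r -opprD cabsN.
  by rewrite -[1 + 1]/(2%:R : C) cabs_nat.
have h5 := cabs_dist (f z) (f (z * w)%g); rewrite cabs_distrC in h5.
move: (cabs_ge0 (f z)) (cabs_ge0 (f (z * w)%g)) => f0 f1.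
have [le1|le1] := lerP 1 (cabs (a - 1)); first by nra.
have le2 : 1 <= cabs (- a - 1) by lra.
have : cabs (f (z * w)%g) <= e by nra.
have h6 : cabs (f z - f (z * w)%g) < d by rewrite cabs_distrC.
by have := cabs_dist (f z) (f (z * w)%g); lra.
Qed.

(** [x^* x] has degree [1], hence is a function [f] of [u]. As [x] commutes with [u] and almost
    intertwines its powers [pM] and [qM], [f] is almost annihilated by [z ^ (pM) - z ^ (qM)],
    and [small_of_roots] applies. *)
Lemma masa_deg_neq0 x (k : nat -> int) l0 : x * u = u * x ->
  (forall l z, gam l z x = cval z ^ k l *: x) -> k l0 != 0 -> x = 0.
Proof.
move=> xu hx kl0; have xsu := comm_star xu.
have [|f fc dE] := cfc_surj univ p0_gt1 (y := star x * x).
  apply: masa_deg0; first by rewrite -mulrA xu mulrA xsu mulrA.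
  move=> l z; rewrite (star_homM (gh l z)) (star_hom_star (gh l z)) hx starZE.
  rewrite -scalerAl -scalerAr scalerA conjc_abs1 ?cabs_exprz ?cval_abs //.
  by rewrite mulVf ?scale1r // expfz_neq0 // cval_neq0.
(* [p] and [q] depend on [e], and may be large as [e] decreases *)
have fe (e : R) : 0 < e -> forall z, cabs (f z) <= cnorm x * e.
  move=> e0 z; have [xe|[p [q [hpq E]]]] := hom_intertwine S_gt1 univ hx e0.
    apply: le_trans (cabs_le_cfc univ p0_gt1 z fc) _; rewrite -dE.
    apply: le_trans (cnormM _ _) _; rewrite cnorm_star.
    by rewrite ler_wpM2l ?cnorm_ge0.
  have pq : (p : nat) != q.
    by apply: contra_neq kl0 => pq; rewrite -(hpq l0) /deg pq subrr.
  have F M z' : cabs (f z' * (cval z' ^+ (p * M) - cval z' ^+ (q * M))) <= cnorm x * e.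
    have zc (n : nat) : ccont (fun z : T => cval z ^+ n) by apply: ccontX; exact: ccont_cval.
    have dc : ccont (fun z : T => cval z ^+ (p * M) - cval z ^+ (q * M)) := ccontB (zc _) (zc _).
    apply: le_trans (cabs_le_cfc univ p0_gt1 z' (ccontM fc dc)) _.
    have zE n : cfc u (fun z => cval z ^+ n) = u ^+ n.
      elim: n => [|n IH]; first by rewrite cfc_cst // scale1r.
      have -> : (fun z : T => cval z ^+ n.+1) = fun z => cval z * cval z ^+ n.
        by apply/funext => w; rewrite exprS.
      by rewrite cfcM // ?cfc_cval // ?IH ?exprS //; exact: ccont_cval.
    rewrite cfcM // cfcB // !zE -dE -mulrA mulrBr.
    rewrite [x * u ^+ (p * M)]commrX //.
    apply: le_trans (cnormM _ _) _; rewrite cnorm_star ler_wpM2l ?cnorm_ge0 //.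
  have [pq'|qp|pq'] := ltngtP p q; last by rewrite pq' eqxx in pq.
    apply: (small_of_roots (K := (q - p)%N) fc); rewrite ?subn_gt0 // => M w.
    apply: le_trans (F M w); rewrite cabsM ler_wpM2l ?cabs_ge0 // cabs_distrC.
    have -> : cval w ^+ (p * M) - cval w ^+ (q * M) = cval w ^+ (p * M) * (1 - cval w ^+ ((q - p) * M)).
      by rewrite mulrBr mulr1 -exprD -mulnDl subnKC // ltnW.
    by rewrite cabsM cabsX cval_abs expr1n mul1r.
  apply: (small_of_roots (K := (p - q)%N) fc); rewrite ?subn_gt0 // => M w.
  apply: le_trans (F M w); rewrite cabsM ler_wpM2l ?cabs_ge0 //.
  have -> : cval w ^+ (p * M) - cval w ^+ (q * M) = cval w ^+ (q * M) * (cval w ^+ ((p - q) * M) - 1).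
    by rewrite mulrBr mulr1 -exprD -mulnDl subnKC // ltnW.
  by rewrite cabsM cabsX cval_abs expr1n mul1r.
have d0 : star x * x = 0.
  rewrite dE; apply: cnorm_small => e e0; apply: (cfc_le hu fc) => z.
  have x1 : 0 < cnorm x + 1 by have := cnorm_ge0 x; lra.
  apply: le_trans (fe (e / (cnorm x + 1)) (divr_gt0 e0 x1) z) _.
  by rewrite mulrA ler_pdivrMr // mulrC ler_pM2l //; lra.
apply: cnorm_eq0; apply/eqP; rewrite -sqrf_eq0 -cstar_identity d0 cnorm0 //.
Qed.

Theorem masa x : x * u = u * x -> cstar_gen [set u] x.
Proof.
have [gZ gM gS g0 _] := cstar_gen_subalg (A := Q) [set u].
have sub := subalg_cclosed (cstar_gen_subalg (A := Q) [set u]).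
apply: (synthesis S_gt1 univ (I := [set x | x * u = u * x])) => //=.
- exact: cclosed_comm.
- by move=> a y z /= yu zu; rewrite mulrDl mulrDr -scalerAl -scalerAr yu zu.
- by rewrite mulr0 mul0r.
- move=> l z y yu; have := congr1 (gam l z) yu.
  by rewrite !(star_homM (gh l z)) (gam_u S_gt1 univ).
- move=> y k yu hy; have [k0|] := pselect (forall l, k l = 0).
    by apply: masa_deg0 => // l z; rewrite hy k0 expr0z scale1r.
  by move=> /existsNP[l /eqP kl]; rewrite (masa_deg_neq0 yu hy kl).
Qed.

End Automorphisms.

(** * Automorphisms fixing [u] *)

Section Main.
Variables (R : realType) (S : set nat).
Local Notation P := (gen_monoid S).
Local Notation T := (circle R).
Local Notation C := R[i].
Hypothesis S_gt1 : forall a, S a -> (1 < a)%N.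
Variables (Q : cstarAlgType R) (u : Q) (s : P -> Q).
Hypothesis univ : is_universal_Q u s.
Implicit Types (p q n : P) (x y : Q).
Local Notation gam := (gam u s).
Local Notation beta := (beta u s).
Let rel := univ_rel univ.
Let hu : unitary u := rel_unitary rel.
Let gh l z := gam_hom S_gt1 univ l z.

Lemma gen_gt1P : (exists p0 : P, (1 < p0)%N) \/ (forall p : P, p = 1%g).
Proof.
have [|h] := pselect (exists p0 : P, (1 < p0)%N); first by left.
right=> p; apply: gen_val_inj; have := gen_gt0 S_gt1 p.
have : ~ (1 < p)%N by move=> h'; apply: h; exists p.
by move=> h1 h2; change (nat_of_gen p = 1%N); lia.
Qed.

Lemma aut_u phi : Aut_fix (cstar_gen [set u]) phi -> phi u = u.
Proof. by move=> [_ h]; apply: h; apply: cstar_gen_sub. Qed.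

Section Surjective.
Variable p0 : P.
Hypothesis p0_gt1 : (1 < p0)%N.
Variable phi : Q -> Q.
Hypothesis hphi : star_hom phi.
Hypothesis phiu : phi u = u.

Let phiz m : phi (zpow u m) = zpow u m.
Proof. by rewrite star_hom_zpow // phiu. Qed.

(** The unitary that [phi] multiplies [s_p] by. *)
Let w p := \sum_(m < p) zpow u m%:Z * (phi (s p) * star (s p)) * zpow u (- m%:Z).

Let s_comm p m (h : (m < p)%N) (k : nat) : (k < p)%N ->
  star (s p) * zpow u (- m%:Z) * zpow u k%:Z * s p = if m == k then 1 else 0.
Proof.
move=> kp; rewrite -(mulrA (star _)) -zpowD //; case: eqVneq => [->|mk].
  by rewrite addNr mulr1 (rel_iso rel).
apply: (sstar_z_s_dvd univ); apply/negP => /dvdn_leq; move/eqP: mk; lia.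
Qed.

Let w_s p : w p * s p = phi (s p).
Proof.
have pp := gen_gt0 S_gt1 p.
rewrite /w mulr_suml (bigD1 (Ordinal pp)) //= [X in _ + X]big1 => [|m m0].
  by rewrite addr0 mul1r mulr1 -mulrA (rel_iso rel) mulr1.
rewrite -!mulrA [star (s p) * _]mulrA.
have := s_comm (ltn_ord m) pp; rewrite mulr1 => ->.
by rewrite ifF ?mulr0 //; apply/negbTE.
Qed.

Let w_comm p : w p * u = u * w p.
Proof.
pose F (m : nat) := zpow u m%:Z * (phi (s p) * star (s p)) * zpow u (- m%:Z).
have E m : F m.+1 * u = u * F m.
  have h : zpow u (- m.+1%:Z) * u = zpow u (- m%:Z).
    by rewrite -zpowSr //; congr (zpow u _); lia.
  by rewrite /F -mulrA h !zpow_nat exprS !mulrA.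
(* the sum is cyclic: its term of index [p] is that of index [0] *)
have Fp : F p = F 0%N.
  rewrite /F mul1r mulr1.
  have h1 : zpow u p%:Z * phi (s p) = phi (s p) * u.
    by rewrite -phiz -(star_homM hphi) -{2}phiu -(star_homM hphi) -{1}[p%:Z]mulr1 -(sE rel) zpow1.
  have h2 : star (s p) * zpow u (- p%:Z) = star u * star (s p).
    by rewrite -[p%:Z]mulr1 -mulrN (sstarE rel) /= expr1.
  rewrite mulrA h1 -mulrA h2 -mulrA [u * _]mulrA; case: hu => _ ->.
  by rewrite mul1r.
have wE : w p = \sum_(m < p) F m by [].
have pp := gen_gt0 S_gt1 p.
rewrite wE mulr_suml mulr_sumr; move: Fp; rewrite -(prednK pp) => Fp.
rewrite big_ord_recl [RHS]big_ord_recr /= addrC -E -Fp; congr (_ + _).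
by apply: eq_bigr => m _; rewrite E.
Qed.

Let w_unitary p : unitary (w p).
Proof.
have phis m k : star (phi (s p)) * zpow u m * zpow u k * phi (s p) =
    phi (star (s p) * zpow u m * zpow u k * s p).
  by rewrite !(star_homM hphi) (star_hom_star hphi) !phiz.
have ws : star (w p) = \sum_(m < p) zpow u m%:Z * (s p * star (phi (s p))) * zpow u (- m%:Z).
  rewrite /w star_sum; apply: eq_bigr => m _.
  by rewrite !starM !star_zpow starK opprK !mulrA.
(* the elements built from [a b^*] and [b c^*] multiply like matrix units *)
have gen (a b : Q) (hb : forall m k : nat, (m < p)%N -> (k < p)%N ->
    star b * zpow u (- m%:Z) * zpow u k%:Z * b = if m == k then 1 else 0) (c : Q) :
  (\sum_(m < p) zpow u m%:Z * (a * star b) * zpow u (- m%:Z)) *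
  (\sum_(m < p) zpow u m%:Z * (b * star c) * zpow u (- m%:Z)) =
  \sum_(m < p) zpow u m%:Z * (a * star c) * zpow u (- m%:Z).
  have core (m k : int) : zpow u m * (a * star b) * zpow u (- m) * (zpow u k * (b * star c) * zpow u (- k)) =
      zpow u m * a * (star b * zpow u (- m) * zpow u k * b) * star c * zpow u (- k) by rewrite !mulrA.
  rewrite mulr_suml; apply: eq_bigr => m _; rewrite mulr_sumr.
  rewrite (eq_bigr (fun k : 'I_p => if m == k then zpow u m%:Z * (a * star c) * zpow u (- m%:Z) else 0)).
    by rewrite -big_mkcond (big_pred1 m) // => k; rewrite /= eq_sym.
  move=> k _; rewrite core hb //; have [->|km] := eqVneq m k.
    by rewrite eqxx mulr1 !mulrA.
  by rewrite ifF ?mulr0 ?mul0r //; apply/negbTE.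
split.
  rewrite ws /w gen => [|m k mp kp].
    by rewrite -[RHS](Q_III rel p); apply: eq_bigr => m _; rewrite !mulrA.
  rewrite phis s_comm //; case: ifP => _; [exact: star_hom1|exact: star_hom0].
rewrite ws /w gen => [|m k mp kp]; last exact: s_comm.
rewrite -[RHS](star_hom1 hphi) -(Q_III rel p) (star_hom_sum hphi); apply: eq_bigr => m _.
by rewrite !(star_homM hphi) (star_hom_star hphi) !phiz !mulrA.
Qed.

Lemma beta_surj : exists2 psi, Hom_theta psi & beta psi = phi.
Proof.
have ex p : exists f : T -> C, ccont f /\ w p = cfc u f.
  have [f fc wE] := cfc_surj univ p0_gt1 (masa S_gt1 univ p0_gt1 (w_comm p)).
  by exists f.
pose f p := sval (cid (ex p)).
have fc p : ccont (f p) by rewrite /f; case: cid => ? [].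
have fw p : w p = cfc u (f p) by rewrite /f; case: cid => ? [].
have f1 p z : cabs (f p z) = 1.
  have fJ := ccontJ (fc p).
  have E : (fun z => conjc (f p z) * f p z) = fun=> 1.
    apply: (cfc_inj univ p0_gt1); [exact: ccontM|exact: ccont_cst|].
    by rewrite cfcM // cfcJ // -fw cfc_cst // scale1r; case: (w_unitary p).
  have := congr1 (fun h => h z) E; rewrite /= mulrC sqr_cabs => /(congr1 (@complex.Re R)) /= /eqP.
  rewrite sqrf_eq1 => /orP[/eqP//|/eqP h]; have := cabs_ge0 (f p z); rewrite h; lra.
pose psi p z : T := mkcircle (f1 p z).
have hpsi : Hom_theta psi.
  split=> [p|p q z]; first by apply/ccont_circle; exact: fc.
  apply: cval_inj; rewrite cvalM !mkcircleE.
  have c1 := fc p; have c2 := fc (p * q)%g; have c3 := ccont_pow (nat_of_gen p) (fc q).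
  suff : f (p * q)%g = fun z => f p z * f q (z ^+ nat_of_gen p)%g by move=> ->.
  apply: (cfc_inj univ p0_gt1) => //; first exact: ccontM.
  have cu (g : T -> C) : ccont g -> cfc u g * u = u * cfc u g.
    by move=> gc; apply/esym; apply: (cfc_comm hu gc).
  apply: (cancel_s rel (p := (p * q)%g)); rewrite ?cu //; first exact: ccontM.
  rewrite -fw w_s (Q_mul rel) (star_homM hphi) -!w_s !fw cfcM //.
  by rewrite -!mulrA; congr (_ * _); rewrite !mulrA (s_cfc rel p (fc q)).
exists psi => //; apply: (hom_eq univ (beta_hom univ hpsi) hphi); first by rewrite (beta_u univ hpsi).
by move=> p; rewrite (beta_s univ p hpsi) -w_s fw.
Qed.

End Surjective.

(** * Automorphisms fixing [O_n] fix [u] *)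

Lemma O_alg_gen n (k : nat) : (k < n)%N -> O_alg u s n (zpow u k%:Z * s n).
Proof. by move=> kn; apply: cstar_gen_sub; exists k. Qed.

Lemma fix_O_alg n (phi : Q -> Q) : star_hom phi -> phi u = u -> phi (s n) = s n ->
  forall x, O_alg u s n x -> phi x = x.
Proof.
move=> hphi phiu phis; apply: (star_hom_eq_gen hphi (star_hom_id Q)) => x [k _ <-].
by rewrite (star_homM hphi) (star_hom_zpow hphi) phiu phis.
Qed.

(** [y^* u^p y] contains the factor [s_N^* u^p s_N = 0] once [N > p], while [u^p y] is
    close to [y u^q]. *)
Lemma rigid_hom n y (k : nat -> int) : (1 < n)%N ->
  (forall K, y = s (gen_pow n K) * y * star (s (gen_pow n K))) ->
  (forall l z, gam l z y = cval z ^ k l *: y) -> y = 0.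
Proof.
move=> n1 yN hy; apply: cnorm_small => e e0.
have [//|[p [q [_ /(_ 1%N) E]]]] := hom_intertwine S_gt1 univ hy e0.
rewrite !muln1 in E; pose N := gen_pow n p; have NE : nat_of_gen N = (n ^ p)%N := gen_powE n p.
have Np : (p < N)%N by rewrite NE ltn_expl.
have z0 : star y * (zpow u p%:Z * y) = 0.
  rewrite [in star y](yN p) -/N [X in _ * (_ * X)](yN p) -/N !starM starK -!mulrA.
  rewrite [star (s N) * (zpow _ _ * _)]mulrA [star (s N) * zpow _ _ * (_ * _)]mulrA.
  rewrite (sstar_z_s_dvd univ) ?mul0r ?mulr0 //.
  by apply/negP => /dvdn_leq; have := gen_gt0 S_gt1 p; lia.
have : cnorm y ^+ 2 <= cnorm y * e.
  rewrite -cstar_identity -(cnormM_zpow hu q%:Z) -cnormN -[- _]add0r -mulrA -{1}z0 -mulrBr.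
  apply: le_trans (cnormM _ _) _; rewrite cnorm_star ler_wpM2l ?cnorm_ge0 //.
have [->|y0] := eqVneq (cnorm y) 0; first by move=> _; exact: ltW.
by rewrite expr2 ler_pM2l // lt_def y0 cnorm_ge0.
Qed.

(** The set of the [y] with [y = s_N y s_N^*] for all powers [N] of [n] is gauge invariant. *)
Lemma rigid n y : (1 < n)%N -> y = s n * y * star (s n) -> y = 0.
Proof.
move=> n1 yn.
pose I := [set y : Q | forall K, y = s (gen_pow n K) * y * star (s (gen_pow n K))].
have Iy : I y.
  elim=> [|K IH].
    by rewrite /= (_ : gen_monoid_one S = 1%g) // (Q_one rel) star1 mul1r mulr1.
  have -> : gen_pow n K.+1 = (n * gen_pow n K)%g by [].
  by rewrite (Q_mul rel) starM {1}yn {1}IH !mulrA.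
apply: (synthesis S_gt1 univ (I := I) (J := [set 0])) Iy => //=.
- move=> l h K; set N := gen_pow n K; have iN := rel_iso rel N.
  apply: (@cclosed_eq _ _ _ id (fun y => s N * y * star (s N)) 1 1).
  + by [].
  + by move=> v w; rewrite mulrBr mulrBl.
  + by move=> v; rewrite mul1r.
  + by move=> v; rewrite mul1r cnormM_coiso // cnorm_isoM.
  + by move=> e /h[z hz lz]; exists z => //; exact: hz.
- by move=> a v w hv hw K; rewrite mulrDr mulrDl -scalerAr -scalerAl -(hv K) -(hw K).
- by move=> K; rewrite mulr0 mul0r.
- move=> l z v hv K; rewrite [in LHS](hv K) !(star_homM (gh l z)) (star_hom_star (gh l z)).
  rewrite (gam_s S_gt1 univ) starZE -!(scalerAl, scalerAr) scalerA conjc_abs1; last first.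
    by rewrite cabsX cval_abs expr1n.
  by rewrite mulVf ?scale1r // expf_neq0 // cval_neq0.
- move=> l h; apply: cnorm_small => e e0; have [z /= -> ] := h e e0.
  by rewrite subr0 => /ltW.
- by move=> a v w /= -> ->; rewrite scaler0 addr0.
- by move=> v k hv hk; exact: (rigid_hom n1 hv hk).
Qed.

(** With [v = phi u], the isometries [u^k s_n] of [O_n] satisfy [v (u^k s_n) = u^(k+1) s_n] for
    [k + 1 < n] and [v (u^(n-1) s_n) = s_n v]; so [u v^* - 1] is supported by [s_n s_n^*] and
    commutes with [s_n]. *)
Lemma fix_O_u n phi : (1 < n)%N -> Aut_fix (O_alg u s n) phi -> phi u = u.
Proof.
move=> n1 [[hphi _] hO].
have n0 : (0 < n)%N by apply: ltnW.
set v := phi u.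
have hs : phi (s n) = s n.
  by have := hO _ (O_alg_gen n0); rewrite mul1r.
have vk (k : nat) : (k < n)%N -> v ^+ k * s n = u ^+ k * s n.
  by move=> kn; have := hO _ (O_alg_gen kn); rewrite /= (star_homM hphi) (star_homX hphi) hs.
have vv : star v * v = 1.
  by rewrite -(star_hom_star hphi) -(star_homM hphi); case: hu => -> _; exact: star_hom1.
have vv' : v * star v = 1.
  by rewrite -(star_hom_star hphi) -(star_homM hphi); case: hu => _ ->; exact: star_hom1.
have sv : s n * v = v ^+ n * s n.
  have := congr1 phi (s_u rel n).
  by rewrite !(star_homM hphi) (star_homX hphi) hs.
pose y := u * star v - 1.
have y1 (k : nat) : (0 < k < n)%N -> y * (u ^+ k * s n) = 0.
  case: k => [//|k] /= kn.
  have E : star v * (u ^+ k.+1 * s n) = u ^+ k * s n.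
    by rewrite -(vk _ kn) exprS -!mulrA [star v * _]mulrA vv mul1r vk // ltnW.
  by rewrite /y mulrBl mul1r -mulrA E mulrA -exprS subrr.
have y0 : y * s n = s n * y.
  have h : star v * s n = u ^+ n.-1 * s n * star v.
    have h1 : v * (u ^+ n.-1 * s n) = s n * v.
      by rewrite -vk ?prednK // mulrA -exprS prednK.
    rewrite -[LHS]mulr1 -vv' !mulrA -[star v * _ * v]mulrA -h1 mulrA vv mul1r //.
  rewrite /y mulrBl mulrBr mul1r mulr1 -mulrA h !mulrA -exprS prednK //.
  by rewrite -(s_u rel).
have yn : y = s n * y * star (s n).
  rewrite -y0 {1}(rel_sum rel n y) (bigD1 (Ordinal n0)) //= big1 => [|k k0].
    by rewrite addr0 mul1r.
  by rewrite y1 ?mul0r // ltn_ord andbT lt0n.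
have := rigid n1 yn; rewrite /y => /eqP; rewrite subr_eq0 => /eqP E.
by rewrite -[LHS]mul1r -E -mulrA vv mulr1.
Qed.

(** The function [psi p] is invariant under roots of unity of order [N = n ^ K]. Averaging a
    Laurent polynomial over them leaves its constant coefficient only. *)
Lemma Hom_theta_const psi n : (1 < n)%N -> Hom_theta psi -> psi n = (fun=> 1%g) ->
  forall p z, psi p z = psi p 1%g :> T.
Proof.
move=> n1 hpsi pn p.
have n0 : (0 < n)%N by apply: ltnW.
have inv z : psi p z = psi p (z ^+ n)%g.
  have := psi_mul hpsi p n z; rewrite gen_mulC (psi_mul hpsi) pn.
  by rewrite mul1g mulg1 => ->.
have invK K z : psi p z = psi p (z ^+ (n ^ K))%g.
  elim: K => [|K IH]; first by rewrite expn0 expg1.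
  by rewrite IH inv circle_expgM expnSr.
have fc := psi_cont hpsi p.
move=> z; apply: cval_inj; apply/eqP; rewrite -subr_eq0; apply/eqP/cabs_eq0/eqP.
rewrite eq_le cabs_ge0 andbT; apply: le_eps => e e0; rewrite add0r.
have [D [q hq]] := trig_dense fc (divr_gt0 e0 (ltr0Sn _ 1)).
pose K := (size q + D)%N; pose N := (n ^ K)%N.
have KN : (K < N)%N by rewrite ltn_expl.
have N0 : (0 < N)%N by apply: leq_ltn_trans KN.
have H z' : cabs (cval (psi p z') - q`_D) <= e / 2%:R.
  have NE : N%:R * (cval (psi p z') - q`_D) = \sum_(j < N)
     (cval (psi p (z' * zetac R N ^+ j)%g) - trig D q (z' * zetac R N ^+ j)%g).
    rewrite sumrB mulrBr; congr (_ - _).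
      rewrite (eq_bigr (fun=> cval (psi p z'))) => [|j _].
        by rewrite sumr_const card_ord mulr_natl.
      rewrite (invK K) [in RHS](invK K) -/N circle_expgMn.
      have -> : ((zetac R N ^+ j) ^+ N)%g = 1%g :> T.
        by apply: cval_inj; rewrite !cvalX -exprM mulnC exprM zeta_expN // expr1n.
      by rewrite mulg1.
    rewrite -(@coef_avg _ q N D (cval z')) ?cval_abs //; [|by apply: leq_trans (ltnW KN); exact: leq_addr|].
      by apply: eq_bigr => j _; rewrite /trig cvalM cval_zetac.
    by apply: leq_ltn_trans KN; exact: leq_addl.
  have : cabs (N%:R * (cval (psi p z') - q`_D)) <= N%:R * (e / 2%:R).
    rewrite NE; apply: le_trans (cabs_sum _ _ _) _.
    have G (j : 'I_N) : true -> cabs (cval (psi p (z' * zetac R N ^+ j)%g) - trig D q (z' * zetac R N ^+ j)%g) <= e / 2%:R.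
      by move=> _; exact: hq.
    by apply: le_trans (ler_sum _ G) _; rewrite sumr_const card_ord -[X in X <= _]mulr_natl.
  by rewrite cabsM cabs_nat ler_pM2l ?ltr0n.
have := cabsB (cval (psi p z) - q`_D) (cval (psi p 1%g) - q`_D).
rewrite opprB addrA subrK; have := H z; have := H 1%g; lra.
Qed.

(** [Q_III] cancels [s_p], and the calculus is injective as soon as the monoid
    has an element other than [1]. *)
Lemma beta_inj psi1 psi2 : Hom_theta psi1 -> Hom_theta psi2 -> beta psi1 = beta psi2 -> psi1 = psi2.
Proof.
move=> h1 h2 E; apply/funext => p; apply/funext => z.
have [[p0 p01]|tr] := gen_gt1P; last by rewrite (tr p) (psi_one h1) (psi_one h2).
apply: cval_inj; have c1 := psi_cont h1 p; have c2 := psi_cont h2 p.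
suff : (fun z => cval (psi1 p z)) = (fun z => cval (psi2 p z)) by move=> /(congr1 (fun f => f z)).
apply: (cfc_inj univ p01) => //; apply: (cancel_s rel (p := p)).
- by apply/esym; apply: (cfc_comm hu c1).
- by apply/esym; apply: (cfc_comm hu c2).
- by rewrite -(beta_s univ p h1) -(beta_s univ p h2) E.
Qed.

Lemma is_beta_beta : is_beta u s beta.
Proof.
split.
- split.
  + by move=> psi hpsi; exact: (beta_aut univ hpsi).
  + by move=> psi1 psi2 /set_mem h1 /set_mem h2; exact: beta_inj.
  + move=> phi hphi; have phiu := aut_u hphi; case: (hphi) => -[hh _] _.
    have [[p0 p01]|tr] := gen_gt1P.
      by have [psi h1 h2] := beta_surj p01 hh phiu; exists psi.
    have h : Hom_theta (fun (_ : P) (_ : T) => 1%g).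
      by apply: Hom_theta_cst => p q; rewrite mulg1.
    exists (fun _ _ => 1%g) => //; rewrite (beta_id univ h) //.
    apply: (hom_eq univ (star_hom_id Q) hh) => // p.
    by rewrite (tr p) (Q_one rel) (star_hom1 hh).
- by move=> psi1 psi2 h1 h2; exact: (beta_mul univ h1 h2).
- by move=> psi hpsi; split; [exact: (beta_u univ hpsi)|move=> p; exact: (beta_s univ p hpsi)].
Qed.

(** * The gauge action of the dual of the group of fractions *)

Lemma dual_fracM (chi : frac_group S -> T) p q : dual_frac chi ->
  chi (frac_of (p * q)%g) = (chi (frac_of p) * chi (frac_of q))%g.
Proof. by move=> h; apply: h; exact: natrM. Qed.

Definition gamma (chi : frac_group S -> T) : Q -> Q := beta (fun p _ => chi (frac_of p)).

Lemma gamma_Hom chi : dual_frac chi -> Hom_theta (fun p (_ : T) => chi (frac_of p)).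
Proof. by move=> h; apply: Hom_theta_cst => p q; exact: dual_fracM. Qed.

Lemma is_gauge_gamma : is_gauge_action u s gamma.
Proof.
split.
- by move=> chi h; case: (beta_aut univ (gamma_Hom h)).
- move=> chi1 chi2 h1 h2; exact: (beta_mul univ (gamma_Hom h1) (gamma_Hom h2)).
- move=> chi h; split; first exact: (beta_u univ (gamma_Hom h)).
  by move=> p; rewrite /gamma (gauge_s univ) // => a b; exact: dual_fracM.
Qed.

(** Two expressions of a fraction agree after cross-multiplication, which takes place in
    the monoid. *)
Lemma char_extend (chi : P -> T) : (forall p q, chi (p * q)%g = (chi p * chi q)%g) ->
  exists chi' : frac_group S -> T, dual_frac chi' /\ forall p, chi' (frac_of p) = chi p.
Proof.
move=> chiM.
have ex (x : frac_group S) : exists pq : P * P, set_val x = (pq.1)%:R / (pq.2)%:R.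
  by have [p [q E]] := set_mem (valP x); exists (p, q).
pose num (x : frac_group S) := (sval (cid (ex x))).1; pose den (x : frac_group S) := (sval (cid (ex x))).2.
have nd (x : frac_group S) : set_val x = (num x)%:R / (den x)%:R by rewrite /num /den; case: cid.
have nz p : (p%:R : rat) != 0 by rewrite pnatr_eq0 -lt0n gen_gt0.
have cross (p q p' q' : P) : (p%:R / q%:R : rat) = p'%:R / q'%:R -> (p * q' = p' * q)%g.
  move=> E; apply: gen_val_inj; change ((p * q')%N = (p' * q)%N); apply/eqP.
  rewrite -(eqr_nat rat) !natrM -(divr1 (_ * _)); apply/eqP.
  have : p%:R / q%:R * (q%:R * q'%:R) = p'%:R / q'%:R * (q%:R * q'%:R) :> rat by rewrite E.
  by rewrite mulrA divfK // [q%:R * q'%:R]mulrC mulrA divfK // divr1.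
pose chi' (x : frac_group S) := (chi (num x) * (chi (den x))^-1)%g.
have chiE (x : frac_group S) (p q : P) : set_val x = p%:R / q%:R -> chi' x = (chi p * (chi q)^-1)%g.
  rewrite nd => /cross /(congr1 chi); rewrite !chiM => E.
  apply: cval_inj; have := congr1 cval E; rewrite /chi' !cvalM !cvalV => {}E.
  by apply/eqP; rewrite eqr_div ?cval_neq0 // E.
exists chi'; split=> [x y xy E|p].
  rewrite (chiE xy (num x * num y)%g (den x * den y)%g); last first.
    by rewrite E !nd !gen_valM !natrM mulf_div.
  by rewrite !chiM /chi'; apply: cval_inj; rewrite !(cvalM, cvalV) mulf_div.
have chi1 : chi 1%g = 1%g.
  by apply: (@circle_mulgI _ (chi 1%g)); rewrite -chiM !mulg1.
rewrite (chiE _ p 1%g); last by rewrite /= divr1.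
by rewrite chi1 invg1 mulg1.
Qed.

Lemma fix_O_iff n psi : (1 < n)%N -> Hom_theta psi ->
  Aut_fix (O_alg u s n) (beta psi) <-> Hom_circle psi /\ psi n = (fun=> 1%g).
Proof.
move=> n1 hpsi; have n0 : (0 < n)%N by apply: ltnW.
have hh := beta_hom univ hpsi; have bu := beta_u univ hpsi; split.
  move=> [_ hO].
  have sn : beta psi (s n) = s n by have := hO _ (O_alg_gen n0); rewrite mul1r.
  have cn := psi_cont hpsi n.
  have pn : psi n = (fun=> 1%g).
    apply/funext => z; apply: cval_inj.
    suff : (fun z => cval (psi n z)) = (fun=> 1) by move=> /(congr1 (fun f => f z)).
    apply: (cfc_inj univ n1) => //; first exact: ccont_cst.
    apply: (cancel_s rel (p := n)); rewrite ?cfc_cst // ?scale1r ?mulr1 ?mul1r //.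
      by apply/esym; apply: (cfc_comm hu cn).
    by rewrite -(beta_s univ n hpsi) sn.
  split=> //; have cst := Hom_theta_const n1 hpsi pn.
  exists (fun p => psi p 1%g); split.
  - exact: psi_one.
  - by move=> p q; rewrite (psi_mul hpsi) [psi q (_ ^+ _)%g]cst.
  - by apply/funext => p; apply/funext => z; exact: cst.
move=> [_ pn]; split; first by case: (beta_aut univ hpsi).
apply: fix_O_alg => //; rewrite (beta_s univ n hpsi) pn cfc_cst // scale1r mul1r //.
Qed.

End Main.

(** * The automorphisms fixing [O_n] *)

Theorem theorem6p11 (R : realType) (S : set nat)
    (S_gt1 : forall a, S a -> (1 < a)%N)
    (S_coprime : forall a b, S a -> S b -> a <> b -> coprime a b)
    (Q : cstarAlgType R) (u : Q) (s : gen_monoid S -> Q)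
    (Q_universal : is_universal_Q u s) :
  exists (beta : (gen_monoid S -> circle R -> circle R) -> Q -> Q)
         (gamma : (frac_group S -> circle R) -> Q -> Q),
    [/\ is_beta u s beta, is_gauge_action u s gamma &
        forall n : gen_monoid S, (2 <= n)%N ->
          is_comp_subgroup (Aut_fix (O_alg u s n))
                           (Aut_fix (cstar_gen [set u])) /\
          forall psi, Hom_theta psi ->
            (Aut_fix (O_alg u s n) (beta psi) <->
               Hom_circle psi /\ psi n = (fun=> 1%g)) /\
            (Aut_fix (O_alg u s n) (beta psi) <->
               exists chi, [/\ dual_frac chi, chi (frac_of n) = 1%g &
                               beta psi = gamma chi])].
Proof.
exists (beta u s), (gamma u s); split.
- exact: is_beta_beta.
- exact: is_gauge_gamma.
move=> n n1; split.
  split; [exact: Aut_fix_group|exact: Aut_fix_group|].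
  move=> phi hphi; have phiu := fix_O_u S_gt1 Q_universal n1 hphi.
  case: (hphi) => hb _; split=> //; case: (hb) => hh _.
  by apply: (star_hom_eq_gen hh (star_hom_id Q)) => x ->.
move=> psi hpsi; have iff := fix_O_iff Q_universal n1 hpsi; split=> //.
split.
  move=> /iff[[chi [chi1 chiM psiE]] pn].
  have [chi' [dchi chiE]] := char_extend S_gt1 chiM.
  exists chi'; split=> //.
    by rewrite chiE; have := congr1 (fun f => f 1%g) pn; rewrite psiE.
  rewrite /gamma psiE; congr (beta u s _); apply/funext => p; apply/funext => z.
  by rewrite chiE.
move=> [chi [dchi chin E]]; apply/iff.
have -> : psi = fun p _ => chi (frac_of p).
  by apply: (beta_inj S_gt1 Q_universal hpsi (gamma_Hom dchi)); exact: E.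
split; last by apply/funext => z; rewrite chin.
exists (fun p => chi (frac_of p)); split=> //.
  by apply: (@circle_mulgI _ (chi (frac_of 1%g))); rewrite -dual_fracM // !mulg1.
by move=> p q; rewrite dual_fracM.
Qed.
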